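(* Assume that there exist $p,q\in(1,\infty]$ with \[ \frac1p+\frac1q<\frac{2}{d'} \] such that $\bar\mu_p:=\sup_{x\in V}\bar\mu_p(x)<\infty$ and $\bar\nu_q:=\sup_{x\in V}\bar\nu_q(x)<\infty$. Assume moreover that there exists $C_{\mathrm{deg}}\in[1,\infty)$ such that $|\{y:y\sim x\}|\le C_{\mathrm{deg}}$ for all $x\in V$. Then there exist constants $c_5,c_6,c_7,c_8\in(0,\infty)$, depending only on $d,p,q,\bar\mu_p,\bar\nu_q$ (and on the constants $d',C_{\mathrm{reg}},C_{\mathrm{S}_1},C_{\mathrm{deg}}$ of the fixed graph $G$), and $\gamma=\gamma(d,p,q)$ (depending also on $d'$), such that for any given $t>0$ and $x\in V$ with $\sqrt t\ge N(x)\vee2\,(N_1(x)\vee N_2(x))$ and for all $y\in V$ the following hold. (i) If $d^\omega(x,y)\le c_5t$, then \[ p^\omega(t,x,y)\le c_6\,t^{-d/2}\Big(1+\frac{d(x,y)}{\sqrt t}\Big)^{\gamma}\exp\!\big(-c_7\,d^\omega(x,y)^2/t\big). \] (ii) If $d^\omega(x,y)\ge c_5t$, then \[ p^\omega(t,x,y)\le c_6\,t^{-d/2}\Big(1+\frac{d(x,y)}{\sqrt t}\Big)^{\gamma}\exp\!\Big(-c_8\,d^\omega(x,y)\Big(1\vee\log\frac{d^\omega(x,y)}{t}\Big)\Big). \]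
   Context: Graph. $G=(V,E)$ is an infinite, connected, locally finite graph with vertex set $V$ and non-oriented edge set $E$; $x\sim y$ means $\{x,y\}\in E$; $d(x,y)$ denotes the natural graph distance, $B(x,r):=\{y\in V: d(x,y)\le r\}$, and $|A|$ is the number of elements of $A\subset V$. Standing assumption on $G$: (i) there exist a number $d\ge2$ and $C_{\mathrm{reg}}\in(0,\infty)$ such that for all $x\in V$ there is $N_1(x)<\infty$ with $C_{\mathrm{reg}}^{-1}n^d\le|B(x,n)|\le C_{\mathrm{reg}}n^d$ for all $n\ge N_1(x)$; (ii) there exist $d'\ge d$ and $C_{\mathrm{S}_1}\in(0,\infty)$ such that for all $x\in V$ there is $N_2(x)<\infty$ such that for all $n\ge N_2(x)$ \[ \Big(\sum_{y\in B(x,n)}|u(y)|^{\frac{d'}{d'-1}}\Big)^{\frac{d'-1}{d'}}\le C_{\mathrm{S}_1}\,n^{1-\frac d{d'}}\sum_{\{y,z\}\in E,\ y\in B(x,n)\text{ or }z\in B(x,n)}|u(y)-u(z)| \] for all $u:V\to\mathbb R$ with $\operatorname{supp}u\subset B(x,n)$. The numbers $d,d',C_{\mathrm{reg}},C_{\mathrm{S}_1},N_1(x),N_2(x)$ are fixed. (The letter $d$ denotes both the exponent and, when written $d(x,y)$, the graph distance.) Weights. $\omega=\{\omega(e)\in(0,\infty):e\in E\}$ is a fixed family of positive weights, $\omega(x,y)=\omega(y,x)=\omega(\{x,y\})$ if $\{x,y\}\in E$ and $\omega(x,y)=0$ otherwise, $\mu^\omega(x):=\sum_{y\sim x}\omega(x,y)$,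 $\nu^\omega(x):=\sum_{y\sim x}1/\omega(x,y)$. Variable speed random walk. $X=(X_t)_{t\ge0}$ is the continuous-time Markov chain on $V$ with generator $(\mathcal L^\omega_{\mathrm V}f)(x)=\sum_{y\sim x}\omega(x,y)(f(y)-f(x))$, i.e. it waits at $x$ an exponential time with mean $1/\mu^\omega(x)$ and then jumps to $y$ with probability $\omega(x,y)/\mu^\omega(x)$; $\mathrm P^\omega_x$ is its law started at $x$, and its heat kernel is $p^\omega(t,x,y):=\mathrm P^\omega_x[X_t=y]$. Chemical distance. $d^\omega(x,y):=\inf_\gamma\sum_{i=0}^{l_\gamma-1}1\wedge\omega(z_i,z_{i+1})^{-1/2}$, the infimum over all paths $\gamma=(z_0,\dots,z_{l_\gamma})$ in $G$ connecting $x$ and $y$. Norms. For finite non-empty $A\subset V$: $\|f\|_{p,A}:=\big(\frac1{|A|}\sum_{x\in A}|f(x)|^p\big)^{1/p}$ for $p\in[1,\infty)$ and $\|f\|_{\infty,A}:=\max_{x\in A}|f(x)|$. Set $\bar\mu_p(x):=\limsup_{n\to\infty}\|\mu^\omega\|_{p,B(x,n)}$ and $\bar\nu_q(x):=\limsup_{n\to\infty}\|\nu^\omega\|_{q,B(x,n)}$. When these are finite, for every $x\in V$, $N(x)=N(x,\omega)<\infty$ denotes a number such that $\sup_{n\ge N(x)}\|\mu^\omega\|_{p,B(x,n)}\le2\bar\mu_p(x)$ and $\sup_{n\ge N(x)}\|\nu^\omega\|_{q,B(x,n)}\le2\bar\nu_q(x)$. Conventions: $1/\infty=0$, $a\vee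 b=\max\{a,b\}$, $a\wedge b=\min\{a,b\}$. *)

(* Defs.v *)
From HB Require Import structures.
From mathcomp Require Import all_boot all_order all_algebra finmap.
From mathcomp Require Import all_classical all_reals all_analysis.

Set Implicit Arguments.
Unset Strict Implicit.
Unset Printing Implicit Defensive.

Import Order.TTheory GRing.Theory Num.Theory.
Import numFieldNormedType.Exports.

Local Open Scope classical_set_scope.
Local Open Scope ring_scope.

(** * Graphs

    A graph on [V] is its adjacency relation [adj : rel V]; a path
    [(z_0, ..., z_l)] is stored as in [path.v], that is as its starting point
    [z_0] together with the sequence [[:: z_1; ...; z_l]].
    [\sum_(i \in A) F i] is the sum over a classical set of [fsbigop.v]; all the
    sets it is used with below are finite on a locally finite graph. *)

Definition neighbours (V : choiceType) (adj : rel V) (x : V) : set V :=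
  [set y | adj x y].

Definition paths (V : choiceType) (adj : rel V) (x y : V) : set (seq V) :=
  [set s | path adj x s /\ last x s = y].

Definition card_set (T : choiceType) (A : set T) : nat := #|` fset_set A|%fset.

Record infinite_graph (V : choiceType) (adj : rel V) : Prop := InfiniteGraph {
  graph_sym : symmetric adj;
  graph_irrefl : irreflexive adj;
  graph_infinite : infinite_set [set: V];
  graph_connected : forall x y, paths adj x y !=set0;
  graph_locally_finite : forall x, finite_set (neighbours adj x)
}.

Definition graph_dist (R : realType) (V : choiceType) (adj : rel V)
    (x y : V) : R :=
  inf [set (size s)%:R | s in paths adj x y].

Definition gball (R : realType) (V : choiceType) (adj : rel V)
    (x : V) (r : R) : set V :=
  [set y | graph_dist R adj x y <= r].

Definition volume_regular (R : realType) (V : choiceType) (adj : rel V)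
    (d Creg : R) (N1 : V -> R) : Prop :=
  forall (x : V) (n : nat), N1 x <= n%:R ->
    Creg^-1 * n%:R `^ d <= (card_set (gball adj x (n%:R : R)))%:R
    /\ (card_set (gball adj x (n%:R : R)))%:R <= Creg * n%:R `^ d.

(** The sum of [|u y - u z|] over the non-oriented edges meeting [B]: each such
    edge corresponds to the two ordered pairs [(y, z)] and [(z, y)], whence the
    factor 1/2. *)
Definition edge_variation (R : realType) (V : choiceType) (adj : rel V)
    (B : set V) (u : V -> R) : R :=
  2^-1 * \sum_(e \in [set e : V * V | adj e.1 e.2 /\ (B e.1 \/ B e.2)])
           `|u e.1 - u e.2|.

Definition isoperimetric_sobolev (R : realType) (V : choiceType) (adj : rel V)
    (d d' CS1 : R) (N2 : V -> R) : Prop :=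
  forall (x : V) (n : nat), N2 x <= n%:R ->
  forall u : V -> R, (forall y, u y != 0 -> gball adj x (n%:R : R) y) ->
    (\sum_(y \in gball adj x (n%:R : R)) `|u y| `^ (d' / (d' - 1)))
      `^ ((d' - 1) / d')
    <= CS1 * n%:R `^ (1 - d / d')
       * edge_variation adj (gball adj x (n%:R : R)) u.

Definition bounded_degree (R : realType) (V : choiceType) (adj : rel V)
    (Cdeg : R) : Prop :=
  forall x, (card_set (neighbours adj x))%:R <= Cdeg.

(** * Weights *)

Record edge_weights (R : realType) (V : choiceType) (adj : rel V)
    (omega : V -> V -> R) : Prop := EdgeWeights {
  weight_sym : forall x y, omega x y = omega y x;
  weight_gt0 : forall x y, adj x y -> 0 < omega x y;
  weight_eq0 : forall x y, ~~ adj x y -> omega x y = 0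
}.

Definition mu (R : realType) (V : choiceType) (adj : rel V)
    (omega : V -> V -> R) (x : V) : R :=
  \sum_(y \in neighbours adj x) omega x y.

Definition nu (R : realType) (V : choiceType) (adj : rel V)
    (omega : V -> V -> R) (x : V) : R :=
  \sum_(y \in neighbours adj x) (omega x y)^-1.

Definition chemical_dist (R : realType) (V : choiceType) (adj : rel V)
    (omega : V -> V -> R) (x y : V) : R :=
  inf [set \sum_(l <- pairmap (fun z z' =>
                         Num.min 1 (omega z z' `^ (- 2^-1))) x s) l
      | s in paths adj x y].

(** * Averaged norms *)

(** Only meant for [1 <= p]; the value at [-oo] is a dummy. *)
Definition avg_norm (R : realType) (V : choiceType) (p : \bar R) (A : set V)
    (f : V -> R) : R :=
  match p with
  | r%:E%E => ((card_set A)%:R^-1 * \sum_(x \in A) `|f x| `^ r) `^ r^-1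
  | +oo%E => \big[Num.max/0]_(x <- fset_set A) `|f x|
  | -oo%E => 0
  end.

Definition limsup_norm (R : realType) (V : choiceType) (adj : rel V)
    (p : \bar R) (f : V -> R) (x : V) : \bar R :=
  limn_esup (fun n : nat => (avg_norm p (gball adj x (n%:R : R)) f)%:E).

Definition sup_limsup_norm (R : realType) (V : choiceType) (adj : rel V)
    (p : \bar R) (f : V -> R) : \bar R :=
  ereal_sup [set limsup_norm adj p f x | x in [set: V]].

Definition norm_controlled_from (R : realType) (V : choiceType) (adj : rel V)
    (p : \bar R) (f : V -> R) (N : V -> R) : Prop :=
  forall x,
    (ereal_sup [set (avg_norm p (gball adj x (n%:R : R)) f)%:E
               | n in [set n : nat | (N x <= n%:R)%R]]
     <= 2%:E * limsup_norm adj p f x)%E.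

(** * The variable speed random walk

    The walk is given by its successive positions [Y 0, Y 1, ...] and by the
    times [T 0, T 1, ...] that it spends there.  The law requirement states that
    [Y] is the Markov chain started at [x] with transition probabilities
    [omega z z' / mu z] and that, given [Y], the [T n] are independent
    exponential variables with means [1 / mu (Y n)]. *)

Record variable_speed_walk (R : realType) (V : choiceType) (adj : rel V)
    (omega : V -> V -> R) (dOmega : measure_display)
    (Omega : measurableType dOmega) (P : V -> probability Omega R)
    (Y : nat -> Omega -> V) (T : nat -> Omega -> R) : Prop :=
  VariableSpeedWalk {
  walk_pos_measurable : forall n z, measurable [set w | Y n w = z];
  walk_time_measurable : forall n, measurable_fun [set: Omega] (T n);
  walk_time_ge0 : forall n w, 0 <= T n w;
  walk_law : forall (x : V) (n : nat) (z : nat -> V) (s : nat -> R),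
    (forall i, 0 <= s i) ->
    P x [set w | forall i, (i <= n)%N -> Y i w = z i /\ s i < T i w]
    = ((z 0 == x)%:R
       * \prod_(i < n) (omega (z i) (z i.+1) / mu adj omega (z i))
       * \prod_(i < n.+1) expR (- (mu adj omega (z i) * s i)))%:E
}.

Definition jump_time (R : realType) (Omega : Type) (T : nat -> Omega -> R)
    (n : nat) (w : Omega) : R :=
  \sum_(i < n) T i w.

(** The position at time [t]; [None] is the cemetery, reached if infinitely many
    jumps occur before time [t]. *)
Definition walk_at (R : realType) (V : choiceType) (Omega : Type)
    (Y : nat -> Omega -> V) (T : nat -> Omega -> R) (t : R) (w : Omega) :
    option V :=
  xget None [set o | exists n : nat,
    jump_time T n w <= t < jump_time T n.+1 w /\ o = Some (Y n w)].

Definition heat_kernel (R : realType) (V : choiceType)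
    (dOmega : measure_display) (Omega : measurableType dOmega)
    (P : V -> probability Omega R)
    (Y : nat -> Omega -> V) (T : nat -> Omega -> R) (t : R) (x y : V) : R :=
  fine (P x [set w | walk_at Y T t w = Some y]).

(* Main.v *)
Require Import Defs.
From HB Require Import structures.
From mathcomp Require Import all_boot all_order all_algebra finmap.
From mathcomp Require Import all_classical all_reals all_analysis.
From mathcomp Require Import ring lra.

Set Implicit Arguments.
Unset Strict Implicit.
Unset Printing Implicit Defensive.

Import Order.TTheory GRing.Theory Num.Theory.
Import numFieldNormedType.Exports.

Local Open Scope classical_set_scope.
Local Open Scope ring_scope.

(** Time is discretised.  With [h = t / n], splitting the holding times of the
    walk into bins of length [h] bounds its law at time [t] by the [n]-th power of
    the resolvent [(1 - h L)^-1] of the generator killed outside a large finite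
    box, up to a factor tending to 1; so only finite sums have to be estimated.

    The isoperimetric Sobolev inequality, applied to a power of a test function
    and combined with Hoelder's inequality, yields a Faber-Krahn inequality whose
    gain [2/d' - 1/p - 1/q] is positive.  De Giorgi's iteration and Nash's
    inequality then give an L^2 mean value inequality on balls of radius about
    [sqrt t] around [x] and around [y], with all constants taken from the single
    ball around [x] of radius about [d(x,y) + sqrt t]; this is the origin of the
    factor [(1 + d(x,y) / sqrt t) ^ gamma].

    Davies' method with the perturbation [psi = - lam * d^omega(x, .)] inserts the
    factor [exp (- lam d^omega(x,y) + Cdeg lam^2 e^lam t)], because
    [omega(y,z) |psi(y) - psi(z)|^2 <= lam^2] along each edge.  The choices
    [lam ~ d^omega / t] and [lam ~ max(1, log (d^omega / t))] give (i) and (ii). *)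

(** * Elementary inequalities *)

Section Inequalities.
Variable R : realType.
Implicit Types (a b c x y z : R).

(** Two obstacles shape the proof. The radius [N y] of the endpoint [y] is not controlled by
    [sqrt t], so all norms of the weights are taken on one ball around [x] that contains the balls
    of radius about [sqrt t] around both endpoints. And the weights are bounded only in averaged
    norms. A cutoff function produces the mass [\sum_z om y z] in the energy estimate, so De
    Giorgi's iteration runs in the norm weighted by this mass, and the Faber-Krahn inequality
    carries the same weight; the inverse weights enter through Cauchy-Schwarz on the edges. Davies'
    method, however, needs the unweighted L^2 norm, for which the generator is symmetric. Passing
    from one norm to the other costs a power [a < 1] of the supremum, which is absorbed.

    The resolvent replaces the heat semigroup because its existence, positivity and symmetry follow
    from linear algebra and a minimum principle, and because an implicit Euler step has the
    favourable sign in every energy estimate. Only an upper bound on the law of the walk is needed,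
    so each term may be bounded separately according to the number of jumps. *)

Lemma amgm3_gt0 a b c x y z : 0 <= a -> 0 <= b -> 0 <= c -> a + b + c = 1 ->
  0 < x -> 0 < y -> 0 < z ->
  x `^ a * y `^ b * z `^ c <= a * x + b * y + c * z.
Proof.
move=> a0 b0 c0 abc x0 y0 z0.
set g := _ * _ * _.
have g0 : 0 < g by rewrite !mulr_gt0 ?powR_gt0.
have lng : ln g = a * ln x + b * ln y + c * ln z.
  by rewrite /g !lnM ?posrE ?mulr_gt0 ?powR_gt0// !ln_powR.
(* Tangent of the exponential at 0. The weighted average of the left-hand sides is 1, because [ln g]
   is the weighted average of the logarithms. *)
have tang t : 0 < t -> 1 + (ln t - ln g) <= t / g.
  move=> t0; have := expR_ge1Dx (ln t - ln g).
  rewrite expRD expRN (lnK (_ : t \is Num.pos))// (lnK (_ : g \is Num.pos))//; exact.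
rewrite -[leLHS]mul1r -ler_pdivlMr//.
have : a * (1 + (ln x - ln g)) + b * (1 + (ln y - ln g))
       + c * (1 + (ln z - ln g)) <= a * (x / g) + b * (y / g) + c * (z / g).
  by rewrite !lerD// ler_wpM2l// tang.
suff -> : a * (1 + (ln x - ln g)) + b * (1 + (ln y - ln g))
       + c * (1 + (ln z - ln g)) = 1.
  by move=> /le_trans; apply; rewrite !mulrDl !mulrA.
rewrite lng; have -> : c = 1 - a - b by lra.
ring.
Qed.

Lemma amgm3 a b c x y z : 0 < a -> 0 < b -> 0 < c -> a + b + c = 1 ->
  0 <= x -> 0 <= y -> 0 <= z ->
  x `^ a * y `^ b * z `^ c <= a * x + b * y + c * z.
Proof.
move=> a0 b0 c0 abc x0 y0 z0.
have rhs : 0 <= a * x + b * y + c * z by rewrite !addr_ge0// mulr_ge0// ltW.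
have [xz|xn] := eqVneq x 0.
  by move: rhs; rewrite xz powR0 ?gt_eqF// !(mul0r, mulr0).
have [yz|yn] := eqVneq y 0.
  by move: rhs; rewrite yz (powR0 (_ : b != 0)) ?gt_eqF// !(mul0r, mulr0).
have [zz|zn] := eqVneq z 0.
  by move: rhs; rewrite zz (powR0 (_ : c != 0)) ?gt_eqF// !(mul0r, mulr0).
by apply: amgm3_gt0 => //; rewrite ?ltW// lt_def ?xn ?yn ?zn.
Qed.

(** Normalising the three sums to 1 reduces this to [amgm3], term by term; a vanishing sum forces
    all its terms to vanish. *)
Lemma holder3 (I : finType) a b c (f g h : I -> R) :
  0 < a -> 0 < b -> 0 < c -> a + b + c = 1 ->
  (forall i, 0 <= f i) -> (forall i, 0 <= g i) -> (forall i, 0 <= h i) ->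
  \sum_i (f i `^ a * g i `^ b * h i `^ c)
  <= (\sum_i f i) `^ a * (\sum_i g i) `^ b * (\sum_i h i) `^ c.
Proof.
move=> a0 b0 c0 abc f0 g0 h0.
have sum0 (k : I -> R) : (forall i, 0 <= k i) -> \sum_i k i = 0 ->
    forall i, k i = 0.
  move=> k0 /eqP; rewrite psumr_eq0// => /allP k00 i.
  by apply/eqP; apply: k00; rewrite mem_index_enum.
have [F0|F0] := eqVneq (\sum_i f i) 0.
  rewrite F0 powR0 ?gt_eqF// !mul0r big1// => i _.
  by rewrite (sum0 f)// powR0 ?gt_eqF// !mul0r.
have [G0|G0] := eqVneq (\sum_i g i) 0.
  rewrite G0 [X in _ <= _ * X * _]powR0 ?(gt_eqF b0)// mulr0 mul0r big1// => i _.
  by rewrite (sum0 g)// [X in _ * X * _]powR0 ?(gt_eqF b0)// mulr0 mul0r.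
have [H0|H0] := eqVneq (\sum_i h i) 0.
  rewrite H0 [X in _ <= _ * X]powR0 ?(gt_eqF c0)// mulr0 big1// => i _.
  by rewrite (sum0 h)// [X in _ * X]powR0 ?(gt_eqF c0)// mulr0.
set F := \sum_i f i in F0 *; set G := \sum_i g i in G0 *; set H := \sum_i h i in H0 *.
have Fp : 0 < F by rewrite lt_def F0 sumr_ge0.
have Gp : 0 < G by rewrite lt_def G0 sumr_ge0.
have Hp : 0 < H by rewrite lt_def H0 sumr_ge0.
have term i : f i `^ a * g i `^ b * h i `^ c <=
    (a * (f i / F) + b * (g i / G) + c * (h i / H)) * (F `^ a * G `^ b * H `^ c).
  have -> : f i `^ a * g i `^ b * h i `^ c =
      ((f i / F) `^ a * (g i / G) `^ b * (h i / H) `^ c)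
      * (F `^ a * G `^ b * H `^ c).
    have {1}-> : f i = f i / F * F by rewrite divfK.
    have {1}-> : g i = g i / G * G by rewrite divfK.
    have {1}-> : h i = h i / H * H by rewrite divfK.
    have [Fw Gw Hw] : [/\ 0 <= F, 0 <= G & 0 <= H] by split; exact: ltW.
    have [fF gG hH] : [/\ 0 <= f i / F, 0 <= g i / G & 0 <= h i / H].
      by split; rewrite divr_ge0.
    rewrite (powRM a fF Fw) (powRM b gG Gw) (powRM c hH Hw).
    ring.
  rewrite ler_wpM2r// ?mulr_ge0 ?powR_ge0//.
  by apply: amgm3 => //; rewrite divr_ge0// ltW.
apply: (le_trans (ler_sum _ (fun i _ => term i))).
rewrite -mulr_suml !big_split/= -!mulr_sumr -!mulr_suml.
by rewrite -/F -/G -/H !divff// !mulr1 abc mul1r.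
Qed.

(** Convexity of the power, obtained without calculus from Young's inequality with the conjugate
    exponents [a / (a - 1)] and [a]. *)
Lemma powR_sub_le a x y : 1 < a -> 0 <= y -> y <= x ->
  x `^ a - y `^ a <= a * x `^ (a - 1) * (x - y).
Proof.
move=> a1 y0 yx; have a0 : 0 < a by lra.
have x0 : 0 <= x by lra.
have [xz|xz] := eqVneq x 0.
  have yz : y = 0 by lra.
  by rewrite xz yz !subrr mulr0.
have yng : a * (x `^ (a - 1) * y) <= (a - 1) * x `^ a + y `^ a.
  have aN0 : a != 0 by rewrite gt_eqF.
  have a1N0 : a - 1 != 0 by rewrite gt_eqF// subr_gt0.
  have := @conjugate_powR R (x `^ (a - 1)) y (a / (a - 1)) a.
  move=> /(_ (powR_ge0 _ _) y0).
  have h1 : 0 < a / (a - 1) by rewrite divr_gt0// subr_gt0.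
  move=> /(_ h1 a0).
  have e : (a / (a - 1))^-1 + a^-1 = 1 by field; apply/andP.
  move=> /(_ e); rewrite -powRrM.
  have -> : (a - 1) * (a / (a - 1)) = a by field.
  move=> h; apply: le_trans (ler_wpM2l (ltW a0) h) _.
  rewrite mulrDr (_ : a * (x `^ a / (a / (a - 1))) = (a - 1) * x `^ a); last first.
    by field; apply/andP.
  by rewrite (_ : a * (y `^ a / a) = y `^ a)//; field.
have xx : x `^ (a - 1) * x = x `^ a by rewrite mulrC mulr_powRB1.
nra.
Qed.

Lemma powR_dist_le a x y : 1 < a -> 0 <= x -> 0 <= y ->
  `|x `^ a - y `^ a| <= a * (x `^ (a - 1) + y `^ (a - 1)) * `|x - y|.
Proof.
move=> a1; wlog yx : x y / y <= x.
  move=> h x0 y0; have [yx|/ltW xy] := leP y x; first exact: h.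
  by rewrite distrC (distrC x y) (addrC (x `^ _)); exact: h.
move=> x0 y0.
rewrite (ger0_norm (_ : 0 <= x - y)) ?subr_ge0//.
rewrite ger0_norm ?subr_ge0; last by rewrite ge0_ler_powR ?nnegrE//; lra.
apply: (le_trans (powR_sub_le a1 y0 yx)).
rewrite ler_wpM2r ?subr_ge0// ler_wpM2l ?lerDl ?powR_ge0//; lra.
Qed.

(** The left-hand side is [expR (- b) * (expR b - 1) ^+ 2], and [expR b - 1 <= b * expR b]. *)
Lemma expR_sym_le b : 0 <= b -> expR b + expR (- b) - 2 <= b ^+ 2 * expR b.
Proof.
move=> b0.
have e0 : 0 < expR b by exact: expR_gt0.
have eN : expR (- b) * expR b = 1 by rewrite -expRD addNr expR0.
have eN0 : 0 < expR (- b) by exact: expR_gt0.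
have e1 : expR b - 1 <= b * expR b.
  have := expR_ge1Dx (- b); nra.
have e2 : 0 <= expR b - 1.
  have := expR_ge1Dx b; lra.
have -> : expR b + expR (- b) - 2 = expR (- b) * (expR b - 1) ^+ 2.
  rewrite (_ : expR (- b) * (expR b - 1) ^+ 2 =
    (expR (- b) * expR b) * expR b - 2 * (expR (- b) * expR b) + expR (- b)); last by ring.
  by rewrite eN; ring.
have : (expR b - 1) ^+ 2 <= (b * expR b) ^+ 2.
  by rewrite lerXn2r// nnegrE mulr_ge0// ltW.
move=> h; apply: le_trans (ler_wpM2l (ltW eN0) h) _.
rewrite (_ : expR (- b) * (b * expR b) ^+ 2 = (expR (- b) * expR b) * (b ^+ 2 * expR b)); last by ring.
by rewrite eN mul1r.
Qed.

Lemma ln1Dx_ge x : 0 <= x -> x <= 1 -> x / 2 <= ln (1 + x).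
Proof.
move=> x0 x1; rewrite -[leLHS]expRK ler_ln ?posrE ?expR_gt0//; last by lra.
have e0 := expR_gt0 (x / 2).
have := expR_ge1Dx (- (x / 2)).
have : expR (- (x / 2)) * expR (x / 2) = 1 by rewrite -expRD addNr expR0.
nra.
Qed.

(** Valid for every [a > 0] at the price of the factor 1/2; it replaces differentiation in the
    discrete Nash argument. *)
Lemma powR1Dx_ge a x : 0 < a -> 0 <= x -> x <= 1 -> 1 + a * x / 2 <= (1 + x) `^ a.
Proof.
move=> a0 x0 x1; rewrite /powR gt_eqF; last by lra.
apply: le_trans (expR_ge1Dx _) _; rewrite ler_expR; have := ln1Dx_ge x0 x1; nra.
Qed.

(** An exponential time outlasts [n] bins with at most the weight that [n] resolvent steps give to
    staying put. This direction of the inequality lets the resolvent dominate the walk. *)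
Lemma exp1Dx_le x (n : nat) : 0 <= x -> expR (- (x * n%:R)) <= ((1 + x)^-1) ^+ n.
Proof.
move=> x0; rewrite expRN exprVn lef_pV2 ?posrE ?exprn_gt0 ?expR_gt0//; last by lra.
by rewrite expRM_natr lerXn2r ?nnegrE ?expR_ge0 ?expR_ge1Dx//; lra.
Qed.

End Inequalities.

(** * Faber-Krahn inequality *)

Section FaberKrahn.
Variables (R : realType) (I : finType).

(** Lagrange's identity. *)
Lemma cauchy_schwarz (J : finType) (f g : J -> R) :
  (\sum_i f i * g i) ^+ 2 <= (\sum_i f i ^+ 2) * (\sum_i g i ^+ 2).
Proof.
have : 0 <= \sum_i \sum_j (f i * g j - f j * g i) ^+ 2.
  by apply: sumr_ge0 => i _; apply: sumr_ge0 => j _; rewrite sqr_ge0.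
have -> : \sum_i \sum_j (f i * g j - f j * g i) ^+ 2 =
    \sum_i \sum_j (f i ^+ 2 * g j ^+ 2) + \sum_i \sum_j (f j ^+ 2 * g i ^+ 2)
    - 2 * \sum_i \sum_j (f i * g i * (f j * g j)).
  rewrite mulr_sumr -sumrN -!big_split/=; apply: eq_bigr => i _.
  rewrite mulr_sumr -sumrN -!big_split/=; apply: eq_bigr => j _; ring.
rewrite [X in _ + X - _]exchange_big/=.
have -> : \sum_i \sum_j f i * g i * (f j * g j) = (\sum_i f i * g i) ^+ 2.
  by rewrite expr2 mulr_suml; apply: eq_bigr => i _; rewrite mulr_sumr.
have -> : \sum_i \sum_j f i ^+ 2 * g j ^+ 2 =
    (\sum_i f i ^+ 2) * (\sum_i g i ^+ 2).
  by rewrite mulr_suml; apply: eq_bigr => i _; rewrite mulr_sumr.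
lra.
Qed.

Definition energy (om : I -> I -> R) (w : I -> R) : R :=
  2^-1 * \sum_y \sum_z om y z * (w y - w z) ^+ 2.

Definition gradient_sum (om : I -> I -> R) (w : I -> R) : R :=
  2^-1 * \sum_y \sum_z (om y z != 0)%:R * `|w y - w z|.

Variable om : I -> I -> R.
Hypothesis om_sym : forall y z, om y z = om z y.
Hypothesis om_ge0 : forall y z, 0 <= om y z.

Lemma energy_ge0 w : 0 <= energy om w.
Proof.
by rewrite mulr_ge0//; apply: sumr_ge0 => y _; apply: sumr_ge0 => z _;
  rewrite mulr_ge0 ?sqr_ge0.
Qed.

(** Cauchy-Schwarz over the edges, with [om] attached to the increments and [om^-1] to the powers.
    Pairs that are not edges contribute nothing, because the inverse of 0 is 0. *)
Lemma gradient_sum_powR_le (al : R) (w : I -> R) : 1 < al -> (forall y, 0 <= w y) ->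
  gradient_sum om (fun y => w y `^ al) ^+ 2 <=
  2 * al ^+ 2 * energy om w
  * \sum_y (\sum_z (om y z)^-1) * (w y `^ (al - 1)) ^+ 2.
Proof.
move=> al1 w0; have al0 : 0 <= al by lra.
pose s y := w y `^ (al - 1).
pose f (e : I * I) := Num.sqrt (om e.1 e.2) * `|w e.1 - w e.2|.
pose g (e : I * I) := (Num.sqrt (om e.1 e.2))^-1 * (s e.1 + s e.2).
have s0 y : 0 <= s y by exact: powR_ge0.
have vle : gradient_sum om (fun y => w y `^ al) <= 2^-1 * (al * \sum_e f e * g e).
  rewrite ler_pM2l// (pair_big xpredT xpredT)/= mulr_sumr.
  apply: ler_sum => -[y z] _; rewrite /f /g/=.
  have [->|omN0] := eqVneq (om y z) 0.
    by rewrite sqrtr0 !mul0r mulr0.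
  have sN0 : Num.sqrt (om y z) != 0.
    by rewrite sqrtr_eq0 -ltNge lt_def omN0 om_ge0.
  rewrite mul1r (_ : al * _ = al * (s y + s z) * `|w y - w z|); last first.
    by field.
  exact: powR_dist_le.
have v0 : 0 <= gradient_sum om (fun y => w y `^ al).
  by rewrite mulr_ge0//; apply: sumr_ge0 => y _; apply: sumr_ge0 => z _;
    rewrite mulr_ge0.
have : gradient_sum om (fun y => w y `^ al) ^+ 2 <=
    (2^-1 * (al * \sum_e f e * g e)) ^+ 2.
  by rewrite lerXn2r// nnegrE (le_trans v0).
move=> /le_trans; apply; rewrite !exprMn.
have Ef : \sum_e f e ^+ 2 = 2 * energy om w.
  rewrite /energy mulrA divff// mul1r (pair_big xpredT xpredT)/=.
  apply: eq_bigr => -[y z] _.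
  by rewrite /f/= exprMn sqr_sqrtr// -normrX ger0_norm// sqr_ge0.
have Eg : \sum_e g e ^+ 2 <= 4 * \sum_y (\sum_z (om y z)^-1) * s y ^+ 2.
  have -> : 4 * (\sum_y (\sum_z (om y z)^-1) * s y ^+ 2) =
     \sum_e (om e.1 e.2)^-1 * (2 * s e.1 ^+ 2 + 2 * s e.2 ^+ 2).
    under [RHS]eq_bigr do rewrite mulrDr.
    rewrite big_split/=.
    have -> : \sum_(e : I * I) (om e.1 e.2)^-1 * (2 * s e.1 ^+ 2) =
       2 * \sum_y (\sum_z (om y z)^-1) * s y ^+ 2.
      rewrite -(pair_big xpredT xpredT (fun y z => (om y z)^-1 * (2 * s y ^+ 2)))/=.
      rewrite mulr_sumr; apply: eq_bigr => y _; rewrite mulr_suml mulr_sumr.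
      by apply: eq_bigr => z _; ring.
    have -> : \sum_(e : I * I) (om e.1 e.2)^-1 * (2 * s e.2 ^+ 2) =
       2 * \sum_y (\sum_z (om y z)^-1) * s y ^+ 2.
      rewrite -(pair_big xpredT xpredT (fun y z => (om y z)^-1 * (2 * s z ^+ 2)))/=.
      rewrite exchange_big/= mulr_sumr; apply: eq_bigr => y _.
      rewrite mulr_suml mulr_sumr.
      by apply: eq_bigr => z _; rewrite om_sym; ring.
    lra.
  apply: ler_sum => -[y z] _; rewrite /g/= exprMn exprVn sqr_sqrtr//.
  by rewrite ler_wpM2l ?invr_ge0//; have := sqr_ge0 (s y - s z); nra.
have := cauchy_schwarz f g; rewrite Ef => cs.
have E0 : 0 <= 2 * energy om w by rewrite mulr_ge0 ?energy_ge0.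
have := le_trans cs (ler_wpM2l E0 Eg).
rewrite -/s; set X := \sum_y _; set Y := _ ^+ 2 => h.
have a2 : 0 <= al ^+ 2 by rewrite sqr_ge0.
have := ler_wpM2l a2 h; nra.
Qed.

Variables (B : pred I) (a b D Cs cm cn : R) (m : I -> R).
Hypothesis ab_gt0 : [/\ 0 < a, 0 < b, a < 1 & b < 1].
Hypothesis D_gt0 : 0 < D.
Hypothesis abD : 0 < 2 - a - b - 2 * D.
Hypothesis cc_ge0 : [/\ 0 <= Cs, 0 <= cm & 0 <= cn].
Hypothesis m_ge0 : forall y, 0 <= m y.
Hypothesis sobolev : forall g : I -> R, (forall y, ~~ B y -> g y = 0) ->
  (\sum_y `|g y| `^ D^-1) `^ D <= Cs * gradient_sum om g.
Hypothesis m_norm : (\sum_(y | B y) m y `^ a^-1) `^ a <= cm.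
Hypothesis nu_norm :
  (\sum_(y | B y) (\sum_z (om y z)^-1) `^ b^-1) `^ b <= cn.

(* The power [al] of the test function [w `^ al] splits the gain
   [2 - a - b - 2 D] between the two Hoelder inequalities in the ratio
   [1 - a : 1 - b], so that both are strict. *)
Lemma faber_krahn (w : I -> R) :
  (forall y, 0 <= w y) -> (forall y, ~~ B y -> w y = 0) ->
  \sum_y m y * w y ^+ 2 <=
  2 * ((2 - a - b) / (1 - a)) ^+ 2 * Cs ^+ 2 * cm * cn
  * (\sum_y (w y != 0)%:R) `^ (2 - a - b - 2 * D) * energy om w.
Proof.
move=> w0 wB; have [a0 b0 a1 b1] := ab_gt0; have [Cs0 cm0 cn0] := cc_ge0.
set al := (2 - a - b) / (1 - a).
have al1 : 1 < al by rewrite /al ltr_pdivlMr; lra.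
have Eal0 : 0 <= 2 * al ^+ 2 * energy om w.
  by apply: mulr_ge0 (energy_ge0 _); apply: mulr_ge0 (sqr_ge0 _).
pose th : R := 1 - 2 * D / (2 - a - b).
have s0 : 0 < 2 - a - b by lra.
have th0 : 0 < th.
  rewrite /th subr_gt0 ltr_pdivrMr// mul1r; move: abD; lra.
pose e1 : R := (1 - b) * th; pose e2 : R := (1 - a) * th.
have e10 : 0 < e1 by rewrite mulr_gt0//; lra.
have e20 : 0 < e2 by rewrite mulr_gt0//; lra.
have e12 : e1 + e2 = 2 - a - b - 2 * D :> R.
  by rewrite /e1 /e2 /th; field; rewrite gt_eqF.
pose T := \sum_y w y `^ (al / D).
pose N := \sum_y (w y != 0)%:R : R.
have sN0 : 2 - a - b != 0 by rewrite gt_eqF.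
have aN0 : 1 - a != 0 by rewrite gt_eqF//; lra.
have DN0 : D != 0 by rewrite gt_eqF.
(* Chosen so that [al / D * be = 2] and [al / D * bc = 2 * (al - 1)]: the single sum [T] then serves
   in both Hoelder inequalities. *)
pose be : R := 2 * D / al; pose bc : R := 2 * D - be.
have beE : be = 2 * D * (1 - a) / (2 - a - b).
  by rewrite /be /al; field; apply/andP.
have be0 : 0 < be by rewrite beE divr_gt0// !mulr_gt0//; lra.
have bcE : bc = 2 * D * (1 - b) / (2 - a - b).
  by rewrite /bc beE; field.
have bc0 : 0 < bc by rewrite bcE divr_gt0// !mulr_gt0//; lra.
have w0w (e : R) y : 0 < e -> w y = 0 -> w y `^ e = 0.
  by move=> ep ->; rewrite powR0// gt_eqF.
have h1 : \sum_y m y * w y ^+ 2 <= cm * T `^ be * N `^ e2.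
  apply: (@le_trans _ _ ((\sum_(y | B y) m y `^ a^-1) `^ a * T `^ be * N `^ e2));
    last by rewrite -!mulrA ler_wpM2r// mulr_ge0// powR_ge0.
  rewrite [in leRHS]big_mkcond/=.
  apply: le_trans (holder3 a0 be0 e20 _ _ _ _) => //.
  - apply: ler_sum => y _.
    have [wy|wy] := eqVneq (w y) 0.
      by rewrite wy expr0n/= mulr0 !mulr_ge0// powR_ge0.
    have -> : B y by apply: contraT => /wB /eqP; rewrite (negPf wy).
    rewrite -!powRrM mulVf ?gt_eqF// powRr1// powR1 mulr1.
    rewrite (_ : al / D * be = 2%:R); last first.
      by rewrite /be; field; rewrite DN0 gt_eqF//; lra.
    by rewrite powR_mulrn.
  - by rewrite beE /e2 /th; field.
  - by move=> y; case: ifP => // _; rewrite powR_ge0.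
  - by move=> y; rewrite powR_ge0.
have h2 : \sum_y (\sum_z (om y z)^-1) * (w y `^ (al - 1)) ^+ 2 <=
    cn * T `^ bc * N `^ e1.
  apply: (@le_trans _ _ ((\sum_(y | B y) (\sum_z (om y z)^-1) `^ b^-1) `^ b
    * T `^ bc * N `^ e1));
    last by rewrite -!mulrA ler_wpM2r// mulr_ge0// powR_ge0.
  rewrite [in leRHS]big_mkcond/=.
  apply: le_trans (holder3 b0 bc0 e10 _ _ _ _) => //.
  - apply: ler_sum => y _.
    have nu0 : 0 <= \sum_z (om y z)^-1.
      by apply: sumr_ge0 => z _; rewrite invr_ge0.
    have [wy|wy] := eqVneq (w y) 0.
      rewrite wy powR0 ?gt_eqF ?subr_gt0// expr0n/= mulr0.
      by rewrite !mulr_ge0// powR_ge0.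
    have -> : B y by apply: contraT => /wB /eqP; rewrite (negPf wy).
    rewrite -!powRrM mulVf ?gt_eqF// powRr1// powR1 mulr1.
    rewrite (_ : al / D * bc = (al - 1) * 2%:R); last first.
      by rewrite /bc /be; field; rewrite DN0 gt_eqF//; lra.
    by rewrite powRrM powR_mulrn// powR_ge0.
  - by rewrite bcE /e1 /th; field.
  - by move=> y; case: ifP => // _; rewrite powR_ge0.
  - by move=> y; rewrite powR_ge0.
have h3 : T `^ (2 * D) <= Cs ^+ 2 * (2 * al ^+ 2 * energy om w) * (cn * T `^ bc * N `^ e1).
  have := sobolev (g := fun y => w y `^ al).
  have gB y : ~~ B y -> w y `^ al = 0 by move=> /wB /w0w; apply; lra.
  move=> /(_ gB).
  rewrite (_ : \sum_y _ = T); last first.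
    by apply: eq_bigr => y _; rewrite ger0_norm ?powR_ge0// -powRrM.
  move=> h; have : (T `^ D) ^+ 2 <= (Cs * gradient_sum om (fun y => w y `^ al)) ^+ 2.
    by rewrite lerXn2r// nnegrE ?powR_ge0// (le_trans _ h) ?powR_ge0.
  rewrite (mulrC 2 D) powRrM powR_mulrn ?powR_ge0// => /le_trans; apply.
  rewrite exprMn -[leRHS]mulrA ler_wpM2l ?sqr_ge0//.
  apply: le_trans (gradient_sum_powR_le al1 w0) _.
  exact: ler_wpM2l.
have T0 : 0 <= T by apply: sumr_ge0 => y _; exact: powR_ge0.
have N0 : 0 <= N by apply: sumr_ge0 => y _.
have E0 := energy_ge0 w.
have powN : N `^ (e1 + e2) = N `^ e1 * N `^ e2.
  by rewrite powRD// gt_eqF ?addr_gt0.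
rewrite -/N.
have -> : N `^ (2 - a - b - 2 * D) = N `^ e1 * N `^ e2 by rewrite -powN e12.
have [Tz|TN0] := eqVneq T 0.
  apply: le_trans h1 _; rewrite Tz powR0 ?gt_eqF// mulr0 mul0r.
  rewrite (_ : _ * energy om w = Cs ^+ 2 * (2 * al ^+ 2 * energy om w) * cm * cn
    * (N `^ e1 * N `^ e2)); last by ring.
  have := sqr_ge0 Cs; have := powR_ge0 N e1; have := powR_ge0 N e2 => *.
  apply: mulr_ge0; last exact: mulr_ge0.
  by apply: mulr_ge0 => //; apply: mulr_ge0 => //; exact: mulr_ge0.
have Tp : 0 < T by rewrite lt_def TN0.
(* As [be + bc = 2 * D], the power [bc] of [T] on the right of [h3] divides out, and what remains is
   the power needed in [h1]. *)
have h4 : T `^ be <= Cs ^+ 2 * (2 * al ^+ 2 * energy om w) * (cn * N `^ e1).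
  rewrite -(@ler_pM2r _ (T `^ bc)) ?powR_gt0//.
  rewrite -powRD; last by rewrite TN0 implybT.
  rewrite (_ : be + bc = 2 * D); last by rewrite /bc; ring.
  by apply: le_trans h3 _; rewrite le_eqVlt; apply/orP; left; apply/eqP; ring.
apply: le_trans h1 _.
have h5 := ler_wpM2l (mulr_ge0 cm0 (powR_ge0 N e2)) h4.
rewrite mulrAC; apply: le_trans h5 _.
by rewrite le_eqVlt; apply/orP; left; apply/eqP; ring.
Qed.

End FaberKrahn.

(** * Resolvent of the killed generator *)

Section Dynamics.
Variables (R : realType) (I : finType) (om : I -> I -> R) (kap : I -> R) (h : R).

Definition dform (f u : I -> R) : R :=
  2^-1 * \sum_y \sum_z om y z * ((f y - f z) * (u y - u z)).

Definition lap (u : I -> R) (y : I) : R :=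
  \sum_z om y z * (u z - u y) - kap y * u y.

Definition is_resolvent (f v : I -> R) : Prop :=
  forall y, v y - h * lap v y = f y.

(* The implicit Euler step [(1 - h * lap)^-1 f]; the default value [f] is never
   taken, by [resolvent_exists]. *)
Definition resolvent (f : I -> R) : I -> R :=
  if pselect (exists v, is_resolvent f v) is left ex then projT1 (cid ex) else f.

Hypothesis om_sym : forall y z, om y z = om z y.
Hypothesis om_ge0 : forall y z, 0 <= om y z.
Hypothesis kap_ge0 : forall y, 0 <= kap y.
Hypothesis h_gt0 : 0 < h.

Lemma sum_lap0 (f u : I -> R) :
  \sum_y f y * \sum_z om y z * (u z - u y) = - dform f u.
Proof.
have -> : \sum_y f y * \sum_z om y z * (u z - u y) =
    \sum_y \sum_z om y z * (f y * (u z - u y)).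
  by apply: eq_bigr => y _; rewrite mulr_sumr; apply: eq_bigr => z _; ring.
set S := \sum_y _.
have S2 : S = \sum_y \sum_z om y z * (f z * (u y - u z)).
  rewrite /S exchange_big/=; apply: eq_bigr => y _; apply: eq_bigr => z _.
  by rewrite om_sym.
have -> : dform f u = 2^-1 * - (S + S).
  rewrite {2}S2 /S /dform -big_split/= -sumrN; congr (_ * _).
  apply: eq_bigr => y _; rewrite -big_split/= -sumrN.
  by apply: eq_bigr => z _; ring.
lra.
Qed.

Lemma sum_lap (f u : I -> R) :
  \sum_y f y * lap u y = - dform f u - \sum_y kap y * f y * u y.
Proof.
rewrite -sum_lap0 -sumrN -big_split/=; apply: eq_bigr => y _.
by rewrite /lap; ring.
Qed.

Lemma dformC f u : dform f u = dform u f.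
Proof.
by congr (_ * _); apply: eq_bigr => y _; apply: eq_bigr => z _; rewrite (mulrC (f y - _)).
Qed.

Lemma lapZ s u y : lap (fun z => s * u z) y = s * lap u y.
Proof.
rewrite /lap [RHS]mulrBr mulr_sumr; congr (_ - _); last by ring.
by apply: eq_bigr => z _; ring.
Qed.

(** At a negative minimum in [B] both the jump part and the killing part of [lap] are nonnegative.
    The predicate [B] serves the comparison with the Dirichlet solution, where the equation holds
    only on a ball. *)
Lemma min_principle (B : pred I) (v : I -> R) :
  (forall y, ~~ B y -> 0 <= v y) ->
  (forall y, B y -> 0 <= v y - h * lap v y) -> forall y, 0 <= v y.
Proof.
move=> vB vL y.
have [y0 _ y0min] := Order.TotalTheory.arg_minP v (isT : xpredT y).
suff: 0 <= v y0 by move=> /le_trans; apply; exact: y0min.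
have [/vL vy0|/vB//] := boolP (B y0).
rewrite leNgt; apply/negP => vneg.
have : 0 <= h * lap v y0.
  rewrite mulr_ge0 ?(ltW h_gt0)// /lap subr_ge0; apply: (@le_trans _ _ 0).
    by rewrite nmulr_lle0 ?kap_ge0.
  by apply: sumr_ge0 => z _; rewrite mulr_ge0// subr_ge0 y0min.
lra.
Qed.

(** In finite dimension injectivity suffices: a vector of the kernel and its opposite are both
    nonnegative by the minimum principle. *)
Lemma resolvent_exists f : exists v, is_resolvent f v.
Proof.
pose ev := @enum_val I xpredT.
pose A : 'M[R]_#|I| := \matrix_(i, j) ((i == j)%:R
   * (1 + h * (\sum_z om (ev j) z + kap (ev j))) - h * om (ev j) (ev i)).
have AE (u : 'rV[R]_#|I|) j : (u *m A) 0 j =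
    u 0 (enum_rank (ev j)) - h * lap (fun y => u 0 (enum_rank y)) (ev j).
  rewrite mxE.
  under eq_bigr do rewrite mxE mulrBr.
  rewrite big_split/= sumrN (bigD1 j)//= eqxx mul1r.
  rewrite [X in _ + X - _]big1 ?addr0; last first.
    by move=> i /negPf ->; rewrite mul0r mulr0.
  rewrite /lap.
  have -> : \sum_z om (ev j) z * (u 0 (enum_rank z) - u 0 (enum_rank (ev j))) =
    \sum_i u 0 i * om (ev j) (ev i) - (\sum_z om (ev j) z) * u 0 (enum_rank (ev j)).
    under eq_bigr do rewrite mulrBr.
    rewrite big_split/= sumrN mulr_suml; congr (_ - _).
    rewrite (reindex ev); last by apply: onW_bij; exact: enum_val_bij.
    by apply: eq_bigr => i _; rewrite /ev enum_valK mulrC.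
  have -> : \sum_i u 0 i * (h * om (ev j) (ev i)) =
     h * \sum_i u 0 i * om (ev j) (ev i).
    by rewrite mulr_sumr; apply: eq_bigr => i _; ring.
  by rewrite /ev !enum_valK; ring.
have inj : row_free A.
  apply: inj_row_free => u uA.
  have uL (s : R) y : s * u 0 (enum_rank y) - h * lap (fun y => s * u 0 (enum_rank y)) y = 0.
    have := AE u (enum_rank y); rewrite uA mxE /ev enum_rankK.
    move=> /esym/(congr1 ( *%R s)); rewrite mulr0 => <-.
    by rewrite lapZ; ring.
  have pos s : forall y, 0 <= s * u 0 (enum_rank y).
    by apply: (@min_principle xpredT) => // y _; rewrite uL.
  apply/rowP => j; rewrite mxE.
  have := pos 1 (enum_val j); have := pos (-1) (enum_val j).
  by rewrite !enum_valK => *; lra.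
have Au : A \in unitmx by rewrite -row_free_unit.
pose b : 'rV[R]_#|I| := \row_j f (ev j).
exists (fun y => (b *m invmx A) 0 (enum_rank y)) => y.
have := AE (b *m invmx A) (enum_rank y).
by rewrite mulmxKV// /b mxE /ev !enum_rankK.
Qed.

Lemma resolventP f : is_resolvent f (resolvent f).
Proof.
rewrite /resolvent; case: pselect => [ex|[]]; last exact: resolvent_exists.
exact: projT2 (cid ex).
Qed.

Lemma resolvent_ge0 f : (forall y, 0 <= f y) -> forall y, 0 <= resolvent f y.
Proof.
move=> f0; apply: (@min_principle xpredT) => // y _.
by rewrite resolventP.
Qed.

Lemma iter_resolvent_ge0 n f :
  (forall y, 0 <= f y) -> forall y, 0 <= iter n resolvent f y.
Proof. by move=> f0; elim: n => //= n IH; exact: resolvent_ge0. Qed.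

Lemma resolvent_adj f g :
  \sum_y resolvent f y * g y = \sum_y f y * resolvent g y.
Proof.
have := resolventP f; have := resolventP g.
set u := resolvent f; set v := resolvent g => gv fu.
under eq_bigr do rewrite -gv mulrBr.
under [RHS]eq_bigr do rewrite -fu mulrBl.
rewrite !big_split/= !sumrN; congr (_ - _).
have -> : \sum_y u y * (h * lap v y) = h * \sum_y u y * lap v y.
  by rewrite mulr_sumr; apply: eq_bigr => y _; ring.
have -> : \sum_y h * lap u y * v y = h * \sum_y v y * lap u y.
  by rewrite mulr_sumr; apply: eq_bigr => y _; ring.
rewrite !sum_lap dformC; congr (_ * (_ - _)); apply: eq_bigr => y _; ring.
Qed.

Lemma iter_resolvent_adj n f g :
  \sum_y iter n resolvent f y * g y = \sum_y f y * iter n resolvent g y.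
Proof.
elim: n f g => //= n IH f g.
by rewrite resolvent_adj IH -iterSr.
Qed.

Lemma sum_resolvent_le f : (forall y, 0 <= f y) ->
  \sum_y resolvent f y <= \sum_y f y.
Proof.
move=> f0; have u0 := resolvent_ge0 f0.
have -> : \sum_y f y = \sum_y resolvent f y - h * \sum_y 1 * lap (resolvent f) y.
  rewrite mulr_sumr -sumrN -big_split/=; apply: eq_bigr => y _.
  by rewrite -[LHS]resolventP mul1r.
have d0 : dform (fun=> 1) (resolvent f) = 0.
  rewrite /dform big1 ?mulr0// => y _; rewrite big1// => z _.
  by rewrite subrr mul0r mulr0.
rewrite sum_lap d0 oppr0 add0r mulrN opprK lerDl mulr_ge0 ?(ltW h_gt0)//.
by apply: sumr_ge0 => y _; rewrite mulr1 mulr_ge0.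
Qed.

(** The equation is tested with [phi ^+ 2 * u]. The resulting form is the energy of [w = phi * u],
    up to a term with the factor [c y z = 2 (cosh (psi y - psi z) - 1)], which [H] controls. *)
Lemma davies_step (psi f : I -> R) (H : R) : 0 <= H -> 2 * (h * H) <= 2^-1 ->
  (forall y, \sum_z om y z * (expR (psi y - psi z) + expR (psi z - psi y) - 2)
             <= 2 * H) ->
  \sum_y expR (psi y) ^+ 2 * resolvent f y ^+ 2
  <= expR (4 * (h * H)) * \sum_y expR (psi y) ^+ 2 * f y ^+ 2.
Proof.
move=> H0 hH psiH; have fu := resolventP f; set u := resolvent f in fu *.
pose phi y := expR (psi y); have phi0 y : 0 < phi y by exact: expR_gt0.
pose w y := phi y * u y.
pose c y z := expR (psi y - psi z) + expR (psi z - psi y) - 2.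
set U := \sum_y _; set F := \sum_y expR (psi y) ^+ 2 * f y ^+ 2.
have UE : U = \sum_y w y ^+ 2.
  by apply: eq_bigr => y _; rewrite /w exprMn.
have e1 : U - F <= 2 * \sum_y (phi y ^+ 2 * u y) * (u y - f y).
  rewrite mulr_sumr /U /F -sumrN -big_split/=; apply: ler_sum => y _.
  rewrite -mulrBr -/(phi y); have := mulr_ge0 (sqr_ge0 (phi y)) (sqr_ge0 (u y - f y)).
  nra.
have e2 : \sum_y (phi y ^+ 2 * u y) * (u y - f y) =
    h * \sum_y (phi y ^+ 2 * u y) * lap u y.
  by rewrite mulr_sumr; apply: eq_bigr => y _; rewrite -fu; ring.
have c_sym y z : c y z = c z y by rewrite /c; ring.
have cE y z : (phi y ^+ 2 * u y - phi z ^+ 2 * u z) * (u y - u z) =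
   (w y - w z) ^+ 2 - c y z * (w y * w z).
  rewrite /c /w /phi !expRD !expRN.
  by field; rewrite !gt_eqF ?expR_gt0.
have c0 y z : 0 <= c y z.
  rewrite /c (_ : psi z - psi y = - (psi y - psi z)); last by ring.
  set b := psi y - psi z; have eb : expR b * expR (- b) = 1.
    by rewrite -expRD subrr expR0.
  have := mulr_ge0 (expR_ge0 (- b)) (sqr_ge0 (expR b - 1)).
  rewrite (_ : expR (- b) * _ = expR b * (expR b * expR (- b))
    - 2 * (expR b * expR (- b)) + expR (- b)); last by ring.
  by rewrite eb; lra.
have e3 : - dform (fun y => phi y ^+ 2 * u y) u <= H * U.
  rewrite /dform -mulrN -sumrN UE mulr_sumr.
  pose d y z := om y z * c y z * (w y ^+ 2 / 2).
  apply: (@le_trans _ _ (2^-1 * \sum_y \sum_z (d y z + d z y))).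
    rewrite ler_pM2l//; apply: ler_sum => y _; rewrite -sumrN.
    apply: ler_sum => z _; rewrite cE /d (om_sym z) (c_sym z).
    have := mulr_ge0 (om_ge0 y z) (sqr_ge0 (w y - w z)).
    have := mulr_ge0 (mulr_ge0 (om_ge0 y z) (c0 y z)) (sqr_ge0 (w y - w z)).
    nra.
  under eq_bigr do rewrite big_split/=.
  rewrite big_split/= [X in _ + X]exchange_big/=.
  set S := \sum_y _; rewrite (_ : 2^-1 * (S + S) = S); last by field.
  apply: ler_sum => y _.
  rewrite /d -mulr_suml; have := ler_wpM2r (sqr_ge0 (w y)) (psiH y).
  by rewrite -/(c _ _); lra.
have e4 : 0 <= \sum_y kap y * (phi y ^+ 2 * u y) * u y.
  apply: sumr_ge0 => y _; rewrite (_ : _ * u y = kap y * (phi y ^+ 2 * u y ^+ 2)).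
    by rewrite mulr_ge0// mulr_ge0 ?sqr_ge0.
  by ring.
have U0 : 0 <= U by apply: sumr_ge0 => y _; rewrite mulr_ge0// sqr_ge0.
have e5 : U - F <= 2 * (h * H * U).
  rewrite -(mulrA h).
  apply: le_trans e1 _; rewrite e2 (sum_lap (fun y => phi y ^+ 2 * u y)).
  rewrite ler_pM2l// ler_pM2l//.
  by apply: le_trans e3; rewrite gerBl.
(* This is [1 / (1 - 2 x) <= 1 + 4 x] for [0 <= x <= 1/4]; hence the smallness required of
   [h * H]. *)
have e6 : U <= F * (1 + 2 * (2 * (h * H))).
  have x0 : 0 <= h * H by rewrite mulr_ge0// ltW.
  set x := h * H in x0 e5 hH *.
  have p1 : 0 <= (1 + 4 * x) * (F - U + 2 * (x * U)).
    by apply: mulr_ge0; lra.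
  have p2 : 0 <= U * (x * (2^-1 - 2 * x)).
    by do 2 (apply: mulr_ge0 => //); rewrite subr_ge0.
  nra.
apply: le_trans e6 _; rewrite mulrC ler_wpM2r//.
  by apply: sumr_ge0 => y _; rewrite mulr_ge0// sqr_ge0.
by apply: le_trans (expR_ge1Dx _); lra.
Qed.

Lemma davies (psi f : I -> R) (H : R) n : 0 <= H -> 2 * (h * H) <= 2^-1 ->
  (forall y, \sum_z om y z * (expR (psi y - psi z) + expR (psi z - psi y) - 2)
             <= 2 * H) ->
  \sum_y expR (psi y) ^+ 2 * iter n resolvent f y ^+ 2
  <= expR (4 * (h * H) * n%:R) * \sum_y expR (psi y) ^+ 2 * f y ^+ 2.
Proof.
move=> H0 hH psiH; elim: n => [|n IH].
  by rewrite mulr0 expR0 mul1r.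
apply: le_trans (davies_step _ H0 hH psiH) _.
rewrite -[n.+1%:R]natr1 mulrDr mulr1 expRD (mulrC (expR (_ * n%:R))).
by rewrite -[leRHS]mulrA ler_wpM2l// expR_ge0.
Qed.

Definition pos_part (u : R) : R := Num.max 0 u.

Lemma pos_part_ge0 u : 0 <= pos_part u.
Proof. by rewrite /pos_part le_max lexx. Qed.

(** Convexity of the squared positive part, with the tangent taken at the new value [u], as an
    implicit scheme requires. *)
Lemma pos_part_sqr_sub u v :
  pos_part u ^+ 2 - pos_part v ^+ 2 <= 2 * (pos_part u * (u - v)).
Proof.
rewrite /pos_part; case: (leP 0 u) => u0; case: (leP 0 v) => v0.
- by have := sqr_ge0 (u - v); nra.
- by nra.
- by have := sqr_ge0 v; nra.
- by nra.
Qed.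

(** The difference of the two sides consists of products of the positive part of one number with the
    negative part of the other, since each positive part kills its own negative part. *)
Lemma pos_part_mono (a b c d u v : R) : a = pos_part u -> b = pos_part v ->
  0 <= c -> 0 <= d ->
  (c * a - d * b) * (a - b) <= (c * a - d * b) * (u - v).
Proof.
move=> -> ->; rewrite /pos_part.
case: (leP 0 u) => u0; case: (leP 0 v) => v0 c0 d0 //.
- have nv : 0 <= - v by lra.
  by have := mulr_ge0 (mulr_ge0 c0 u0) nv; nra.
- have nu : 0 <= - u by lra.
  by have := mulr_ge0 (mulr_ge0 d0 v0) nu; nra.
- by rewrite !mulr0 !subrr !mul0r.
Qed.

(** The test function is [eta ^+ 2 * w]. On each edge the energy of [eta * w] exceeds the tested
    form by at most [(eta y - eta z) ^+ 2 * (w y * w z)], which is split symmetrically between both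
    ends. *)
Lemma caccioppoli (eta u u' w : I -> R) (k : R) :
  (forall y, w y = pos_part (u y - k)) ->
  (forall y, eta y != 0 -> u y - u' y <= h * \sum_z om y z * (u z - u y)) ->
  \sum_y eta y ^+ 2 * w y ^+ 2
  - \sum_y eta y ^+ 2 * pos_part (u' y - k) ^+ 2
  + 2 * (h * energy om (fun y => eta y * w y))
  <= h * \sum_y (\sum_z om y z * (eta y - eta z) ^+ 2) * w y ^+ 2.
Proof.
move=> wE sub; have w0 y : 0 <= w y by rewrite wE pos_part_ge0.
have e1 : \sum_y eta y ^+ 2 * w y ^+ 2
  - \sum_y eta y ^+ 2 * pos_part (u' y - k) ^+ 2 <=
  2 * (h * \sum_y eta y ^+ 2 * w y * \sum_z om y z * (u z - u y)).
  rewrite !mulr_sumr -sumrN -big_split/=; apply: ler_sum => y _.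
  rewrite -mulrBr.
  have [->|ey] := eqVneq (eta y) 0; first by rewrite expr0n/= !mul0r !mulr0.
  have ew0 : 0 <= eta y ^+ 2 * w y by rewrite mulr_ge0// sqr_ge0.
  have := ler_wpM2l ew0 (sub _ ey).
  have := ler_wpM2l (sqr_ge0 (eta y)) (pos_part_sqr_sub (u y - k) (u' y - k)).
  rewrite -wE; nra.
rewrite sum_lap0 in e1.
have e2 : energy om (fun y => eta y * w y)
   - dform (fun y => eta y ^+ 2 * w y) u <=
   2^-1 * \sum_y (\sum_z om y z * (eta y - eta z) ^+ 2) * w y ^+ 2.
  rewrite /energy /dform -mulrBr ler_pM2l// -sumrN -big_split/=.
  pose d y z := om y z * (eta y - eta z) ^+ 2 * (w y ^+ 2 / 2).
  apply: (@le_trans _ _ (\sum_y \sum_z (d y z + d z y))).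
    apply: ler_sum => y _; rewrite -sumrN -big_split/=.
    apply: ler_sum => z _; rewrite /d (om_sym z).
    have := @pos_part_mono (w y) (w z) (eta y ^+ 2) (eta z ^+ 2) (u y - k) (u z - k)
      (wE y) (wE z) (sqr_ge0 _) (sqr_ge0 _).
    rewrite (_ : u y - k - (u z - k) = u y - u z); last by ring.
    move=> /(ler_wpM2l (om_ge0 y z)).
    have := mulr_ge0 (mulr_ge0 (om_ge0 y z) (sqr_ge0 (eta y - eta z)))
      (sqr_ge0 (w y - w z)).
    nra.
  pose S := \sum_y \sum_z d y z.
  have -> : \sum_y \sum_z (d y z + d z y) = S + S.
    have S2 : S = \sum_y \sum_z d z y by rewrite /S exchange_big.
    rewrite {2}S2 /S -big_split/=.
    by apply: eq_bigr => y _; rewrite big_split.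
  have SE : S = \sum_y
      (\sum_z om y z * (eta y - eta z) ^+ 2) * (w y ^+ 2 / 2).
    by apply: eq_bigr => y _; rewrite mulr_suml.
  rewrite SE -mulr2n le_eqVlt; apply/orP; left; apply/eqP.
  by rewrite -sumrMnl; apply: eq_bigr => y _; rewrite -mulr_natl; field.
have := ler_wpM2l (ltW h_gt0) e2.
lra.
Qed.

End Dynamics.

(** * De Giorgi iteration *)

Section DeGiorgi.
Variables (R : realType) (I : finType) (om : I -> I -> R) (h : R) (N : nat).
Variables (rho : I -> R) (r eps K : R) (v : nat -> I -> R).
Hypothesis om_sym : forall y z, om y z = om z y.
Hypothesis om_ge0 : forall y z, 0 <= om y z.
Hypothesis h_gt0 : 0 < h.
Hypothesis rho_lip : forall y z, om y z != 0 -> rho z <= rho y + 1.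
Hypothesis v_start : forall y, rho y <= r -> v 0%N y = 0.
Hypothesis v_sub : forall i y, (i < N)%N -> rho y <= r ->
  v i.+1 y - v i y <= h * \sum_z om y z * (v i.+1 z - v i.+1 y).
Hypothesis K_gt0 : 0 < K.
Hypothesis eps_gt0 : 0 < eps.
Hypothesis fk : forall w : I -> R, (forall y, 0 <= w y) ->
  (forall y, ~~ (rho y <= r) -> w y = 0) ->
  \sum_y (\sum_z om y z) * w y ^+ 2
  <= K * (\sum_y (w y != 0)%:R) `^ eps * energy om w.

(** It is 1 up to [s - 2 g] and vanishes from [s - g] on. The gap between [s - g] and [s] is at
    least one edge long when [1 <= g], so the gradient is felt only where [rho y <= s]. *)
Definition cutoff (s g : R) (y : I) : R :=
  Num.min 1 (pos_part ((s - g - rho y) / g)).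

Definition excess (k : R) (i : nat) (y : I) : R := pos_part (v i y - k).

(** The space-time integral of the squared excess in the weight produced by [cutoff_grad]. The
    values after the step are summed, hence [i.+1]. *)
Definition level_mass (n : nat) (k s : R) : R :=
  h * \sum_(i < n) \sum_(y | rho y <= s)
    (\sum_z om y z) * excess k i.+1 y ^+ 2.

Lemma cutoff_bounds s g y : 0 <= cutoff s g y <= 1.
Proof. by rewrite /cutoff ge_min lexx le_min ler01 pos_part_ge0. Qed.

Lemma cutoff_eq1 s g y : 0 < g -> rho y <= s - 2 * g -> cutoff s g y = 1.
Proof.
move=> g0 ry; apply/min_idPl; rewrite /pos_part le_max; apply/orP; right.
by rewrite ler_pdivlMr// mul1r; lra.
Qed.

Lemma cutoff_eq0 s g y : 0 < g -> s - g <= rho y -> cutoff s g y = 0.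
Proof.
move=> g0 ry; rewrite /cutoff /pos_part.
have h0 : (s - g - rho y) / g <= 0 by rewrite ler_pdivrMr// mul0r; lra.
by rewrite (max_idPl h0) (min_idPr _).
Qed.

Lemma cutoff_lip s g y z : 0 < g ->
  `|cutoff s g y - cutoff s g z| <= `|rho y - rho z| / g.
Proof.
move=> g0.
have -> : `|rho y - rho z| / g = `|(s - g - rho y) / g - (s - g - rho z) / g|.
  by rewrite -mulrBl normrM (gtr0_norm (_ : 0 < g^-1)) ?invr_gt0// distrC;
    congr (`|_| * _); ring.
apply: (@le_trans _ _ `|pos_part ((s - g - rho y) / g)
                        - pos_part ((s - g - rho z) / g)|).
  rewrite /cutoff; set a := pos_part _; set b := pos_part _.
  by case: (leP 1 a) => a1; case: (leP 1 b) => b1; rewrite ler_norml;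
    case: (ger0P (a - b)) => ab; apply/andP; split; lra.
rewrite /pos_part; set a := _ / g; set b := _ / g.
by case: (leP 0 a) => a1; case: (leP 0 b) => b1; rewrite ler_norml;
  case: (ger0P (a - b)) => ab; apply/andP; split; lra.
Qed.

Lemma cutoff_grad s g y : 1 <= g ->
  \sum_z om y z * (cutoff s g y - cutoff s g z) ^+ 2
  <= g ^- 2 * (if rho y <= s then \sum_z om y z else 0).
Proof.
move=> g1; have g0 : 0 < g by lra.
case: ifPn => rys.
  rewrite mulr_sumr; apply: ler_sum => z _.
  have [->|yz] := eqVneq (om y z) 0; first by rewrite mul0r mulr0.
  rewrite mulrC ler_wpM2r//.
  have lip : `|rho y - rho z| <= 1.
    have := rho_lip yz; have : om z y != 0 by rewrite om_sym.
    by move=> /rho_lip h1 h2; rewrite ler_norml; apply/andP; split; lra.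
  have : `|cutoff s g y - cutoff s g z| <= g^-1.
    apply: le_trans (cutoff_lip _ _ _ g0) _.
    by rewrite -[leRHS]mul1r ler_wpM2r// invr_ge0 ltW.
  rewrite -exprVn ler_norml => /andP[l1 l2]; nra.
rewrite mulr0 big1// => z _.
have [->|yz] := eqVneq (om y z) 0; first by rewrite mul0r.
move: rys; rewrite -ltNge => rys.
have : om z y != 0 by rewrite om_sym.
move=> /rho_lip h1.
rewrite !cutoff_eq0 ?subrr ?expr0n ?mulr0//; lra.
Qed.

Lemma level_mass_ge0 n k s : 0 <= level_mass n k s.
Proof.
rewrite mulr_ge0 ?(ltW h_gt0)//; apply: sumr_ge0 => i _; apply: sumr_ge0 => y _.
by rewrite mulr_ge0 ?sqr_ge0//; apply: sumr_ge0.
Qed.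

Lemma level_mass_mono n n' k k' s s' : (n <= n')%N -> k' <= k -> s <= s' ->
  level_mass n k s <= level_mass n' k' s'.
Proof.
move=> nn kk ss; rewrite /level_mass ler_wpM2l ?(ltW h_gt0)//.
have m0 y : 0 <= \sum_z om y z by apply: sumr_ge0.
pose F k s (i : nat) := \sum_(y | rho y <= s) (\sum_z om y z) * excess k i.+1 y ^+ 2.
have F0 i : 0 <= F k' s' i.
  by apply: sumr_ge0 => y _; rewrite mulr_ge0 ?sqr_ge0.
apply: (@le_trans _ _ (\sum_(i < n) F k' s' i)).
  apply: ler_sum => i _; rewrite /F big_mkcond [leRHS]big_mkcond/=.
  apply: ler_sum => y _.
  have ex : excess k i.+1 y <= excess k' i.+1 y.
    rewrite /excess /pos_part ge_max le_max lexx/= le_max.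
    by apply/orP; right; lra.
  have exx : (\sum_z om y z) * excess k i.+1 y ^+ 2 <=
             (\sum_z om y z) * excess k' i.+1 y ^+ 2.
    by rewrite ler_wpM2l// lerXn2r// nnegrE pos_part_ge0.
  case: ifPn => rs; first by rewrite (le_trans rs ss).
  by case: ifP => // _; rewrite mulr_ge0 ?sqr_ge0.
rewrite -!(big_mkord xpredT (F k' s')) (big_cat_nat (n := n) _ nn)//= lerDl.
by apply: sumr_ge0.
Qed.

(** [caccioppoli] telescopes in time. The initial term vanishes because [v 0] is zero on the ball
    and [0 <= k]. *)
Lemma level_energy k s g n : 1 <= g -> 0 <= k -> s <= r -> (n <= N)%N ->
  \sum_y cutoff s g y ^+ 2 * excess k n y ^+ 2
  + 2 * (h * \sum_(i < n) energy om (fun y => cutoff s g y * excess k i.+1 y))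
  <= g ^- 2 * level_mass n k s.
Proof.
move=> g1 k0 sr; have g0 : 0 < g by lra.
elim: n => [_|n IH nN].
  rewrite /level_mass !big_ord0 !mulr0 addr0 big1// => y _.
  have [ry|ry] := leP (rho y) r.
    by rewrite /excess v_start// sub0r /pos_part (max_idPl _) ?expr0n ?mulr0//
      oppr_le0.
  by rewrite cutoff_eq0 ?expr0n ?mul0r//; lra.
have := IH (ltnW nN).
have sub y : cutoff s g y != 0 ->
    v n.+1 y - v n y <= h * \sum_z om y z * (v n.+1 z - v n.+1 y).
  move=> cy; apply: v_sub => //; apply: contraNT cy; rewrite -ltNge => ry.
  by rewrite cutoff_eq0//; lra.
have := @caccioppoli R I om h om_sym om_ge0 h_gt0 (cutoff s g) (v n.+1) (v n)
  (excess k n.+1) k (fun=> erefl) sub.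
have le1 : h * \sum_y (\sum_z om y z * (cutoff s g y - cutoff s g z) ^+ 2)
     * excess k n.+1 y ^+ 2 <=
   g ^- 2 * (h * \sum_(y | rho y <= s) (\sum_z om y z) * excess k n.+1 y ^+ 2).
  rewrite mulrCA ler_wpM2l ?(ltW h_gt0)// mulr_sumr [leRHS]big_mkcond/=.
  apply: ler_sum => y _.
  have := ler_wpM2r (sqr_ge0 (excess k n.+1 y)) (cutoff_grad s y g1).
  case: ifP => _ hh; apply: le_trans hh _.
    by rewrite -mulrA.
  by rewrite mulr0 mul0r.
rewrite /level_mass !big_ord_recr/= !mulrDr -!/(excess k n _).
move=> c1 c2; apply: le_trans (lerD c2 (le_trans c1 le1)) => {c1 c2 le1}.
rewrite le_eqVlt; apply/orP; left; apply/eqP; rewrite /excess; ring.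
Qed.

Lemma level_sup k s g n : 1 <= g -> 0 <= k -> s <= r -> (n <= N)%N ->
  \sum_(y | rho y <= s - 2 * g) excess k n y ^+ 2 <= g ^- 2 * level_mass N k s.
Proof.
move=> g1 k0 sr nN; have g0 : 0 < g by lra.
have := level_energy g1 k0 sr nN.
have E0 : 0 <= h * \sum_(i < n) energy om (fun y => cutoff s g y * excess k i.+1 y).
  by rewrite mulr_ge0 ?(ltW h_gt0)//; apply: sumr_ge0 => i _; exact: energy_ge0.
have : level_mass n k s <= level_mass N k s by exact: level_mass_mono.
move=> /(ler_wpM2l (_ : 0 <= g ^- 2)); rewrite invr_ge0 sqr_ge0 => /(_ isT) h1 h2.
apply: le_trans h1; apply: (@le_trans _ _ (\sum_y cutoff s g y ^+ 2 * excess k n y ^+ 2)).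
  rewrite big_mkcond; apply: ler_sum => y _.
  by case: ifPn => ry; [rewrite cutoff_eq1// expr1n mul1r|rewrite mulr_ge0 ?sqr_ge0].
lra.
Qed.

Lemma level_energy_sum k s g : 1 <= g -> 0 <= k -> s <= r ->
  h * \sum_(i < N) energy om (fun y => cutoff s g y * excess k i.+1 y)
  <= g ^- 2 * level_mass N k s.
Proof.
move=> g1 k0 sr; have := level_energy g1 k0 sr (leqnn N).
have : 0 <= \sum_y cutoff s g y ^+ 2 * excess k N y ^+ 2.
  by apply: sumr_ge0 => y _; rewrite mulr_ge0 ?sqr_ge0.
have : 0 <= h * \sum_(i < N) energy om (fun y => cutoff s g y * excess k i.+1 y).
  by rewrite mulr_ge0 ?(ltW h_gt0)//; apply: sumr_ge0 => i _; exact: energy_ge0.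
lra.
Qed.

(** Where the excess over [k + ka] is positive, the excess over [k] is at least [ka]. Chebyshev's
    inequality with [level_sup] bounds the size of this set, and Faber-Krahn turns it into the gain
    [eps] in the exponent. The cutoff is used twice, hence the loss [4 * g] of radius. *)
Lemma level_step k ka s g : 1 <= g -> 0 <= k -> 0 < ka -> s <= r ->
  level_mass N (k + ka) (s - 4 * g) <=
  K * (ka ^- 2 * (g ^- 2 * level_mass N k s)) `^ eps * (g ^- 2 * level_mass N k s).
Proof.
move=> g1 k0 ka0 sr; have g0 : 0 < g by lra.
set A := level_mass N k s.
have A0 : 0 <= A by exact: level_mass_ge0.
have kk0 : 0 <= k + ka by lra.
have sr' : s - 2 * g <= r by lra.
have gi0 : 0 <= g ^- 2 by rewrite invr_ge0 sqr_ge0.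
have ki0 : 0 <= ka ^- 2 by rewrite invr_ge0 sqr_ge0.
pose w i y := cutoff (s - 2 * g) g y * excess (k + ka) i y.
have w0 i y : 0 <= w i y.
  by rewrite mulr_ge0 ?pos_part_ge0//; case/andP: (cutoff_bounds (s - 2 * g) g y).
have wz i y : w i y != 0 -> rho y <= s - 2 * g /\ ka < v i y - k.
  move=> wN; split.
    rewrite leNgt; apply: contra wN => ry.
    by rewrite /w cutoff_eq0 ?mul0r//; lra.
  rewrite ltNge; apply: contra wN => ry.
  by rewrite /w /excess /pos_part (max_idPl _) ?mulr0//; lra.
have supp i : (i <= N)%N -> \sum_y (w i y != 0)%:R <= ka ^- 2 * (g ^- 2 * A) :> R.
  move=> iN; apply: le_trans (ler_wpM2l ki0 (level_sup g1 k0 sr iN)).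
  rewrite mulr_sumr [leRHS]big_mkcond/=; apply: ler_sum => y _.
  have [wy|/wz[-> vk]]/= := eqVneq (w i y) 0.
    by case: ifP => // _; rewrite mulr_ge0// sqr_ge0.
  rewrite mulrC ler_pdivlMr ?exprn_gt0// mul1r lerXn2r ?nnegrE ?pos_part_ge0 ?ltW//.
  by rewrite /excess /pos_part lt_max vk orbT.
apply: (@le_trans _ _ (h * \sum_(i < N) \sum_y (\sum_z om y z) * w i.+1 y ^+ 2)).
  rewrite ler_wpM2l ?(ltW h_gt0)//; apply: ler_sum => i _.
  rewrite big_mkcond; apply: ler_sum => y _.
  case: ifPn => ry; last by rewrite mulr_ge0 ?sqr_ge0//; apply: sumr_ge0.
  by rewrite /w cutoff_eq1 ?mul1r//; lra.
have E0 i : 0 <= energy om (w i) by exact: energy_ge0.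
apply: (@le_trans _ _ (h * \sum_(i < N) K * (ka ^- 2 * (g ^- 2 * A)) `^ eps
    * energy om (w i.+1))).
  rewrite ler_wpM2l ?(ltW h_gt0)//; apply: ler_sum => i _.
  apply: le_trans (fk (w0 _) _) _.
    move=> y ry; apply/eqP; apply: contraNT ry => /wz[ry _]; lra.
  rewrite ler_wpM2r// ler_wpM2l ?(ltW K_gt0)// ge0_ler_powR ?(ltW eps_gt0)//.
  - by rewrite nnegrE; apply: sumr_ge0.
  - by rewrite nnegrE; apply: mulr_ge0 => //; exact: mulr_ge0.
  - exact: supp.
rewrite -mulr_sumr mulrCA ler_wpM2l//.
  by rewrite mulr_ge0 ?powR_ge0// ltW.
apply: le_trans (level_energy_sum g1 kk0 sr') _.
rewrite ler_wpM2l//; apply: level_mass_mono => //; lra.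
Qed.

Lemma ex_dyadic_scale : 16 <= r -> exists J : nat, 16 * 2 ^+ J <= r < 32 * 2 ^+ J.
Proof.
move=> r16; have ex : exists n, r < 32 * 2 ^+ n.
  exists (Num.truncn r).+1; apply: lt_le_trans (truncnS_gt r) _.
  rewrite -[leLHS]mul1r ler_pM// ?ler1n//.
  rewrite -natrX ler_nat; exact: (ltnW (ltn_expl _ _)).
have [J rJ minJ] := ex_minnP ex.
exists J; rewrite rJ andbT.
case: J rJ minJ => [|J] rJ minJ; first by rewrite expr0 mulr1.
rewrite leNgt; apply/negP => lt; have : (J.+1 <= J)%N.
  by apply: minJ; move: lt; rewrite exprS; lra.
by rewrite ltnn.
Qed.

(* Levels increase to [k] and radii decrease to [r / 2] dyadically, as long as the
   cutoff scale [r / (16 2^j)] stays above the lattice spacing; [k] is chosen so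
   that the masses decay like [2 ^ (- a j)], and the number of steps available
   makes the last mass at most [(32 / r) ^ a] times the first one. *)
Lemma degiorgi (a : R) n y : 0 <= a -> 2 + 4 * eps <= a * eps -> 16 <= r ->
  (n <= N)%N -> rho y <= 0 -> 0 <= v n y ->
  v n y ^+ 2 <= 2 * (1024 / r ^+ 2 * (256 * 2 `^ a * K / r ^+ 2) `^ eps^-1
                     + (32 / r) `^ a) * level_mass N 0 r.
Proof.
move=> a0 aeps r16 nN ry vn0.
have r0 : 0 < r by lra.
set T := (_ / r ^+ 2) `^ _; set A := level_mass N 0 r.
have A0 : 0 <= A by exact: level_mass_ge0.
have a2 : 0 < 2 `^ a :> R by exact: powR_gt0.
have Tb0 : 0 < 256 * 2 `^ a * K / r ^+ 2.
  apply: divr_gt0 (exprn_gt0 _ r0); apply: mulr_gt0 K_gt0.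
  by apply: mulr_gt0 a2; rewrite ltr0n.
have T0 : 0 < T by exact: powR_gt0.
have [Az|AN0] := eqVneq A 0.
  rewrite Az mulr0; have := @level_sup 0 r 1 n (lexx 1) (lexx 0) (lexx r) nN.
  rewrite -/A Az mulr0 => sup; apply: le_trans sup.
  rewrite (bigD1 y)/=; last by lra.
  rewrite {1}/excess subr0 /pos_part (max_idPr vn0) lerDl.
  by apply: sumr_ge0 => z _; rewrite sqr_ge0.
have Ap : 0 < A by rewrite lt_def AN0.
(* With [x = 2 ^ j], the factor 1024 collects [ka ^- 2 = 4 x^2 / k2] and [g ^- 2 = 256 x^2 / r^2],
   so the measure of the support in [level_step] is at most [x^(4 - a) / T]. The power [eps] of
   [1 / T] cancels [K] and the other factor 256, and leaves the decay [2^(- a)]. *)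
pose k2 : R := 1024 * A * T / r ^+ 2.
have k20 : 0 < k2.
  apply: divr_gt0 (exprn_gt0 _ r0); apply: mulr_gt0 T0.
  by apply: mulr_gt0 Ap; rewrite ltr0n.
pose k := Num.sqrt k2.
have k0 : 0 < k by rewrite sqrtr_gt0.
have kk : k ^+ 2 = k2 by rewrite sqr_sqrtr// ltW.
pose x (j : nat) : R := 2 ^+ j.
have x1 j : 1 <= x j by rewrite exprn_ege1// ler1n.
have x0 j : 0 < x j by exact: lt_le_trans (x1 j).
have claim j : 16 * x j <= 2 * r ->
    level_mass N (k * (1 - (x j)^-1)) (r / 2 + r / (2 * x j)) <= x j `^ (- a) * A.
  elim: j => [_|j IH hj].
    rewrite /x expr0 invr1 subrr mulr0 mulr1 powR1 mul1r.
    by apply: level_mass_mono => //; lra.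
  have hx : 16 * x j <= r by move: hj; rewrite /x exprS; lra.
  have hx2 : 16 * x j <= 2 * r by lra.
  have {hx2}IH := IH hx2; set Aj := level_mass _ _ _ in IH.
  have Aj0 : 0 <= Aj by exact: level_mass_ge0.
  (* Then [4 * g] is exactly the difference of two consecutive radii. *)
  pose g := r / (16 * x j).
  have g1 : 1 <= g by rewrite ler_pdivlMr ?mulr_gt0// mul1r.
  have xi1 : (x j)^-1 <= 1 by rewrite invf_le1.
  have xi0 : 0 < (x j)^-1 by rewrite invr_gt0.
  have kj0 : 0 <= k * (1 - (x j)^-1) by rewrite mulr_ge0 ?(ltW k0)// subr_ge0.
  have ka0 : 0 < k / (2 * x j) by rewrite divr_gt0 ?mulr_gt0.
  have sr : r / 2 + r / (2 * x j) <= r.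
    have : r / (2 * x j) <= r / 2.
      rewrite ler_pM2l// lef_pV2 ?posrE ?mulr_gt0//.
      by have := x1 j; lra.
    lra.
  have xN0 : x j != 0 by rewrite gt_eqF.
  have step := level_step g1 kj0 ka0 sr.
  rewrite (_ : k * (1 - (x j.+1)^-1) = k * (1 - (x j)^-1) + k / (2 * x j)); last first.
    by rewrite /x exprS; field.
  rewrite (_ : r / 2 + r / (2 * x j.+1) = r / 2 + r / (2 * x j) - 4 * g); last first.
    by rewrite /g /x exprS; field.
  apply: le_trans step _; rewrite -/Aj.
  have rN0 : r != 0 by rewrite gt_eqF.
  have kN0 : k != 0 by rewrite gt_eqF.
  have g2E : g ^- 2 = 256 * x j ^+ 2 / r ^+ 2 by rewrite /g; field; apply/andP.
  have k2E : (k / (2 * x j)) ^- 2 = 4 * x j ^+ 2 / k2.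
    by rewrite -kk; field; apply/andP.
  rewrite g2E k2E.
  have q0 : 0 <= 256 * x j ^+ 2 / r ^+ 2.
    apply: divr_ge0 (sqr_ge0 _); apply: mulr_ge0 (sqr_ge0 _).
    by rewrite ler0n.
  have q1 : 0 <= 4 * x j ^+ 2 / k2.
    apply: divr_ge0 (ltW k20); apply: mulr_ge0 (sqr_ge0 _).
    by rewrite ler0n.
  have up : 4 * x j ^+ 2 / k2 * (256 * x j ^+ 2 / r ^+ 2 * Aj) <=
      T^-1 * x j `^ (4 - a).
    apply: le_trans (ler_wpM2l q1 (ler_wpM2l q0 IH)) _.
    rewrite powRD; last by rewrite xN0 implybT.
    rewrite (powR_mulrn 4 (ltW (x0 j))).
    rewrite le_eqVlt; apply/orP; left; apply/eqP; rewrite /k2.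
    field; rewrite rN0 AN0; apply/and3P; split => //; rewrite gt_eqF//.
  have Ti : T^-1 `^ eps = r ^+ 2 / (256 * 2 `^ a * K).
    rewrite -(powR_inv1 (ltW T0)) -powRrM mulN1r /T -powRrM mulrN mulVf ?gt_eqF//.
    by rewrite (powR_inv1 (ltW Tb0)) invf_div.
  (* Here [2 + 4 * eps <= a * eps] enters: the decay of the masses beats the growth of the cutoff
     constants. *)
  have xp : x j `^ (4 - a) `^ eps * x j ^+ 2 <= 1.
    rewrite -powRrM -(powR_mulrn 2 (ltW (x0 j))) -powRD; last by rewrite xN0 implybT.
    rewrite -[leRHS](powRr0 (x j)); apply: ler_powR (x1 j) _ _ _.
    by rewrite mulrBl addrAC subr_le0 addrC.
  apply: (@le_trans _ _ (K * (T^-1 * x j `^ (4 - a)) `^ eps *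
      (256 * x j ^+ 2 / r ^+ 2 * (x j `^ (- a) * A)))).
    apply: ler_pM.
    - exact: mulr_ge0 (ltW K_gt0) (powR_ge0 _ _).
    - exact: mulr_ge0.
    - rewrite ler_wpM2l ?(ltW K_gt0)// ge0_ler_powR ?(ltW eps_gt0)// nnegrE.
        by apply: mulr_ge0 => //; exact: mulr_ge0.
      by apply: mulr_ge0; rewrite ?powR_ge0// invr_ge0 ltW.
    - exact: ler_wpM2l.
  rewrite powRM ?invr_ge0 ?powR_ge0 ?(ltW T0)// Ti.
  rewrite (_ : x j.+1 `^ (- a) = (2 `^ a)^-1 * x j `^ (- a)); last first.
    by rewrite /x exprS powRM ?exprn_ge0// powRN.
  have := ler_wpM2l (mulr_ge0 (mulr_ge0 (ltW (_ : 0 < (2 `^ a)^-1)) (powR_ge0 (x j) (- a))) A0) xp.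
  rewrite invr_gt0 => /(_ a2); rewrite mulr1; apply: le_trans.
  rewrite le_eqVlt; apply/orP; left; apply/eqP.
  by field; rewrite rN0 !gt_eqF.
have [J /andP[J1 J2]] := ex_dyadic_scale r16.
have claimJ := claim J (_ : 16 * x J <= 2 * r).
have {claim}claimJ : level_mass N (k * (1 - (x J)^-1)) (r / 2 + r / (2 * x J))
    <= x J `^ (- a) * A by apply: claimJ; rewrite /x; lra.
have gJ1 : 1 <= r / (16 * x J) by rewrite ler_pdivlMr ?mulr_gt0// mul1r.
have xi1 : (x J)^-1 <= 1 by rewrite invf_le1.
have xi0 : 0 < (x J)^-1 by rewrite invr_gt0.
have kJ0 : 0 <= k * (1 - (x J)^-1) by rewrite mulr_ge0 ?(ltW k0)// subr_ge0.
have rx0 : 0 < r / (2 * x J) by rewrite divr_gt0 ?mulr_gt0.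
have rxE : r / (16 * x J) = r / (2 * x J) / 8.
  by field; rewrite gt_eqF.
have sJ : r / 2 + r / (2 * x J) <= r.
  have : r / (2 * x J) <= r / 2.
    by rewrite ler_pM2l// lef_pV2 ?posrE ?mulr_gt0//; have := x1 J; lra.
  lra.
have := level_sup gJ1 kJ0 sJ nN.
rewrite (bigD1 y)/=; last by rewrite rxE; lra.
set S := \sum_(_ | _) _; have S0 : 0 <= S by apply: sumr_ge0 => z _; rewrite sqr_ge0.
set AJ := level_mass _ _ _ in claimJ * => sup.
have AJ0 : 0 <= AJ by exact: level_mass_ge0.
have exJ : excess (k * (1 - (x J)^-1)) n y ^+ 2 <= (32 / r) `^ a * A.
  have : (r / (16 * x J)) ^- 2 * AJ <= AJ.
    rewrite ler_piMl// invf_le1 ?exprn_ege1// exprn_gt0//; exact: lt_le_trans gJ1.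
  have : x J `^ (- a) * A <= (32 / r) `^ a * A.
    rewrite ler_wpM2r// powRN -powR_inv1 ?powR_ge0// powRAC powR_inv1 ?(ltW (x0 J))//.
    rewrite ge0_ler_powR ?nnegrE ?invr_ge0 ?(ltW (x0 J))//.
      by rewrite divr_ge0// ltW.
    rewrite -[leRHS]invf_div lef_pV2 ?posrE ?divr_gt0//.
    by rewrite ler_pdivrMr//; rewrite /x; lra.
  lra.
have : v n y <= k + excess (k * (1 - (x J)^-1)) n y.
  have : k * (1 - (x J)^-1) <= k by rewrite ler_piMr ?(ltW k0)//; lra.
  have : v n y - k * (1 - (x J)^-1) <= excess (k * (1 - (x J)^-1)) n y.
    by rewrite /excess /pos_part le_max lexx orbT.
  lra.
set e := excess _ _ _ in exJ * => ve.
have e0 : 0 <= e by exact: pos_part_ge0.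
have : v n y ^+ 2 <= (k + e) ^+ 2 by rewrite lerXn2r// nnegrE addr_ge0// ltW.
have := sqr_ge0 (k - e).
have -> : 2 * (1024 / r ^+ 2 * T + (32 / r) `^ a) * A =
   2 * k ^+ 2 + 2 * ((32 / r) `^ a * A).
  by rewrite kk /k2; field; rewrite gt_eqF.
nra.
Qed.

End DeGiorgi.

(** * Nash inequality *)

Section Nash.
Variables (R : realType) (I : finType) (om : I -> I -> R) (kap : I -> R) (h : R).
Variables (B : pred I) (x0 : I) (eps K : R).
Hypothesis om_sym : forall y z, om y z = om z y.
Hypothesis om_ge0 : forall y z, 0 <= om y z.
Hypothesis kap_ge0 : forall y, 0 <= kap y.
Hypothesis h_gt0 : 0 < h.
Hypothesis K_gt0 : 0 < K.
Hypothesis eps_bounds : 0 < eps <= 2.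
Hypothesis h_small : h <= 4 `^ eps * K.
Hypothesis fk : forall w : I -> R, (forall y, 0 <= w y) ->
  (forall y, ~~ B y -> w y = 0) ->
  \sum_y w y ^+ 2 <= K * (\sum_y (w y != 0)%:R) `^ eps
                     * (energy om w + \sum_y kap y * w y ^+ 2).

Let G := resolvent om kap h.

(** Faber-Krahn is applied to [w] truncated at a quarter of its squared L^2 norm [a]. As the sum of
    [w] is at most 1, the truncated function has at most [4 / a] points in its support and keeps at
    least half of [a]. *)
Lemma nash (w : I -> R) : (forall y, 0 <= w y) ->
  (forall y, ~~ B y -> w y = 0) -> \sum_y w y <= 1 ->
  (\sum_y w y ^+ 2) * (\sum_y w y ^+ 2) `^ eps <=
  2 * (4 `^ eps * K) * (energy om w + \sum_y kap y * w y ^+ 2).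
Proof.
move=> w0 wB w1; case/andP: eps_bounds => eps0 _.
set a := \sum_y w y ^+ 2.
have a0 : 0 <= a by apply: sumr_ge0 => y _; rewrite sqr_ge0.
have D0 : 0 <= energy om w + \sum_y kap y * w y ^+ 2.
  rewrite addr_ge0 ?energy_ge0//; apply: sumr_ge0 => y _.
  by rewrite mulr_ge0 ?sqr_ge0.
have [->|aN0] := eqVneq a 0.
  rewrite mul0r; apply: mulr_ge0 D0; apply: mulr_ge0 => //.
  exact: mulr_ge0 (powR_ge0 _ _) (ltW K_gt0).
have ap : 0 < a by rewrite lt_def aN0.
pose s := a / 4; have s0 : 0 < s by rewrite divr_gt0.
pose ws y := pos_part (w y - s).
have ws0 y : 0 <= ws y by exact: pos_part_ge0.
have wsE y : w y <= s -> ws y = 0.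
  by move=> ys; rewrite /ws /pos_part (max_idPl _)// subr_le0.
have wsE' y : s <= w y -> ws y = w y - s.
  by move=> ys; rewrite /ws /pos_part (max_idPr _)// subr_ge0.
have wsB y : ~~ B y -> ws y = 0 by move=> /wB wy; rewrite wsE// wy; exact: ltW.
have lip y z : (ws y - ws z) ^+ 2 <= (w y - w z) ^+ 2.
  case: (lerP s (w y)) => sy; case: (lerP s (w z)) => sz.
  - by rewrite !wsE'// (_ : _ - _ - _ = w y - w z)//; ring.
  - rewrite (wsE' y sy) (wsE z (ltW sz)) subr0.
    nra.
  - rewrite (wsE' z sz) (wsE y (ltW sy)) sub0r.
    nra.
  - by rewrite (wsE y (ltW sy)) (wsE z (ltW sz)) subrr expr0n/= sqr_ge0.
have Dle : energy om ws + \sum_y kap y * ws y ^+ 2 <=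
           energy om w + \sum_y kap y * w y ^+ 2.
  rewrite lerD//.
    rewrite ler_pM2l//; apply: ler_sum => y _; apply: ler_sum => z _.
    by rewrite ler_wpM2l.
  apply: ler_sum => y _; rewrite ler_wpM2l// lerXn2r ?nnegrE//.
  by case: (lerP s (w y)) => sy; [rewrite wsE'//; lra|rewrite (wsE _ (ltW sy))].
have card_le : \sum_y (ws y != 0)%:R <= 4 / a.
  rewrite (_ : 4 / a = s^-1 * 1); last by rewrite mulr1 /s invf_div.
  apply: (@le_trans _ _ (s^-1 * \sum_y w y)); last first.
    by rewrite ler_wpM2l// invr_ge0 ltW.
  rewrite mulr_sumr; apply: ler_sum => y _.
  have [wy|wy] := eqVneq (ws y) 0; first by rewrite mulr_ge0// invr_ge0 ltW.
  have : s < w y by rewrite ltNge; apply: contra wy => /wsE ->.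
  by move=> sy; rewrite mulrC ler_pdivlMr//= mul1r ltW.
have half : a / 2 <= \sum_y ws y ^+ 2.
  have : a <= \sum_y ws y ^+ 2 + 2 * s * \sum_y w y.
    rewrite mulr_sumr -big_split/=; apply: ler_sum => y _.
    case: (lerP s (w y)) => sy.
      by rewrite wsE'//; nra.
    rewrite (wsE _ (ltW sy)) expr0n/= add0r; have := w0 y; nra.
  rewrite /s; nra.
have := fk ws0 wsB => fkw.
have p1 : (\sum_y (ws y != 0)%:R) `^ eps <= (4 / a) `^ eps.
  rewrite ge0_ler_powR ?(ltW eps0)// nnegrE ?divr_ge0//.
  exact: sumr_ge0.
have Ds0 : 0 <= energy om ws + \sum_y kap y * ws y ^+ 2.
  rewrite addr_ge0 ?energy_ge0//; apply: sumr_ge0 => y _.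
  by rewrite mulr_ge0 ?sqr_ge0.
have : a / 2 <= K * (4 / a) `^ eps * (energy om w + \sum_y kap y * w y ^+ 2).
  apply: le_trans half _; apply: le_trans fkw _.
  apply: ler_pM => //.
    exact: mulr_ge0 (ltW K_gt0) (powR_ge0 _ _).
  by rewrite ler_wpM2l ?(ltW K_gt0).
rewrite powRM// ?invr_ge0//.
rewrite (_ : a^-1 `^ eps = (a `^ eps)^-1); last first.
  by rewrite -powR_inv1// powRAC powR_inv1// powR_ge0.
have ae0 : 0 < a `^ eps by exact: powR_gt0.
move=> /(ler_wpM2r (ltW ae0)) hh.
have -> : a * a `^ eps = 2 * (a / 2 * a `^ eps) by field.
apply: le_trans (ler_wpM2l _ hh) _ => //.
by rewrite le_eqVlt; apply/orP; left; apply/eqP; field; rewrite gt_eqF.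
Qed.

(** Discrete form of the differential inequality [a' <= - C a^(1 + eps)]: the power [a^(- eps)] of
    the squared L^2 norm grows at least linearly. [h_small] keeps the relative loss [x] of one step
    below 1. *)
Lemma nash_decay n : B x0 ->
  (forall i y, ~~ B y -> iter i G (fun y => (y == x0)%:R) y = 0) -> (0 < n)%N ->
  \sum_y iter n G (fun y => (y == x0)%:R) y ^+ 2
  <= (4 * (4 `^ eps * K) / (eps * (h * n%:R))) `^ eps^-1.
Proof.
case/andP: eps_bounds => eps0 eps2 Bx0 uB n0.
pose u i := iter i G (fun y => (y == x0)%:R : R).
have u0 i y : 0 <= u i y by apply: iter_resolvent_ge0 => // z; rewrite ler0n.
have del (F : I -> R) : \sum_y (y == x0)%:R * F y = F x0.
  rewrite (bigD1 x0)//= eqxx mul1r big1 ?addr0// => y /negPf ->.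
  by rewrite mul0r.
have u1 i : \sum_y u i y <= 1.
  elim: i => [|i IH].
    by have := del (fun=> 1); rewrite /u/=; under eq_bigr do rewrite mulr1; move=> ->.
  by apply: le_trans IH; exact: sum_resolvent_le.
pose a i := \sum_y u i y ^+ 2.
have a0 i : 0 <= a i by apply: sumr_ge0 => y _; rewrite sqr_ge0.
set c := 4 `^ eps * K.
have c0 : 0 < c by rewrite mulr_gt0// powR_gt0.
have step i : a i.+1 + h / c * (a i.+1 * a i.+1 `^ eps) <= a i.
  have nsh := nash (u0 i.+1) (uB i.+1) (u1 i.+1).
  rewrite -/(u i.+1) -/(a i.+1) -/c in nsh.
  set D := _ + _ in nsh.
  have D2 : 2 * (h * D) = - (2 * \sum_y u i.+1 y * (h * lap om kap (u i.+1) y)).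
    have -> : \sum_y u i.+1 y * (h * lap om kap (u i.+1) y) =
        h * \sum_y u i.+1 y * lap om kap (u i.+1) y.
      by rewrite mulr_sumr; apply: eq_bigr => y _; ring.
    rewrite sum_lap// /D /energy /dform.
    have -> : \sum_y kap y * u i.+1 y * u i.+1 y = \sum_y kap y * u i.+1 y ^+ 2.
      by apply: eq_bigr => y _; ring.
    have -> : \sum_y \sum_z om y z * ((u i.+1 y - u i.+1 z) * (u i.+1 y - u i.+1 z))
       = \sum_y \sum_z om y z * (u i.+1 y - u i.+1 z) ^+ 2.
      by apply: eq_bigr => y _; apply: eq_bigr => z _; ring.
    ring.
  have e1 : a i.+1 + 2 * (h * D) <= a i.
    rewrite D2 /a mulr_sumr -sumrN -big_split/=; apply: ler_sum => y _.
    have := @resolventP R I om kap h om_ge0 kap_ge0 h_gt0 (u i) y.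
    rewrite -/G -/(u i.+1) => hy.
    have -> : h * lap om kap (u i.+1) y = u i.+1 y - u i y.
      by rewrite -hy /u/=; ring.
    have -> : u i.+1 y = G (u i) y by [].
    have := sqr_ge0 (G (u i) y - u i y); nra.
  have h2 : h / c * (a i.+1 * a i.+1 `^ eps) <= 2 * (h * D).
    have := ler_wpM2l (divr_ge0 (ltW h_gt0) (ltW c0)) nsh.
    move=> /le_trans; apply; rewrite le_eqVlt; apply/orP; left; apply/eqP.
    by field; rewrite gt_eqF.
  lra.
have mono i : a i.+1 <= a i.
  apply: le_trans (step i); rewrite lerDl; apply: mulr_ge0.
    exact: divr_ge0 (ltW h_gt0) (ltW c0).
  exact: mulr_ge0 (powR_ge0 _ _).
have a1 i : a i <= 1.
  elim: i => [|i IH]; last exact: le_trans (mono i) IH.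
  rewrite /a /u/= -[leRHS](del (fun=> 1)).
  by apply: ler_sum => y _; case: (y == x0); rewrite ?expr1n ?expr0n ?mul1r ?mul0r.
have anti i j : (i <= j)%N -> a j <= a i.
  move=> /subnK <-; elim: (j - i)%N => [|k IH] //.
  by rewrite addSn; exact: le_trans (mono _) IH.
have [an0|anN0] := eqVneq (a n) 0.
  by rewrite -/(u n) -/(a n) an0 powR_ge0.
have anp : 0 < a n by rewrite lt_def anN0 a0.
have hc1 : h / c <= 1 by rewrite ler_pdivrMr// mul1r.
have hc0 : 0 < h / c by rewrite divr_gt0.
have grow i : (i <= n)%N -> eps * (h / c) / 4 * i%:R <= (a i `^ eps)^-1.
  elim: i => [_|i IH ilt]; first by rewrite mulr0 invr_ge0 powR_ge0.
  have aip : 0 < a i.+1 by exact: lt_le_trans anp (anti _ _ ilt).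
  have := IH (ltnW ilt).
  have aip' : 0 < a i by exact: lt_le_trans aip (mono i).
  set b' := (a i.+1 `^ eps)^-1; set b := (a i `^ eps)^-1.
  have ae0 : 0 < a i.+1 `^ eps by exact: powR_gt0.
  have ae0' : 0 < a i `^ eps by exact: powR_gt0.
  have ae1 : a i.+1 `^ eps <= 1.
    apply: (@le_trans _ _ (1 `^ eps)); last by rewrite powR1.
    by rewrite ge0_ler_powR ?nnegrE ?(ltW eps0)//.
  pose x := h / c * a i.+1 `^ eps.
  have x0' : 0 <= x by exact: mulr_ge0 (ltW hc0) (ltW ae0).
  have x1 : x <= 1 by rewrite mulr_ile1// ltW.
  have : (a i.+1 * (1 + x)) `^ eps <= a i `^ eps.
    rewrite ge0_ler_powR ?nnegrE ?(ltW eps0)//.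
      by apply: mulr_ge0 => //; lra.
    by apply: le_trans (step i); rewrite /x le_eqVlt; apply/orP; left; apply/eqP; ring.
  rewrite powRM//; last by lra.
  have := powR1Dx_ge eps0 x0' x1.
  move=> /(ler_wpM2l (ltW ae0)) h1 /(le_trans h1) {h1} h1.
  have b0 : 0 < b by rewrite invr_gt0.
  have b'0 : 0 < b' by rewrite invr_gt0.
  have bE : a i.+1 `^ eps * b' = 1 by rewrite divff// gt_eqF.
  have bE' : a i `^ eps * b = 1 by rewrite divff// gt_eqF.
  have h2 : b * (1 + eps * x / 2) <= b'.
    have := ler_wpM2r (mulr_ge0 (ltW b0) (ltW b'0)) h1.
    rewrite (_ : _ * _ * (b * b') = (a i.+1 `^ eps * b') * (b * (1 + eps * x / 2)));
      last by ring.
    by rewrite mulrA bE' bE !mul1r.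
  have xb : x * b' = h / c by rewrite /x -mulrA bE mulr1.
  have y0 : 0 <= eps * x / 2 by rewrite divr_ge0// mulr_ge0// ltW.
  have y1 : eps * x / 2 <= 1.
    by have := ler_wpM2r x0' eps2; lra.
  (* This is [1 / (1 + s) <= 1 - s / 2] with [s = eps * x / 2] in the unit interval, hence the
     requirement [eps <= 2]. *)
  have h3 : b <= b' * (1 - eps * x / 4).
    have := ler_wpM2r (_ : 0 <= 1 - eps * x / 4) h2.
    have := mulr_ge0 (ltW b0) (mulr_ge0 y0 (_ : 0 <= 1 - eps * x / 2)).
    have p1 : 0 <= 1 - eps * x / 2 by lra.
    have p2 : 0 <= 1 - eps * x / 4 by lra.
    move=> /(_ p1) q1 /(_ p2) q2; nra.
  have eE : eps * (h / c) / 4 = b' * (eps * x / 4) by rewrite -xb; field.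
  rewrite -[i.+1%:R]natr1 mulrDr mulr1; set e := eps * (h / c) / 4 in eE * => IHb.
  by rewrite {2}eE; move: h3; rewrite mulrBr mulr1; lra.
have := grow n (leqnn n).
rewrite -/(u n) -/(a n) => gn.
have nr0 : 0 < n%:R :> R by rewrite ltr0n.
have ae0 : 0 < a n `^ eps by exact: powR_gt0.
have le1 : a n `^ eps <= 4 * c / (eps * (h * n%:R)).
  rewrite -[leLHS]invrK.
  rewrite (_ : 4 * c / _ = (eps * (h / c) / 4 * n%:R)^-1); last first.
    by field; rewrite !gt_eqF.
  have q0 : 0 < eps * (h / c) / 4 * n%:R.
    by apply: mulr_gt0 nr0; apply: divr_gt0 => //; exact: mulr_gt0.
  by rewrite lef_pV2// posrE ?invr_gt0.
rewrite [leLHS](_ : _ = (a n `^ eps) `^ eps^-1); last first.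
  by rewrite -powRrM mulfV ?gt_eqF// powRr1.
have rhs0 := le_trans (ltW ae0) le1.
apply: ge0_ler_powR => //; rewrite ?nnegrE ?invr_ge0 ?powR_ge0 ?(ltW eps0)//.
Qed.

End Nash.

(** * Mean value inequality *)

Section MeanValue.
Variables (R : realType) (I : finType) (om : I -> I -> R) (kap : I -> R) (h : R).
Variables (N : nat) (dist : I -> I -> R) (x0 : I) (r0 eps a K cm : R).
Hypothesis om_sym : forall y z, om y z = om z y.
Hypothesis om_ge0 : forall y z, 0 <= om y z.
Hypothesis kap_ge0 : forall y, 0 <= kap y.
Hypothesis h_gt0 : 0 < h.
Hypothesis dist_refl : forall y, dist y y = 0.
Hypothesis dist_triangle : forall y z w, dist y w <= dist y z + dist z w.
Hypothesis dist_adj : forall y z, om y z != 0 -> dist y z <= 1.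
Hypothesis r0_ge1 : 1 <= r0.
Hypothesis hN : h * N%:R = r0 ^+ 2.
Hypothesis K_ge1 : 1 <= K.
Hypothesis cm_ge1 : 1 <= cm.
Hypothesis a_bounds : 0 < a < 1.
Hypothesis eps_bounds : 0 < eps <= 2.
Let m y := \sum_z om y z.
Hypothesis m_norm : (\sum_(y | dist x0 y <= r0) m y `^ a^-1) `^ a <= cm.
Hypothesis fk_m : forall w : I -> R, (forall y, 0 <= w y) ->
  (forall y, ~~ (dist x0 y <= r0) -> w y = 0) ->
  \sum_y m y * w y ^+ 2 <= K * (\sum_y (w y != 0)%:R) `^ eps * energy om w.
Hypothesis fk_1 : forall w : I -> R, (forall y, 0 <= w y) ->
  (forall y, ~~ (dist x0 y <= r0) -> w y = 0) ->
  \sum_y w y ^+ 2 <= K * (\sum_y (w y != 0)%:R) `^ eps * energy om w.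

(** [A] is the least exponent allowed in [degiorgi]. [ga] satisfies [ga * (1 - a) = 2 + 2 / eps], so
    that the powers of the local radius cancel. The two arguments of the maximum belong to points
    near the boundary and to the others. *)
Definition absorb_const : R :=
  let A := 4 + 2 / eps in let ga := (2 + 2 / eps) / (1 - a) in
  Num.max (32 `^ ga)
    ((2 `^ ga * (2 * (1024 * (256 * 2 `^ A) `^ eps^-1 + 32 `^ A))) `^ (1 - a)^-1).

(** Hoelder's inequality after [f ^+ 2] is split into its powers [a] and [1 - a]: the first is
    bounded by the supremum [V], the second is summed. *)
Lemma mass_sum_le (B : pred I) (f : I -> R) (V L : R) :
  (forall y, B y -> dist x0 y <= r0) -> (forall y, B y -> f y ^+ 2 <= V) ->
  \sum_(y | B y) f y ^+ 2 <= L ->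
  \sum_(y | B y) m y * f y ^+ 2 <= V `^ a * cm * L `^ (1 - a).
Proof.
move=> Br fV fL; have /andP[a0 a1] := a_bounds.
have m0 y : 0 <= m y by apply: sumr_ge0.
have L0 : 0 <= L by apply: le_trans fL; apply: sumr_ge0 => y _; rewrite sqr_ge0.
pose g y := if B y then m y `^ a^-1 else 0.
pose k y := if B y then f y ^+ 2 else 0.
have g0 y : 0 <= g y by rewrite /g; case: ifP => // _; rewrite powR_ge0.
have k0 y : 0 <= k y by rewrite /k; case: ifP => // _; rewrite sqr_ge0.
(* [holder3] wants three positive exponents, so [1 - a] is cut into two equal halves. *)
have b0 : 0 < (1 - a) / 2 by rewrite divr_gt0// subr_gt0.
have hol := holder3 a0 b0 b0 (_ : a + (1 - a) / 2 + (1 - a) / 2 = 1) g0 k0 k0.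
have {hol} := hol _; rewrite (_ : a + (1 - a) / 2 + (1 - a) / 2 = 1); last by field.
move=> /(_ erefl) hol.
have split_pow (s : R) : 0 <= s -> s `^ ((1 - a) / 2) * s `^ ((1 - a) / 2) = s `^ (1 - a).
  move=> s0; rewrite -powRD; first by congr (_ `^ _); field.
  by rewrite (_ : _ + _ = 1 - a) ?subr_eq0 ?(gt_eqF a1)//; field.
rewrite -mulrA split_pow in hol; last exact: sumr_ge0.
have sg : (\sum_y g y) `^ a <= cm.
  apply: le_trans m_norm; rewrite ge0_ler_powR ?(ltW a0) ?nnegrE ?sumr_ge0//.
    by move=> y _; exact: powR_ge0.
  rewrite [leRHS]big_mkcond/=; apply: ler_sum => y _; rewrite /g.
  by case: ifP => [/Br ->//|_]; case: ifP => // _; rewrite powR_ge0.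
have sk : (\sum_y k y) `^ (1 - a) <= L `^ (1 - a).
  rewrite ge0_ler_powR ?nnegrE ?sumr_ge0// ?subr_ge0 ?(ltW a1)//.
  by rewrite /k -big_mkcond.
apply: (@le_trans _ _ (V `^ a * (\sum_y g y `^ a * k y `^ ((1 - a) / 2) * k y `^ ((1 - a) / 2)))).
  rewrite big_mkcond/= mulr_sumr; apply: ler_sum => y _; rewrite /g /k.
  case: ifP => [By|_]; last by rewrite !mulr_ge0 ?powR_ge0.
  rewrite -mulrA split_pow ?sqr_ge0// -powRrM mulVf ?gt_eqF// powRr1//.
  rewrite [leRHS]mulrCA ler_wpM2l//.
  have f0 := sqr_ge0 (f y).
  rewrite {1}(_ : f y ^+ 2 = (f y ^+ 2) `^ a * (f y ^+ 2) `^ (1 - a)); last first.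
    rewrite -powRD; first by rewrite addrC subrK powRr1.
    by rewrite addrC subrK oner_eq0.
  rewrite ler_wpM2r ?powR_ge0// ge0_ler_powR ?nnegrE ?(ltW a0)//; last exact: fV.
  exact: le_trans f0 (fV _ By).
rewrite -mulrA ler_wpM2l ?powR_ge0//.
apply: le_trans hol _; apply: ler_pM => //; exact: powR_ge0.
Qed.

(* The supremum of [dist-to-boundary ^ ga * v ^ 2] is absorbed: the local estimate
   bounds it by its own power [a < 1] times a power of the [L^2]-bound [L]. *)
Lemma absorption (v : nat -> I -> R) (L : R) n :
  (forall i y, 0 <= v i y) ->
  (forall y, dist x0 y <= r0 -> v 0%N y = 0) ->
  (forall i y, (i < N)%N -> dist x0 y <= r0 ->
     v i.+1 y - v i y <= h * \sum_z om y z * (v i.+1 z - v i.+1 y)) ->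
  (forall i, (i <= N)%N -> \sum_(y | dist x0 y <= r0) v i y ^+ 2 <= L) ->
  (n <= N)%N ->
  v n x0 ^+ 2 <= absorb_const * ((K / r0 ^+ 2) `^ eps^-1 * cm) `^ (1 - a)^-1 * L.
Proof.
move=> v0 vstart vsub vL nN; have /andP[a0 a1] := a_bounds.
have /andP[eps0 eps2] := eps_bounds.
have [r01 K_1 cm_1] := And3 r0_ge1 K_ge1 cm_ge1.
have r0p : 0 < r0 by lra.
have L0 : 0 <= L.
  by apply: le_trans (vL 0%N isT); apply: sumr_ge0 => y _; rewrite sqr_ge0.
have ia : 0 < 1 - a by rewrite subr_gt0.
rewrite /absorb_const; set A := 4 + 2 / eps; set ga := (2 + 2 / eps) / (1 - a).
set C1 := 2 `^ ga * _; set C := Num.max _ _.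
have e2 : 0 < 2 / eps by rewrite divr_gt0.
have ga0 : 0 < ga by rewrite divr_gt0//; lra.
have A0 : 0 <= A by rewrite /A; lra.
pose W (p : 'I_N.+1 * I) := pos_part (r0 - dist x0 p.2) `^ ga * v p.1 p.2 ^+ 2.
have [[n1 z] _ zmax] := Order.TotalTheory.arg_maxP W (isT : xpredT (ord0, x0)).
set M := W (n1, z) in zmax.
have M0 : 0 <= M by rewrite mulr_ge0 ?powR_ge0 ?sqr_ge0.
have Wle i y : (i <= N)%N -> pos_part (r0 - dist x0 y) `^ ga * v i y ^+ 2 <= M.
  by move=> iN; have := zmax (Ordinal (iN : (i < N.+1)%N), y) isT.
pose Q := (K `^ eps^-1 * r0 ^+ 2 * cm).
have K1 : 1 <= K `^ eps^-1.
  apply: (@le_trans _ _ (1 `^ eps^-1)); first by rewrite powR1.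
  by rewrite ge0_ler_powR ?nnegrE ?invr_ge0 ?(ltW eps0)//; lra.
have r21 : 1 <= r0 ^+ 2 by rewrite exprn_ege1.
have Q1 : 1 <= Q by rewrite /Q mulr_ege1// mulr_ege1.
have Q0 : 0 <= Q := le_trans ler01 Q1.
have C1p : 0 <= C1.
  apply: mulr_ge0; first exact: powR_ge0.
  apply: mulr_ge0; first exact: ler0n.
  apply: addr_ge0; last exact: powR_ge0.
  apply: mulr_ge0; [exact: ler0n|exact: powR_ge0].
have cA0 : 0 <= 256 * 2 `^ A by apply: mulr_ge0; [exact: ler0n|exact: powR_ge0].
have main : M <= C * Q `^ (1 - a)^-1 * L.
  have CQ0 : 0 <= C * Q `^ (1 - a)^-1.
    by rewrite mulr_ge0 ?powR_ge0// le_max powR_ge0.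
  have Qi1 : 1 <= Q `^ (1 - a)^-1.
    apply: (@le_trans _ _ (1 `^ (1 - a)^-1)); first by rewrite powR1.
    by rewrite ge0_ler_powR ?nnegrE ?invr_ge0 ?(ltW ia)//; lra.
  have [dz|dz] := leP r0 (dist x0 z).
    have -> : M = 0.
      by rewrite /M /W/= /pos_part (max_idPl _) ?subr_le0// powR0 ?gt_eqF// mul0r.
    exact: mulr_ge0.
  (* With half the distance to the boundary, the weight of any point within [r] of [z] is at least
     the power [ga] of [r]; hence [v ^+ 2 <= V] there. *)
  pose de := r0 - dist x0 z; pose r := de / 2.
  have de0 : 0 < de by rewrite subr_gt0.
  have rp : 0 < r by rewrite divr_gt0.
  have ME : M = de `^ ga * v n1 z ^+ 2.
    by rewrite /M /W/= /pos_part (max_idPr _)// ltW.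
  have n1N : (n1 <= N)%N by rewrite -ltnS.
  have vz : v n1 z ^+ 2 <= L.
    apply: le_trans (vL n1 n1N); rewrite (bigD1 z) ?(ltW dz)//= lerDl.
    by apply: sumr_ge0 => y _; rewrite sqr_ge0.
  (* Close to the boundary the iteration has no room above the lattice spacing, and a single summand
     of the L^2 bound suffices. *)
  have [r16|r16] := ltP r 16.
    rewrite ME; apply: (@le_trans _ _ (C * 1 * L)); last first.
      by rewrite ler_wpM2r// ler_wpM2l// le_max powR_ge0.
    rewrite mulr1; apply: ler_pM; rewrite ?powR_ge0 ?sqr_ge0//.
    rewrite le_max; apply/orP; left.
    rewrite ge0_ler_powR ?(ltW ga0) ?nnegrE ?(ltW de0)//.
    by move: r16; rewrite /r; lra.
  have inB y : dist z y <= r -> dist x0 y <= r0.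
    move=> zy; apply: le_trans (dist_triangle x0 z y) _.
    by move: zy; rewrite /r /de; move: dz; lra.
  have lip y w : om y w != 0 -> dist z w <= dist z y + 1.
    by move=> /dist_adj yw; apply: le_trans (dist_triangle z y w) _; lra.
  have fkz (w : I -> R) : (forall y, 0 <= w y) ->
      (forall y, ~~ (dist z y <= r) -> w y = 0) ->
      \sum_y (\sum_z om y z) * w y ^+ 2
      <= K * (\sum_y (w y != 0)%:R) `^ eps * energy om w.
    move=> w0 wz; apply: fk_m => // y ry; apply: wz.
    by apply: contra ry; exact: inB.
  have start y : dist z y <= r -> v 0%N y = 0 by move=> /inB /vstart.
  have sub i y : (i < N)%N -> dist z y <= r ->
     v i.+1 y - v i y <= h * \sum_z om y z * (v i.+1 z - v i.+1 y).
    by move=> iN /inB; exact: vsub.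
  have K0 : 0 < K by exact: lt_le_trans K_1.
  have Aeps : 2 + 4 * eps <= A * eps.
    rewrite (_ : A * eps = 2 + 4 * eps)//.
    by rewrite /A; field; rewrite gt_eqF.
  have dg := degiorgi om_sym om_ge0 h_gt0 lip start sub K0 eps0 fkz A0 Aeps r16
    n1N (_ : dist z z <= 0) (v0 n1 z).
  have {dg} := dg _; rewrite dist_refl => /(_ (lexx 0)).
  set T := (_ / r ^+ 2) `^ _; set lm := level_mass _ _ _ _ _ _ _ => dg.
  pose V := M / r `^ ga.
  have rga : 0 < r `^ ga by exact: powR_gt0.
  have lmle : lm <= r0 ^+ 2 * (V `^ a * cm * L `^ (1 - a)).
    rewrite -hN /lm /level_mass -mulrA ler_wpM2l ?(ltW h_gt0)//.
    apply: (@le_trans _ _ (\sum_(i < N) (V `^ a * cm * L `^ (1 - a)))); last first.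
      by rewrite sumr_const card_ord mulr_natl.
    apply: ler_sum => i _.
    have exE y : excess v 0 i.+1 y = v i.+1 y.
      by rewrite /excess subr0 /pos_part (max_idPr _).
    under eq_bigr do rewrite exE.
    apply: mass_sum_le => //.
      move=> y zy; rewrite /V ler_pdivlMr// mulrC.
      apply: le_trans (Wle i.+1 y (ltn_ord i)).
      rewrite ler_wpM2r ?sqr_ge0// ge0_ler_powR ?(ltW ga0) ?nnegrE ?pos_part_ge0 ?(ltW rp)//.
      rewrite /pos_part le_max; apply/orP; right.
      by have := dist_triangle x0 z y; move: zy; rewrite /r /de; lra.
    apply: le_trans (vL i.+1 (ltn_ord i)).
    rewrite big_mkcond [leRHS]big_mkcond/=; apply: ler_sum => y _.
    by case: ifP => [/inB ->//|_]; case: ifP => // _; rewrite sqr_ge0.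
  have rN0 : r != 0 by rewrite gt_eqF.
  have rga1 : r `^ ga * r `^ (- (ga * a)) = r `^ (2 + 2 / eps).
    rewrite -powRD; last by rewrite rN0 implybT.
    by congr (_ `^ _); rewrite /ga; field; rewrite !gt_eqF.
  have rpow : r `^ (2 + 2 / eps) = r ^+ 2 * (r ^+ 2) `^ eps^-1.
    rewrite powRD; last by rewrite rN0 implybT.
    by rewrite powR_mulrn ?(ltW rp)// powRrM powR_mulrn ?(ltW rp).
  have TE : T = (256 * 2 `^ A) `^ eps^-1 * K `^ eps^-1 / (r ^+ 2) `^ eps^-1.
    have ri0 : 0 <= r ^- 2 by rewrite invr_ge0 sqr_ge0.
    rewrite /T (powRM _ (mulr_ge0 cA0 (ltW K0)) ri0).
    rewrite (powRM _ cA0 (ltW K0)); congr (_ * _).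
    by rewrite -powR_inv1 ?sqr_ge0// powRAC powR_inv1 ?powR_ge0.
  have r2e : 0 < (r ^+ 2) `^ eps^-1 by rewrite powR_gt0// exprn_gt0.
  have pA : (32 / r) `^ A * r `^ (2 + 2 / eps) <= 32 `^ A.
    rewrite powRM ?invr_ge0 ?(ltW rp)// -mulrA ler_piMr ?powR_ge0//.
    rewrite -(powR_inv1 (ltW rp)) -powRrM mulN1r -powRD; last by rewrite rN0 implybT.
    apply: (@le_trans _ _ (r `^ 0)); last by rewrite powRr0.
    apply: ler_powR; first by apply: le_trans r16; rewrite ler1n.
    by rewrite (_ : _ + _ = - 2%:R) ?oppr_le0 ?ler0n// /A; ring.
  have bra : 2 * (1024 / r ^+ 2 * T + (32 / r) `^ A) * r `^ (2 + 2 / eps) <=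
      2 * (1024 * (256 * 2 `^ A) `^ eps^-1 + 32 `^ A) * K `^ eps^-1.
    have t1 : 1024 / r ^+ 2 * T * r `^ (2 + 2 / eps) =
        1024 * (256 * 2 `^ A) `^ eps^-1 * K `^ eps^-1.
      rewrite TE rpow; field; rewrite rN0 gt_eqF//.
    have t2 : 32 `^ A <= 32 `^ A * K `^ eps^-1 by rewrite ler_peMr ?powR_ge0.
    rewrite (_ : 2 * (1024 / r ^+ 2 * T + _) * _ = 2 * (1024 / r ^+ 2 * T *
      r `^ (2 + 2 / eps) + (32 / r) `^ A * r `^ (2 + 2 / eps))); last by ring.
    rewrite t1 (_ : 2 * (_ + 32 `^ A) * _ = 2 * (1024 * (256 * 2 `^ A) `^ eps^-1
      * K `^ eps^-1 + 32 `^ A * K `^ eps^-1)); last by ring.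
    rewrite ler_pM2l// lerD2l; exact: le_trans pA t2.
  have VE : V `^ a = M `^ a * r `^ (- (ga * a)).
    rewrite /V powRM ?invr_ge0 ?powR_ge0//; congr (_ * _).
    by rewrite -powR_inv1 ?powR_ge0// -!powRrM; congr (_ `^ _); ring.
  (* All powers of [r] have cancelled; dividing by the power [a] of [M] then absorbs the
     supremum. *)
  have Mle : M <= C1 * Q * (M `^ a * L `^ (1 - a)).
    rewrite {1}ME (_ : de = 2 * r); last by rewrite /r; field.
    rewrite powRM ?(ltW rp)// /C1 -!mulrA ler_pM2l ?powR_gt0//.
    rewrite mulrC; apply: le_trans (ler_wpM2r (ltW rga) dg) _.
    have T0 : 0 <= 2 * (1024 / r ^+ 2 * T + (32 / r) `^ A).
      apply: mulr_ge0; first exact: ler0n.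
      apply: addr_ge0; last exact: powR_ge0.
      apply: mulr_ge0; last exact: powR_ge0.
      by apply: divr_ge0; [exact: ler0n|exact: sqr_ge0].
    apply: le_trans (ler_wpM2r (ltW rga) (ler_wpM2l T0 lmle)) _.
    rewrite VE (_ : _ * r `^ ga = (2 * (1024 / r ^+ 2 * T + (32 / r) `^ A)
      * (r `^ ga * r `^ (- (ga * a)))) * (r0 ^+ 2 * cm * (M `^ a * L `^ (1 - a))));
      last by ring.
    rewrite rga1.
    have X0 : 0 <= r0 ^+ 2 * cm * (M `^ a * L `^ (1 - a)).
      apply: mulr_ge0; last exact: mulr_ge0 (powR_ge0 _ _) (powR_ge0 _ _).
      exact: mulr_ge0 (sqr_ge0 _) (le_trans ler01 cm_1).
    apply: le_trans (ler_wpM2r X0 bra) _.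
    by rewrite le_eqVlt; apply/orP; left; apply/eqP; rewrite /Q; ring.
  have [Mz|MN0] := eqVneq M 0; first by rewrite Mz mulr_ge0.
  have Mp : 0 < M by rewrite lt_def MN0.
  have M1 : M `^ (1 - a) <= C1 * Q * L `^ (1 - a).
    rewrite -(@ler_pM2r _ (M `^ a)) ?powR_gt0//.
    rewrite -powRD; last by rewrite MN0 implybT.
    rewrite subrK powRr1//; apply: le_trans Mle _.
    by rewrite le_eqVlt; apply/orP; left; apply/eqP; ring.
  rewrite [leLHS](_ : _ = (M `^ (1 - a)) `^ (1 - a)^-1); last first.
    by rewrite -powRrM mulfV ?gt_eqF// powRr1.
  apply: (@le_trans _ _ ((C1 * Q * L `^ (1 - a)) `^ (1 - a)^-1)).
    apply: ge0_ler_powR => //; rewrite ?nnegrE ?invr_ge0 ?(ltW ia) ?powR_ge0//.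
    exact: mulr_ge0 (mulr_ge0 C1p Q0) (powR_ge0 _ _).
  rewrite (powRM _ (mulr_ge0 C1p Q0) (powR_ge0 _ _)) (powRM _ C1p Q0) -powRrM mulfV ?gt_eqF// powRr1//.
  rewrite ler_wpM2r// ler_wpM2r ?powR_ge0// le_max; apply/orP; right.
  exact: lexx.
have rga : 0 < r0 `^ ga by exact: powR_gt0.
rewrite -(ler_pM2l rga).
have := Wle n x0 nN; rewrite dist_refl subr0 /pos_part (max_idPr (ltW r0p)).
move=> /le_trans; apply; apply: le_trans main _.
rewrite le_eqVlt; apply/orP; left; apply/eqP.
have -> : Q = (K / r0 ^+ 2) `^ eps^-1 * cm * r0 `^ (2 + 2 / eps).
  have r0N : r0 != 0 by rewrite gt_eqF.
  rewrite powRD; last by rewrite r0N implybT.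
  rewrite powRM ?invr_ge0 ?sqr_ge0//; last by lra.
  rewrite powR_mulrn ?(ltW r0p)// powRrM powR_mulrn ?(ltW r0p)//.
  rewrite -(powR_inv1 (sqr_ge0 r0)) (powRAC _ (-1)) powR_inv1 ?powR_ge0//.
  by rewrite /Q; field; rewrite gt_eqF// powR_gt0// exprn_gt0.
rewrite powRM ?powR_ge0//; last first.
  by rewrite mulr_ge0 ?powR_ge0//; lra.
rewrite -(powRrM r0) -/ga; ring.
Qed.

(* The generator with Dirichlet boundary conditions outside [B]: the weights of the
   edges leaving [B] are turned into killing rates. *)
Let B : pred I := fun y => dist x0 y <= r0.
Let omB (y z : I) := if B y && B z then om y z else 0.
Let kapB (y : I) := if B y then kap y + \sum_(z | ~~ B z) om y z else 0.
Let G := resolvent om kap h.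
Let GB := resolvent omB kapB h.

Lemma omB_sym y z : omB y z = omB z y.
Proof. by rewrite /omB andbC om_sym. Qed.

Lemma omB_ge0 y z : 0 <= omB y z.
Proof. by rewrite /omB; case: ifP. Qed.

Lemma kapB_ge0 y : 0 <= kapB y.
Proof. by rewrite /kapB; case: ifP => // _; rewrite addr_ge0// sumr_ge0. Qed.

Lemma lapB_in (w : I -> R) y : (forall z, ~~ B z -> w z = 0) -> B y ->
  lap omB kapB w y = lap om kap w y.
Proof.
move=> wB By; rewrite /lap /kapB By.
rewrite [in RHS](bigID B)/= [X in _ = _ + X - _](_ : _ = - (\sum_(z | ~~ B z) om y z) * w y).
  rewrite [in LHS](bigID B)/= [X in _ + X - _ = _]big1 ?addr0; last first.
    by move=> z /negPf Bz; rewrite /omB Bz andbF mul0r.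
  have -> : \sum_(i | B i) omB y i * (w i - w y) = \sum_(i | B i) om y i * (w i - w y).
    by apply: eq_bigr => z Bz; rewrite /omB By Bz.
  ring.
rewrite mulNr mulr_suml -sumrN; apply: eq_bigr => z Bz.
by rewrite (wB z Bz) sub0r mulrN.
Qed.

Lemma lapB_out (w : I -> R) y : ~~ B y -> lap omB kapB w y = 0.
Proof.
move=> /negPf By; rewrite /lap /kapB By mul0r subr0 big1// => z _.
by rewrite /omB By mul0r.
Qed.

(** For [w] supported in the ball, each form together with its killing term is minus the pairing of
    [w] with the same Laplacian, so the two agree; dropping [kap] gives the inequality. *)
Lemma energyB (w : I -> R) : (forall z, ~~ B z -> w z = 0) ->
  energy om w <= energy omB w + \sum_y kapB y * w y ^+ 2.
Proof.
move=> wB.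
have dE (o : I -> I -> R) : energy o w = dform o w w.
  by congr (_ * _); apply: eq_bigr => y _; apply: eq_bigr => z _; rewrite expr2.
have kE (k : I -> R) : \sum_y k y * w y ^+ 2 = \sum_y k y * w y * w y.
  by apply: eq_bigr => y _; rewrite expr2 mulrA.
have := sum_lap kapB omB_sym w w; have := sum_lap kap om_sym w w.
rewrite -!dE -!kE.
have -> : \sum_y w y * lap omB kapB w y = \sum_y w y * lap om kap w y.
  apply: eq_bigr => y _; have [By|By] := boolP (B y); first by rewrite lapB_in.
  by rewrite wB// !mul0r.
have : 0 <= \sum_y kap y * w y ^+ 2.
  by apply: sumr_ge0 => y _; rewrite mulr_ge0 ?sqr_ge0.
lra.
Qed.

Lemma iter_GB_out (f : I -> R) i y : (forall z, ~~ B z -> f z = 0) -> ~~ B y ->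
  iter i GB f y = 0.
Proof.
move=> fB By; elim: i => [|i IH] /=; first exact: fB.
have := @resolventP R I omB kapB h omB_ge0 kapB_ge0 h_gt0 (iter i GB f) y.
by rewrite lapB_out// mulr0 subr0 -/GB => ->.
Qed.

(** The first summand bounds the remainder, the second the Dirichlet solution; the factor 2 comes
    from squaring their sum. *)
Definition mean_value_const : R :=
  2 * (absorb_const * ((K / r0 ^+ 2) `^ eps^-1 * cm) `^ (1 - a)^-1
       + (4 * (4 `^ eps * K) / (eps * r0 ^+ 2)) `^ eps^-1).

(* The solution is split into the Dirichlet solution on the ball, controlled by the
   Nash inequality, and a remainder that vanishes at time 0 on the ball, so that
   De Giorgi's iteration applies to it without a cutoff in time. *)
Lemma mean_value (f : I -> R) (L : R) : (forall y, 0 <= f y) ->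
  h <= 4 `^ eps * K ->
  (forall i, (i <= N)%N -> \sum_(y | dist x0 y <= r0) iter i G f y ^+ 2 <= L) ->
  iter N G f x0 ^+ 2 <= mean_value_const * L.
Proof.
move=> f0 hK uL.
have Bx0 : B x0 by rewrite /B dist_refl; exact: le_trans ler01 r0_ge1.
pose fB y := if B y then f y else 0.
have fB0 y : 0 <= fB y by rewrite /fB; case: ifP.
have fBout y : ~~ B y -> fB y = 0 by rewrite /fB => /negPf ->.
pose u i := iter i G f; pose d i := iter i GB fB.
have u0 i y : 0 <= u i y by exact: iter_resolvent_ge0.
have d0 i y : 0 <= d i y.
  by apply: (iter_resolvent_ge0 omB_ge0 kapB_ge0 h_gt0).
have dout i y : ~~ B y -> d i y = 0 by exact: iter_GB_out.
pose v i y := u i y - d i y.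
have uE i y : u i.+1 y - h * lap om kap (u i.+1) y = u i y.
  exact: (@resolventP R I om kap h om_ge0 kap_ge0 h_gt0 (u i) y).
have dE i y : B y -> d i.+1 y - h * lap om kap (d i.+1) y = d i y.
  move=> By; rewrite -lapB_in//; last exact: dout.
  exact: (@resolventP R I omB kapB h omB_ge0 kapB_ge0 h_gt0 (d i) y).
have vlap i y : lap om kap (v i) y = lap om kap (u i) y - lap om kap (d i) y.
  rewrite /lap.
  have -> : \sum_z om y z * (v i z - v i y) =
    \sum_z om y z * (u i z - u i y) - \sum_z om y z * (d i z - d i y).
    by rewrite -sumrN -big_split/=; apply: eq_bigr => z _; rewrite /v; ring.
  rewrite /v; ring.
have vE i y : B y -> v i.+1 y - h * lap om kap (v i.+1) y = v i y.
  by move=> By; rewrite vlap /v -(uE i y) -(dE i y By); ring.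
(* The Dirichlet solution stays below the full one: it vanishes outside the ball, and inside both
   solve the same equation. *)
have v0 i : forall y, 0 <= v i y.
  elim: i => [|i IH].
    by move=> y; rewrite /v /u /d/= /fB; case: ifP => _; rewrite ?subrr ?subr0.
  apply: (min_principle om_ge0 kap_ge0 h_gt0 (B := B)) => y By.
    by rewrite /v dout// subr0.
  by rewrite vE.
have vstart y : dist x0 y <= r0 -> v 0%N y = 0.
  by move=> By; rewrite /v /u /d/= /fB /B By subrr.
have vsub i y : (i < N)%N -> dist x0 y <= r0 ->
   v i.+1 y - v i y <= h * \sum_z om y z * (v i.+1 z - v i.+1 y).
  move=> _ By; rewrite -(vE i y By) opprB addrC subrK ler_wpM2l ?(ltW h_gt0)//.
  by rewrite /lap gerBl mulr_ge0.
have vL i : (i <= N)%N -> \sum_(y | dist x0 y <= r0) v i y ^+ 2 <= L.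
  move=> /uL; apply: le_trans; apply: ler_sum => y _.
  have vu : v i y <= u i y by rewrite /v gerBl.
  by rewrite -[iter i G f y]/(u i y) lerXn2r ?nnegrE.
have va := absorption v0 vstart vsub vL (leqnn N).
have /andP[eps0 eps2] := eps_bounds.
have L0 : 0 <= L.
  by apply: le_trans (uL 0%N isT); apply: sumr_ge0 => y _; rewrite sqr_ge0.
have N0 : (0 < N)%N.
  rewrite lt0n; apply/negP => /eqP NE; have := hN; rewrite NE mulr0 => /esym/eqP.
  by rewrite sqrf_eq0 gt_eqF//; exact: lt_le_trans ltr01 r0_ge1.
have K0 : 0 < K by exact: lt_le_trans ltr01 K_ge1.
pose del (y : I) : R := (y == x0)%:R.
have delout y : ~~ B y -> del y = 0.
  by move=> By; rewrite /del; case: eqVneq => // yx; rewrite yx Bx0 in By.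
have nd : \sum_y iter N GB del y ^+ 2 <= (4 * (4 `^ eps * K) / (eps * (h * N%:R))) `^ eps^-1.
  apply: (nash_decay (B := B)) => //.
  - exact: omB_sym.
  - exact: omB_ge0.
  - exact: kapB_ge0.
  - move=> w w0 wB; apply: le_trans (fk_1 w0 wB) _.
    rewrite ler_wpM2l ?energyB//.
    exact: mulr_ge0 (ltW K0) (powR_ge0 _ _).
  - by move=> i y By; exact: iter_GB_out.
(* By symmetry the value at [x0] is the pairing of the initial datum with the Dirichlet kernel of
   [x0], whose L^2 norm is bounded by [nd]. *)
have da : d N x0 ^+ 2 <= (4 * (4 `^ eps * K) / (eps * r0 ^+ 2)) `^ eps^-1 * L.
  have -> : d N x0 = \sum_y iter N GB del y * fB y.
    rewrite (iter_resolvent_adj omB_sym omB_ge0 kapB_ge0 h_gt0).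
    rewrite (bigD1 x0)//= /del eqxx mul1r big1 ?addr0// => y /negPf ->.
    by rewrite mul0r.
  apply: le_trans (cauchy_schwarz _ _) _.
  rewrite -hN; apply: ler_pM => //.
  - by apply: sumr_ge0 => y _; rewrite sqr_ge0.
  - by apply: sumr_ge0 => y _; rewrite sqr_ge0.
  - apply: le_trans (uL 0%N isT); rewrite [leRHS]big_mkcond/=.
    by apply: ler_sum => y _; rewrite /fB /B; case: ifP => // _; rewrite expr0n.
rewrite -/(u N) (_ : u N x0 = v N x0 + d N x0); last by rewrite /v subrK.
rewrite /mean_value_const; move: va da.
set X := _ * L; set Y := _ * L => va da.
rewrite (_ : 2 * _ * L = 2 * (X + Y)); last by rewrite /X /Y; ring.
have := sqr_ge0 (v N x0 - d N x0); nra.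
Qed.

End MeanValue.

(** * Davies' method *)

Section OffDiagonal.
Variables (R : realType) (I : finType) (om : I -> I -> R) (kap : I -> R) (h : R).
Variables (N : nat) (dist : I -> I -> R) (rr Q H b : R).
Hypothesis om_sym : forall y z, om y z = om z y.
Hypothesis om_ge0 : forall y z, 0 <= om y z.
Hypothesis kap_ge0 : forall y, 0 <= kap y.
Hypothesis h_gt0 : 0 < h.
Hypothesis H_ge0 : 0 <= H.
Hypothesis hH : 2 * (h * H) <= 2^-1.
Hypothesis Q_ge0 : 0 <= Q.
Let G := resolvent om kap h.

Definition delta (x y : I) : R := (y == x)%:R.

(** Kept abstract in [Q] and [rr], so that Davies' method also accepts the trivial inequality with
    [rr = 0] and [Q = 1] used for small times. *)
Definition mean_value_at (x : I) : Prop :=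
  forall (f : I -> R) (L : R), (forall y, 0 <= f y) ->
  (forall i, (i <= N)%N -> \sum_(y | dist x y <= rr) iter i G f y ^+ 2 <= L) ->
  iter N G f x ^+ 2 <= Q * L.

Lemma sum_delta x (F : I -> R) : \sum_y delta x y * F y = F x.
Proof.
rewrite (bigD1 x)//= /delta eqxx mul1r big1 ?addr0// => y /negPf ->.
by rewrite mul0r.
Qed.

(* [f = exp (- 2 psi) p] turns the left-hand side [Z] into [(G^N f) x], and the
   mean value inequality followed by Davies' estimate gives [Z ^ 2 <= C Z]. *)
Lemma weighted_kernel_le (psi : I -> R) x : mean_value_at x ->
  (forall y, dist x y <= rr -> psi x - psi y <= b) ->
  (forall y, \sum_z om y z * (expR (psi y - psi z) + expR (psi z - psi y) - 2)
             <= 2 * H) ->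
  \sum_y (expR (- psi y) * iter N G (delta x) y) ^+ 2
  <= Q * expR (2 * (b - psi x) + 4 * (h * H) * N%:R).
Proof.
move=> mv psib psiH.
set p := iter N G (delta x).
have p0 y : 0 <= p y by apply: iter_resolvent_ge0 => // z; rewrite /delta ler0n.
pose f y := expR (- psi y) ^+ 2 * p y.
have f0 y : 0 <= f y by rewrite mulr_ge0 ?sqr_ge0.
set Z := \sum_y _.
have Z0 : 0 <= Z by apply: sumr_ge0 => y _; rewrite sqr_ge0.
have ZE : Z = iter N G f x.
  rewrite -(sum_delta x) -(iter_resolvent_adj om_sym om_ge0 kap_ge0 h_gt0).
  by apply: eq_bigr => y _; rewrite /f -/p; ring.
have ee y : expR (psi y) * expR (- psi y) = 1 by rewrite -expRD subrr expR0.
have ZE2 : Z = \sum_y expR (psi y) ^+ 2 * f y ^+ 2.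
  apply: eq_bigr => y _; rewrite /f.
  rewrite (_ : expR (psi y) ^+ 2 * _ = (expR (psi y) * expR (- psi y)) ^+ 2
    * (expR (- psi y) * p y) ^+ 2); last by ring.
  by rewrite ee expr1n mul1r.
set E := expR _.
have L_le i : (i <= N)%N -> \sum_(y | dist x y <= rr) iter i G f y ^+ 2 <= E * Z.
  move=> iN.
  apply: (@le_trans _ _ (expR (2 * (b - psi x)) *
      \sum_y expR (psi y) ^+ 2 * iter i G f y ^+ 2)).
    rewrite big_mkcond mulr_sumr; apply: ler_sum => y _.
    case: ifP => [/psib yb|_]; last by rewrite mulr_ge0 ?expR_ge0// mulr_ge0 ?sqr_ge0.
    rewrite mulrA ler_peMl ?sqr_ge0//.
    rewrite -expRM_natl -expRD -[leLHS]expR0 ler_expR; lra.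
  rewrite /E expRD -mulrA ler_wpM2l ?expR_ge0//.
  apply: le_trans (davies om_sym om_ge0 kap_ge0 h_gt0 f i H_ge0 hH psiH) _.
  rewrite -ZE2 ler_wpM2r// ler_expR ler_wpM2l ?ler_nat//.
  by rewrite mulr_ge0// mulr_ge0// ltW.
have := mv f (E * Z) f0 L_le; rewrite -ZE.
have [->|ZN0] := eqVneq Z 0; first by rewrite mulr_ge0 ?expR_ge0.
have Zp : 0 < Z by rewrite lt_def ZN0.
by rewrite expr2 mulrA ler_pM2r.
Qed.

(** The kernel after [N + N] steps is the pairing of two kernels after [N] steps. The weights
    [expR (- psi)] and [expR psi] cancel in the product, and Cauchy-Schwarz leaves
    [weighted_kernel_le] for [psi] at [x] and for [- psi] at [y]. *)
Lemma off_diagonal (psi : I -> R) x y : mean_value_at x -> mean_value_at y ->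
  (forall z, dist x z <= rr -> `|psi x - psi z| <= b) ->
  (forall z, dist y z <= rr -> `|psi y - psi z| <= b) ->
  (forall y, \sum_z om y z * (expR (psi y - psi z) + expR (psi z - psi y) - 2)
             <= 2 * H) ->
  iter (N + N) G (delta y) x
  <= Q * expR (psi y - psi x + 2 * b + 4 * (h * H) * N%:R).
Proof.
move=> mvx mvy bx by_ psiH.
have Zx := weighted_kernel_le mvx
  (fun z zx => le_trans (ler_norm _) (bx z zx)) psiH.
have Zy := @weighted_kernel_le (fun z => - psi z) y mvy.
have {}Zy := Zy _ _.
have bN z : dist y z <= rr -> - psi y - - psi z <= b.
  move=> zy; apply: le_trans (by_ z zy); rewrite distrC; apply: le_trans (ler_norm _).
  lra.
have psiN z : \sum_w om z w * (expR (- psi z - - psi w) + expR (- psi w - - psi z) - 2)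
   <= 2 * H.
  apply: le_trans (psiH z); apply: ler_sum => w _.
  rewrite ler_wpM2l// lerD2r addrC le_eqVlt; apply/orP; left; apply/eqP.
  by congr (expR _ + expR _); ring.
have {}Zy := Zy bN psiN.
set p := iter (N + N) G (delta y) x.
have p0 : 0 <= p by apply: iter_resolvent_ge0 => // z; rewrite /delta ler0n.
have pE : p = \sum_z (expR (- psi z) * iter N G (delta x) z)
                     * (expR (- - psi z) * iter N G (delta y) z).
  rewrite /p iterD -(sum_delta x) -(iter_resolvent_adj om_sym om_ge0 kap_ge0 h_gt0).
  apply: eq_bigr => z _.
  have ee : expR (- psi z) * expR (- - psi z) = 1 by rewrite -expRD addrN expR0.
  by rewrite mulrACA ee mul1r.
set E := expR _.
rewrite -[leLHS]ger0_norm// -[leRHS]ger0_norm; last by rewrite mulr_ge0 ?expR_ge0.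
rewrite -ler_sqr ?nnegrE// !real_normK ?num_real//.
rewrite {1}pE; apply: le_trans (cauchy_schwarz _ _) _.
apply: le_trans (ler_pM _ _ Zx Zy) _; try by apply: sumr_ge0 => z _; rewrite sqr_ge0.
rewrite mulrACA -expRD exprMn expr2 ler_wpM2l ?mulr_ge0//.
rewrite /E -expRM_natl ler_expR; lra.
Qed.

End OffDiagonal.

(** * Graph and chemical distances *)

Section GraphFacts.
Variables (R : realType) (V : choiceType) (adj : rel V).

(** Bridge from sums over sets of vertices to the sums over a finite type in which the analysis is
    done. *)
Lemma fsum_reindex (J : finType) (T : choiceType) (f : J -> T) (A : set T) (F : T -> R) :
  injective f -> (forall z, A z -> exists j, f j = z) ->
  \sum_(z \in A) F z = \sum_(j | `[< A (f j) >]) F (f j).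
Proof.
move=> finj fA.
pose r := [seq f j | j <- index_enum J & `[< A (f j) >]].
have rA z : (z \in r) = (z \in A).
  apply/mapP/idP => [[j]|].
    by rewrite mem_filter => /andP[/asboolP Aj _] ->; rewrite inE.
  rewrite inE => Az; have [j jz] := fA _ Az; exists j => //.
  by rewrite mem_filter mem_index_enum andbT; apply/asboolP; rewrite jz.
have finA : finite_set A.
  apply: (sub_finite_set _ (finite_seq r)) => z Az.
  by rewrite /mkset rA inE.
rewrite fsbig_finite// (perm_big r)/=.
  by rewrite big_map big_filter.
apply: uniq_perm => //.
  by rewrite map_inj_uniq// filter_uniq// index_enum_uniq.
by move=> z; rewrite rA in_fset_set.
Qed.

Lemma card_set_sum (A : set V) : finite_set A ->
  (card_set A)%:R = \sum_(z \in A) (1 : R).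
Proof.
move=> finA; rewrite fsbig_finite// big_const_seq iter_addr_0 count_predT.
by [].
Qed.

Hypothesis graph : infinite_graph adj.
Let asym : symmetric adj := graph_sym graph.

Lemma paths_cat x y z s s' : paths adj x y s -> paths adj y z s' ->
  paths adj x z (s ++ s').
Proof.
move=> [ps ls] [ps' ls']; split.
  by rewrite cat_path ps ls ps'.
by rewrite last_cat ls.
Qed.

Lemma graph_dist_attained x y : exists2 s, paths adj x y s &
  graph_dist R adj x y = (size s)%:R /\
  forall s', paths adj x y s' -> (size s <= size s')%N.
Proof.
have [s0 ps0] := graph_connected graph x y.
have ex : exists n, `[< exists2 s, paths adj x y s & size s = n >].
  by exists (size s0); apply/asboolP; exists s0.
have [n /asboolP[s ps sn] nmin] := ex_minnP ex.
exists s => //; split; last first.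
  by move=> s' ps'; rewrite sn; apply: nmin; apply/asboolP; exists s'.
apply/eqP; rewrite eq_le; apply/andP; split.
  apply: ge_inf; last by exists s.
  by exists 0 => _ [s' _ <-]; rewrite ler0n.
apply: lb_le_inf; first by exists (size s)%:R, s.
move=> _ [s' ps' <-]; rewrite ler_nat sn; apply: nmin; apply/asboolP; by exists s'.
Qed.

Lemma graph_dist_le x y s : paths adj x y s -> graph_dist R adj x y <= (size s)%:R.
Proof.
move=> ps; have [s' _ [-> smin]] := graph_dist_attained x y.
by rewrite ler_nat smin.
Qed.

Lemma graph_dist_ge0 x y : 0 <= graph_dist R adj x y.
Proof. by have [s _ [-> _]] := graph_dist_attained x y. Qed.

Lemma graph_dist_refl x : graph_dist R adj x x = 0.
Proof.
apply/eqP; rewrite eq_le graph_dist_ge0 andbT.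
by have := @graph_dist_le x x [::]; apply.
Qed.

Lemma graph_dist_triangle x y z :
  graph_dist R adj x z <= graph_dist R adj x y + graph_dist R adj y z.
Proof.
have [s ps [-> _]] := graph_dist_attained x y.
have [s' ps' [-> _]] := graph_dist_attained y z.
by rewrite -natrD -size_cat; apply: graph_dist_le; exact: paths_cat ps ps'.
Qed.

Lemma graph_dist_adj x y : adj x y -> graph_dist R adj x y <= 1.
Proof.
by move=> xy; have := @graph_dist_le x y [:: y]; apply; split => //=; rewrite xy.
Qed.

Lemma finite_reach x n : finite_set [set y | exists2 s, paths adj x y s & (size s <= n)%N].
Proof.
elim: n => [|n IH].
  apply: (sub_finite_set _ (finite_set1 x)) => y [s [_ <-]].
  by rewrite leqn0 => /nilP ->.
set A := [set y | _] in IH.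
have finU : finite_set (A `|` \bigcup_(z in A) neighbours adj z).
  rewrite finite_setU; split => //; apply: bigcup_finite => // z _.
  exact: graph_locally_finite.
apply: (sub_finite_set _ finU) => y [s [ps ls] sn].
move: ps ls sn; case/lastP: s => [|s z] ps ls sn.
  by left; exists [::].
rewrite last_rcons in ls; rewrite rcons_path in ps; case/andP: ps => ps pz.
rewrite size_rcons in sn.
by right; exists (last x s); [exists s|rewrite /neighbours/= -ls].
Qed.

Lemma finite_gball x (r : R) : finite_set (gball adj x r).
Proof.
apply: (sub_finite_set _ (finite_reach x (Num.truncn r))) => y; rewrite /gball/= => yr.
have [s ps [sE _]] := graph_dist_attained x y; exists s => //.
rewrite truncn_ge_nat -?sE//; exact: le_trans (graph_dist_ge0 x y) yr.
Qed.

Lemma finite_neighbours x : finite_set (neighbours adj x).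
Proof. exact: graph_locally_finite. Qed.

Lemma exists_neighbour x : exists y, adj x y.
Proof.
have [y yx] : exists y, y != x.
  apply: contrapT => nex; apply: (graph_infinite graph).
  apply: (sub_finite_set _ (finite_set1 x)) => y _ /=.
  by apply/eqP; apply: contrapT => /negP yx; apply: nex; exists y.
have [s [ps ls]] := graph_connected graph x y.
case: s ps ls => [_ /= xy|z s /andP[xz _] _]; last by exists z.
by rewrite xy eqxx in yx.
Qed.

Variable omega : V -> V -> R.
Hypothesis weights : edge_weights adj omega.

Definition edge_length (z z' : V) : R := Num.min 1 (omega z z' `^ (- 2^-1)).

Lemma edge_length_bounds z z' : 0 <= edge_length z z' <= 1.
Proof. by rewrite /edge_length le_min ler01 powR_ge0/= ge_min lexx. Qed.

Lemma chemical_dist_le x y s : paths adj x y s ->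
  chemical_dist adj omega x y <= \sum_(l <- pairmap edge_length x s) l.
Proof.
move=> ps; apply: ge_inf; last by exists s.
exists 0 => _ [s' _ <-]; elim: s' x {ps} => [|z s' IH] x /=; rewrite ?big_nil//.
by rewrite big_cons addr_ge0//; case/andP: (edge_length_bounds x z).
Qed.

Lemma chemical_dist_ge0 x y : 0 <= chemical_dist adj omega x y.
Proof.
apply: lb_le_inf; first by have [s ps] := graph_connected graph x y; eexists; exists s.
move=> _ [s' _ <-]; elim: s' x => [|z s' IH] x /=; rewrite ?big_nil//.
by rewrite big_cons addr_ge0//; case/andP: (edge_length_bounds x z).
Qed.

Lemma chemical_dist_refl x : chemical_dist adj omega x x = 0.
Proof.
apply/eqP; rewrite eq_le chemical_dist_ge0 andbT.
by have := @chemical_dist_le x x [::]; rewrite big_nil; apply.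
Qed.

(** The infimum need not be attained, so an arbitrary path to [y] is prolonged by the edge before
    the infimum is taken. *)
Lemma chemical_dist_edge x y z : adj y z ->
  chemical_dist adj omega x z <= chemical_dist adj omega x y + edge_length y z.
Proof.
move=> yz; rewrite -lerBlDr; apply: lb_le_inf.
  by have [s ps] := graph_connected graph x y; eexists; exists s.
move=> _ [s [ps ls] <-]; rewrite lerBlDr.
have : paths adj x z (s ++ [:: z]).
  by apply: paths_cat (conj ps ls) _; split => //=; rewrite yz.
move=> /chemical_dist_le; rewrite pairmap_cat big_cat/= ls big_seq1.
exact.
Qed.

Lemma edge_length_sym y z : edge_length y z = edge_length z y.
Proof. by rewrite /edge_length (weight_sym weights). Qed.

Lemma chemical_dist_lip x y z : adj y z ->
  `|chemical_dist adj omega x y - chemical_dist adj omega x z| <= edge_length y z.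
Proof.
move=> yz; have h1 := chemical_dist_edge x yz.
have h2 : chemical_dist adj omega x y <= chemical_dist adj omega x z + edge_length y z.
  by rewrite edge_length_sym; apply: chemical_dist_edge; rewrite asym.
by rewrite ler_norml; apply/andP; split; lra.
Qed.

(** Edge lengths are at most 1. This bounds the oscillation of Davies' perturbation on the balls of
    the mean value inequality. *)
Lemma chemical_dist_lip_graph x y z :
  `|chemical_dist adj omega x y - chemical_dist adj omega x z| <= graph_dist R adj y z.
Proof.
have [s ps [-> _]] := graph_dist_attained y z.
elim: s y ps => [|w s IH] y [].
  by move=> _ /= ->; rewrite subrr normr0.
move=> /= /andP[yw ps] ls; rewrite -[_.+1%:R]natr1 [leRHS]addrC.
have -> : chemical_dist adj omega x y - chemical_dist adj omega x z =
  chemical_dist adj omega x y - chemical_dist adj omega x w +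
  (chemical_dist adj omega x w - chemical_dist adj omega x z) by ring.
apply: le_trans (ler_normD _ _) _; apply: lerD; last exact: IH.
apply: le_trans (chemical_dist_lip x yw) _.
by case/andP: (edge_length_bounds y w).
Qed.

Lemma mu_gt0 x : 0 < mu adj omega x.
Proof.
have [y xy] := exists_neighbour x.
rewrite /mu fsbig_finite; last exact: finite_neighbours.
have yin : y \in fset_set (neighbours adj x).
  by rewrite in_fset_set ?inE//; exact: finite_neighbours.
rewrite (big_fsetD1 y)//=; apply: ltr_pwDl; first exact: weight_gt0 weights _ _ xy.
rewrite big_seq; apply: sumr_ge0 => z; rewrite in_fsetD1 => /andP[_].
rewrite in_fset_set; last exact: finite_neighbours.
by rewrite inE => /(weight_gt0 weights)/ltW.
Qed.

Lemma omega_ge0 x y : 0 <= omega x y.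
Proof.
have [/(weight_gt0 weights)/ltW//|/(weight_eq0 weights) ->//] := boolP (adj x y).
Qed.

End GraphFacts.

(** * Finite boxes *)

Lemma ler_sum_subseq (R : realType) (T : eqType) (r1 r2 : seq T) (F : T -> R) :
  uniq r1 -> uniq r2 -> {subset r1 <= r2} -> (forall z, z \in r2 -> 0 <= F z) ->
  \sum_(z <- r1) F z <= \sum_(z <- r2) F z.
Proof.
move=> u1 u2 sub F0; rewrite [leRHS](bigID (fun z => z \in r1))/=.
rewrite -[X in _ <= X + _]big_filter [X in _ <= X + _](perm_big r1)/= ?lerDl.
  by rewrite big_seq_cond; apply: sumr_ge0 => z /andP[/F0].
apply: uniq_perm; rewrite ?filter_uniq// => z.
by rewrite mem_filter andb_idr//; exact: sub.
Qed.

Lemma fsum_le_sub (R : realType) (T : choiceType) (A B : set T) (F : T -> R) :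
  finite_set B -> A `<=` B -> (forall z, B z -> 0 <= F z) ->
  \sum_(z \in A) F z <= \sum_(z \in B) F z.
Proof.
move=> fB AB F0; have fA : finite_set A by exact: sub_finite_set AB fB.
rewrite !fsbig_finite//; apply: ler_sum_subseq => // z; rewrite !in_fset_set// !inE.
  exact: AB.
exact: F0.
Qed.

Section Box.
Variables (R : realType) (V : choiceType) (adj : rel V) (omega : V -> V -> R).
Variable (Lam : {fset V}).
Hypothesis graph : infinite_graph adj.
Hypothesis weights : edge_weights adj omega.

Definition box_weight (y z : Lam) : R := omega (val y) (val z).

(** The rate of the jumps that leave the box, so that the total rate at a vertex remains [mu]. *)
Definition box_killing (y : Lam) : R :=
  mu adj omega (val y) - \sum_z box_weight y z.

Lemma box_weight_sym y z : box_weight y z = box_weight z y.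
Proof. exact: weight_sym weights _ _. Qed.

Lemma box_weight_ge0 y z : 0 <= box_weight y z.
Proof. exact: omega_ge0 weights _ _. Qed.

Lemma box_weight_neq0 y z : (box_weight y z != 0) = adj (val y) (val z).
Proof.
rewrite /box_weight; have [yz|yz] := boolP (adj (val y) (val z)).
  by rewrite gt_eqF// (weight_gt0 weights).
by rewrite (weight_eq0 weights)// eqxx.
Qed.

Lemma box_sum_le (y : Lam) (F : V -> R) :
  (forall z, adj (val y) z -> 0 <= F z) -> (forall z, ~~ adj (val y) z -> F z = 0) ->
  \sum_(z : Lam) F (val z) <= \sum_(z \in neighbours adj (val y)) F z.
Proof.
move=> F0 Fz; pose A := [set z | adj (val y) z /\ z \in Lam].
have -> : \sum_(z : Lam) F (val z) = \sum_(z \in A) F z.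
  rewrite (fsum_reindex (f := val : Lam -> V)); last 2 first.
  - exact: val_inj.
  - by move=> z [_ zL]; exists [` zL]%fset.
  rewrite [RHS]big_mkcond/=; apply: eq_bigr => z _.
  case: asboolP => //= nA; rewrite Fz//.
  by apply/negP => yz; apply: nA; split => //; exact: fsvalP.
apply: fsum_le_sub => //; first exact: finite_neighbours graph _.
by move=> z [].
Qed.

Lemma box_killing_ge0 y : 0 <= box_killing y.
Proof.
rewrite subr_ge0; apply: box_sum_le => z yz; last exact: weight_eq0 weights _ _ yz.
exact: omega_ge0 weights _ _.
Qed.

Lemma box_mass_le y : \sum_z box_weight y z <= mu adj omega (val y).
Proof. by rewrite -subr_ge0; exact: box_killing_ge0. Qed.

Lemma box_nu_le y : \sum_z (box_weight y z)^-1 <= nu adj omega (val y).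
Proof.
apply: (box_sum_le (F := fun z => (omega (val y) z)^-1)) => z yz.
  by rewrite invr_ge0; exact: omega_ge0 weights _ _.
by rewrite (weight_eq0 weights)// invr0.
Qed.

(** Both arguments of the minimum in [edge_length] are used: the power of the weight makes
    [l ^+ 2 * box_weight y z <= 1], and the bound [l <= 1] keeps the exponential below [expR lam].
    The degree bound sums this over the neighbours. *)
Lemma box_davies (Cdeg lam : R) (psi : Lam -> R) : bounded_degree adj Cdeg ->
  0 <= lam ->
  (forall y z, adj (val y) (val z) ->
     `|psi y - psi z| <= lam * edge_length omega (val y) (val z)) ->
  forall y, \sum_z box_weight y z
    * (expR (psi y - psi z) + expR (psi z - psi y) - 2)
  <= 2 * (Cdeg * lam ^+ 2 * expR lam / 2).
Proof.
move=> deg lam0 lip y.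
have c0 : 0 <= lam ^+ 2 * expR lam by rewrite mulr_ge0 ?sqr_ge0 ?expR_ge0.
pose F z := (adj (val y) z)%:R * (lam ^+ 2 * expR lam).
apply: (@le_trans _ _ (\sum_(z : Lam) F (val z))).
  apply: ler_sum => z _; rewrite /F.
  have [yz|yz] := boolP (adj (val y) (val z)); last first.
    by rewrite /box_weight (weight_eq0 weights)// !mul0r.
  rewrite mul1r; have w0 := weight_gt0 weights yz; rewrite -/(box_weight y z) in w0.
  set l := edge_length omega (val y) (val z).
  have l01 : 0 <= l <= 1 by exact: edge_length_bounds.
  have lw : l ^+ 2 * box_weight y z <= 1.
    have lle : l <= box_weight y z `^ (- 2^-1) by rewrite /l /edge_length ge_min lexx orbT.
    have l0 : 0 <= l by case/andP: l01.
    have : l ^+ 2 <= (box_weight y z `^ (- 2^-1)) ^+ 2.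
      by rewrite lerXn2r// nnegrE ?powR_ge0.
    have -> : (box_weight y z `^ (- 2^-1)) ^+ 2 = (box_weight y z)^-1.
      rewrite -powR_mulrn ?powR_ge0// -powRrM (_ : - 2^-1 * 2%:R = -1); last by field.
      by rewrite powR_inv1// ltW.
    move=> /(ler_wpM2r (ltW w0)) /le_trans; apply.
    by rewrite mulVf// gt_eqF.
  have b_le (b : R) : 0 <= b -> b <= lam * l ->
      expR b + expR (- b) - 2 <= l ^+ 2 * (lam ^+ 2 * expR lam).
    move=> b0 bl; apply: le_trans (expR_sym_le b0) _.
    rewrite mulrA -exprMn mulrC (mulrC _ (expR lam)); apply: ler_pM.
    - exact: expR_ge0.
    - exact: sqr_ge0.
    - rewrite ler_expR (le_trans bl)// ler_piMr//; by case/andP: l01.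
    - by rewrite mulrC lerXn2r// nnegrE (le_trans b0).
  have : expR (psi y - psi z) + expR (psi z - psi y) - 2 <= l ^+ 2 * (lam ^+ 2 * expR lam).
    have := lip y z yz; rewrite -/l.
    have e1 : psi z - psi y = - (psi y - psi z) by ring.
    case: (ger0P (psi y - psi z)) => s0 sl; first by rewrite e1; exact: b_le.
    rewrite e1; move: s0 sl; set s := psi y - psi z => s0 sl.
    have s1 : 0 <= - s by lra.
    by have := b_le (- s) s1 sl; rewrite opprK (addrC (expR (- s))).
  move=> /(ler_wpM2l (ltW w0)) /le_trans; apply.
  rewrite mulrCA mulrA -[leRHS]mul1r ler_wpM2r//.
have degy : \sum_(z \in neighbours adj (val y)) (1 : R) <= Cdeg.
  by rewrite -card_set_sum//; exact: finite_neighbours graph _.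
apply: (@le_trans _ _ (\sum_(z \in neighbours adj (val y)) F z)).
  apply: box_sum_le => z; rewrite /F; first by move=> ->; rewrite mul1r.
  by move=> /negPf ->; rewrite mul0r.
have fn := finite_neighbours graph (val y).
rewrite !fsbig_finite// in degy *.
have -> : \sum_(z <- fset_set (neighbours adj (val y))) F z =
  (\sum_(z <- fset_set (neighbours adj (val y))) 1) * (lam ^+ 2 * expR lam).
  rewrite mulr_suml big_seq [RHS]big_seq; apply: eq_bigr => z.
  by rewrite in_fset_set// inE /neighbours/= /F => ->.
apply: le_trans (ler_wpM2r c0 degy) _.
by rewrite le_eqVlt; apply/orP; left; apply/eqP; field.
Qed.

Variables (d d' CS1 : R) (N2 : V -> R) (x : V) (n : nat).
Hypothesis d'2 : 2 <= d'.
Hypothesis sob : isoperimetric_sobolev adj d d' CS1 N2.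
Hypothesis N2n : N2 x <= n%:R.
Hypothesis CS1_ge0 : 0 <= CS1.
Hypothesis ball_sub : forall y, gball adj x (n%:R : R) y -> y \in Lam.
Hypothesis nbr_sub : forall y z, gball adj x (n%:R : R) y -> adj y z -> z \in Lam.

Lemma box_sum_ball (F : V -> R) :
  \sum_(y : Lam | `[< gball adj x (n%:R : R) (val y) >]) F (val y) =
  \sum_(y \in gball adj x (n%:R : R)) F y.
Proof.
rewrite (fsum_reindex (f := val : Lam -> V)) //; last first.
  by move=> z /ball_sub zL; exists [` zL]%fset.
Qed.

(** Extension by zero. Every edge meeting the ball has both ends in the box, so no term of
    [edge_variation] is lost. *)
Lemma box_sobolev (g : Lam -> R) :
  (forall y, ~~ `[< gball adj x (n%:R : R) (val y) >] -> g y = 0) ->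
  (\sum_y `|g y| `^ ((d' - 1) / d')^-1) `^ ((d' - 1) / d')
  <= CS1 * n%:R `^ (1 - d / d') * gradient_sum box_weight g.
Proof.
move=> gB.
pose u (z : V) : R := if insub z is Some a then g a else 0.
have uE (a : Lam) : u (val a) = g a by rewrite /u valK.
have usupp z : u z != 0 -> gball adj x (n%:R : R) z.
  rewrite /u; case: insubP => [a _ <-|]; last by rewrite eqxx.
  by move=> ga; apply: contrapT => nb; move: ga; rewrite gB ?eqxx//; apply/asboolP.
have := sob N2n usupp.
have -> : \sum_(y \in gball adj x (n%:R : R)) `|u y| `^ (d' / (d' - 1)) =
    \sum_y `|g y| `^ ((d' - 1) / d')^-1.
  rewrite -box_sum_ball [LHS]big_mkcond/=; apply: eq_bigr => a _.
  rewrite uE invf_div; case: ifPn => // nb.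
  rewrite gB// normr0 powR0// gt_eqF// divr_gt0//; have := d'2; lra.
move=> /le_trans; apply; rewrite ler_wpM2l//; first by rewrite mulr_ge0 ?powR_ge0.
rewrite /edge_variation /gradient_sum ler_pM2l// (pair_big xpredT xpredT)/=.
pose f (e : Lam * Lam) := (val e.1, val e.2).
rewrite (fsum_reindex (f := f)); last 2 first.
- by move=> [a b] [a' b'] [] /val_inj -> /val_inj ->.
- move=> [y z]/= [yz yb].
  have [yL zL] : y \in Lam /\ z \in Lam.
    case: yb => [yB|zB]; split; [exact: ball_sub|exact: nbr_sub yB yz| |exact: ball_sub].
    by apply: nbr_sub zB _; rewrite (graph_sym graph).
  by exists ([` yL], [` zL])%fset.
rewrite big_mkcond/=; apply: ler_sum => -[a b] _ /=; rewrite !uE box_weight_neq0.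
case: asboolP => [[-> _]|_]; first by rewrite mul1r.
exact: mulr_ge0.
Qed.

End Box.

(** * Mean value inequality in a box, with explicit powers of the radius *)

Section BoxMeanValue.
Variables (R : realType) (d d' a b CS1 Creg cmu cnu : R).
Let D := (d' - 1) / d'.
Let eps := 2 - a - b - 2 * D.

Definition fk_const : R := Num.max 1
  (2 * ((2 - a - b) / (1 - a)) ^+ 2 * CS1 ^+ 2 * (Creg `^ a * cmu)
   * (Creg `^ b * cnu)).

Definition moment_const : R := Num.max 1 (Creg `^ a * cmu).

Definition box_mean_const : R :=
  2 * (absorb_const eps a * (fk_const `^ eps^-1 * moment_const) `^ (1 - a)^-1
       + (4 * 4 `^ eps / eps * fk_const) `^ eps^-1).

Hypothesis d2 : 2 <= d.
Hypothesis dd' : d <= d'.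
Hypothesis ab_bounds : [/\ 0 < a, 0 < b, a < 1 & b < 1].
Hypothesis abd : a + b < 2 / d'.
Hypothesis CS1_gt0 : 0 < CS1.
Hypothesis Creg_gt0 : 0 < Creg.
Hypothesis cmu_ge1 : 1 <= cmu.
Hypothesis cnu_ge0 : 0 <= cnu.

Let d'0 : d' != 0. Proof. by rewrite gt_eqF//; move: d2 dd'; lra. Qed.

Lemma epsE : eps = 2 / d' - a - b.
Proof. by rewrite /eps /D; field. Qed.

Lemma eps_gt0 : 0 < eps.
Proof. by rewrite epsE; move: abd; lra. Qed.

(** A consequence of [d <= d']; it makes the power [2 - d * eps] of [n] at least 1, so that
    [1 <= K]. *)
Lemma eps_d_le2 : d * eps <= 2.
Proof.
have [a0 b0 _ _] := ab_bounds.
have d'p : 0 < d' by move: d2 dd'; lra.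
have d0 : 0 <= d by move: d2; lra.
apply: (@le_trans _ _ (d * (2 / d'))).
  by rewrite ler_wpM2l// epsE; lra.
rewrite mulrA ler_pdivrMr// mulrC ler_pM2l//.
Qed.

Lemma eps_le2 : eps <= 2.
Proof.
have := eps_d_le2; have e0 := eps_gt0; move: d2 => d2'.
have : 2 * eps <= d * eps by rewrite ler_pM2r.
lra.
Qed.

Lemma absorb_const_ge0 : 0 <= absorb_const eps a.
Proof. by rewrite /absorb_const le_max powR_ge0. Qed.

Lemma box_mean_const_ge0 : 0 <= box_mean_const.
Proof.
apply: mulr_ge0; first exact: ler0n.
apply: addr_ge0; last exact: powR_ge0.
exact: mulr_ge0 absorb_const_ge0 (powR_ge0 _ _).
Qed.

Variables (V : choiceType) (adj : rel V) (omega : V -> V -> R) (Lam : {fset V}).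
Variables (N2 : V -> R) (x : V) (n : nat).
Hypothesis graph : infinite_graph adj.
Hypothesis weights : edge_weights adj omega.
Hypothesis sob : isoperimetric_sobolev adj d d' CS1 N2.
Hypothesis N2n : N2 x <= n%:R.
Hypothesis n_gt0 : (0 < n)%N.
Hypothesis ball_sub : forall y, gball adj x (n%:R : R) y -> y \in Lam.
Hypothesis nbr_sub : forall y z, gball adj x (n%:R : R) y -> adj y z -> z \in Lam.
Let Bn := gball adj x (n%:R : R).
Hypothesis vol : (card_set Bn)%:R <= Creg * n%:R `^ d.
Hypothesis mu_mom : \sum_(z \in Bn) mu adj omega z `^ a^-1 <=
  (card_set Bn)%:R * cmu `^ a^-1.
Hypothesis nu_mom : \sum_(z \in Bn) nu adj omega z `^ b^-1 <=
  (card_set Bn)%:R * cnu `^ b^-1.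

Let om := box_weight omega (Lam := Lam).
Let dist (y z : Lam) := graph_dist R adj (val y) (val z).
Let inB (y : Lam) := `[< Bn (val y) >].

Lemma moment_le (c e : R) (m : Lam -> R) (M : V -> R) : 0 < e -> 0 <= c ->
  (forall y, 0 <= m y <= M (val y)) ->
  \sum_(z \in Bn) M z `^ e^-1 <= (card_set Bn)%:R * c `^ e^-1 ->
  (\sum_(y | inB y) m y `^ e^-1) `^ e <= Creg `^ e * n%:R `^ (d * e) * c.
Proof.
move=> e0 c0 mM hM.
have n0 : 0 <= n%:R :> R by rewrite ler0n.
apply: (@le_trans _ _ ((Creg * n%:R `^ d * c `^ e^-1) `^ e)); last first.
  rewrite powRM ?mulr_ge0 ?powR_ge0 ?(ltW Creg_gt0)//.
  rewrite (powRM _ (ltW Creg_gt0) (powR_ge0 _ _)) -powRrM -powRrM.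
  by rewrite mulVf ?gt_eqF// powRr1.
have lhs0 : 0 <= \sum_(y | inB y) m y `^ e^-1 by apply: sumr_ge0 => *; exact: powR_ge0.
have le1 : \sum_(y | inB y) m y `^ e^-1 <= Creg * n%:R `^ d * c `^ e^-1.
  apply: le_trans (ler_wpM2r (powR_ge0 _ _) vol).
  apply: le_trans hM; rewrite -(box_sum_ball ball_sub) -/Bn.
  apply: ler_sum => y _; have /andP[m0 mle] := mM y.
  by rewrite ge0_ler_powR ?nnegrE ?invr_ge0 ?(ltW e0)// (le_trans m0).
by rewrite ge0_ler_powR ?(ltW e0) ?nnegrE// (le_trans lhs0).
Qed.

Let K := fk_const * n%:R `^ (2 - d * eps).
Let cm := moment_const * n%:R `^ (d * a).

(** The majorant [M] is kept general because the inequality is needed both for the mass and for the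
    constant 1. The exponent of [n] is [2 (1 - d / d') + d a + d b = 2 - d eps]. *)
Lemma box_faber_krahn (m : Lam -> R) (M : V -> R) (w : Lam -> R) :
  (forall y, 0 <= m y <= M (val y)) ->
  \sum_(z \in Bn) M z `^ a^-1 <= (card_set Bn)%:R * cmu `^ a^-1 ->
  (forall y, 0 <= w y) -> (forall y, ~~ inB y -> w y = 0) ->
  \sum_y m y * w y ^+ 2 <= K * (\sum_y (w y != 0)%:R) `^ eps * energy om w.
Proof.
move=> mM hM w0 wB; have [a0 b0 a1 b1] := ab_bounds.
have n0 : 0 <= n%:R :> R by rewrite ler0n.
have np : 0 < n%:R :> R by rewrite ltr0n.
have cmu0 : 0 <= cmu by exact: le_trans ler01 cmu_ge1.
have d'2 : 2 <= d' by move: d2 dd'; lra.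
have D0 : 0 < D by rewrite /D divr_gt0//; lra.
have mn := moment_le a0 cmu0 mM hM.
have nn : (\sum_(y | inB y) (\sum_z (om y z)^-1) `^ b^-1) `^ b
    <= Creg `^ b * n%:R `^ (d * b) * cnu.
  apply: (moment_le b0 cnu_ge0 _ nu_mom) => y.
  rewrite box_nu_le// andbT; apply: sumr_ge0 => z _.
  by rewrite invr_ge0; exact: (box_weight_ge0 weights).
have cc : [/\ 0 <= CS1 * n%:R `^ (1 - d / d'),
     0 <= Creg `^ a * n%:R `^ (d * a) * cmu & 0 <= Creg `^ b * n%:R `^ (d * b) * cnu].
  by split; rewrite !mulr_ge0 ?powR_ge0 ?(ltW CS1_gt0).
have sobg (g : Lam -> R) : (forall y, ~~ inB y -> g y = 0) ->
    (\sum_y `|g y| `^ D^-1) `^ D <= CS1 * n%:R `^ (1 - d / d') * gradient_sum om g.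
  exact: (box_sobolev graph weights d'2 sob N2n (ltW CS1_gt0) ball_sub nbr_sub).
have m0 y : 0 <= m y by case/andP: (mM y).
have := faber_krahn (box_weight_sym weights (Lam := Lam)) (box_weight_ge0 weights (Lam := Lam))
  ab_bounds D0 eps_gt0 cc m0 sobg mn nn w0 wB.
move=> /le_trans; apply; rewrite -/eps -/om.
rewrite ler_wpM2r ?ler_wpM2r ?powR_ge0//.
  by apply: energy_ge0; exact: (box_weight_ge0 weights).
apply: (@le_trans _ _ ((2 * ((2 - a - b) / (1 - a)) ^+ 2 * CS1 ^+ 2 * (Creg `^ a * cmu)
   * (Creg `^ b * cnu)) * n%:R `^ (2 - d * eps))); last first.
  by rewrite ler_wpM2r ?powR_ge0// /fk_const le_max lexx orbT.
have -> : n%:R `^ (2 - d * eps) =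
    (n%:R `^ (1 - d / d')) ^+ 2 * n%:R `^ (d * a) * n%:R `^ (d * b).
  rewrite -powR_mulrn ?powR_ge0// -powRrM -!powRD ?(gt_eqF np) ?implybT//.
  by congr (_ `^ _); rewrite epsE; field.
by rewrite le_eqVlt; apply/orP; left; apply/eqP; ring.
Qed.

(** Count of the powers, with [y = n / r0]: [K / r0 ^+ 2] is a constant times [n^(- d eps) y^2],
    whose power [1 / eps] is [n^(- d) y^(2 / eps)]. The moment adds [n^(d a)], and the power
    [1 / (1 - a)] gives [n^(- d)] times the power [2 / (eps (1 - a))] of [y]. The centre [x0] need
    not be [x]: only its ball has to lie in that of [x]. *)
Lemma box_mean_value_at (x0 : Lam) (r0 h : R) (N : nat) :
  0 < h -> h <= 1 -> 1 <= r0 -> h * N%:R = r0 ^+ 2 ->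
  graph_dist R adj x (val x0) + r0 <= n%:R ->
  mean_value_at om (box_killing adj omega (Lam := Lam)) h N dist r0
    (box_mean_const * n%:R `^ (- d) * (n%:R / r0) `^ (2 / (eps * (1 - a)))) x0.
Proof.
move=> h0 h1 r01 hN x0n f L f0 fL; have [a0 b0 a1 b1] := ab_bounds.
have eps0 := eps_gt0.
have eb : 0 < eps <= 2 by rewrite eps0 eps_le2.
have np : 0 < n%:R :> R by rewrite ltr0n.
have n1 : 1 <= n%:R :> R by rewrite ler1n.
have r0p : 0 < r0 by exact: lt_le_trans r01.
have sub y : dist x0 y <= r0 -> inB y.
  move=> xy; apply/asboolP; apply: le_trans x0n.
  by apply: le_trans (graph_dist_triangle R graph _ (val x0) _) _; rewrite lerD2l.
have pn1 e : 0 <= e -> 1 <= n%:R `^ e :> R.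
  by move=> e0; rewrite -[leLHS](powRr0 n%:R) ler_powR.
have K1 : 1 <= K.
  rewrite /K mulr_ege1 ?pn1//; first by rewrite /fk_const le_max lexx.
  by have := eps_d_le2; lra.
have cm1 : 1 <= cm.
  rewrite /cm mulr_ege1 ?pn1//; first by rewrite /moment_const le_max lexx.
  by rewrite mulr_ge0 ?(ltW a0)//; move: d2; lra.
have ab : 0 < a < 1 by rewrite a0 a1.
have mmass y : 0 <= \sum_z om y z <= mu adj omega (val y).
  by rewrite (box_mass_le graph weights) andbT; apply: sumr_ge0 => z _;
    exact: (box_weight_ge0 weights).
have m1 (y : Lam) : 0 <= (1 : R) <= 1 by rewrite ler01 lexx.
have one_mom : \sum_(z \in Bn) (1 : R) `^ a^-1 <= (card_set Bn)%:R * cmu `^ a^-1.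
  rewrite powR1 card_set_sum; last exact: finite_gball.
  rewrite ler_peMr//; first by rewrite -card_set_sum//; exact: finite_gball.
  apply: (@le_trans _ _ (1 `^ a^-1)); first by rewrite powR1.
  by rewrite ge0_ler_powR ?nnegrE ?invr_ge0 ?(ltW a0) ?(le_trans ler01).
have fkm w : (forall y, 0 <= w y) -> (forall y, ~~ (dist x0 y <= r0) -> w y = 0) ->
    \sum_y (\sum_z om y z) * w y ^+ 2
    <= K * (\sum_y (w y != 0)%:R) `^ eps * energy om w.
  move=> w0 wB; apply: (box_faber_krahn mmass mu_mom w0) => y yB.
  by apply: wB; apply: contra yB; exact: sub.
have fk1 w : (forall y, 0 <= w y) -> (forall y, ~~ (dist x0 y <= r0) -> w y = 0) ->
    \sum_y w y ^+ 2 <= K * (\sum_y (w y != 0)%:R) `^ eps * energy om w.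
  move=> w0 wB; have wB' y : ~~ inB y -> w y = 0.
    by move=> yB; apply: wB; apply: contra yB; exact: sub.
  apply: le_trans (box_faber_krahn (m := fun=> 1) (M := fun=> 1) m1 one_mom w0 wB').
  by apply: ler_sum => y _; rewrite mul1r.
have cmu0 : 0 <= cmu by exact: le_trans ler01 cmu_ge1.
have mnorm : (\sum_(y | dist x0 y <= r0) (\sum_z om y z) `^ a^-1) `^ a <= cm.
  apply: (@le_trans _ _ ((\sum_(y | inB y) (\sum_z om y z) `^ a^-1) `^ a)).
    rewrite ge0_ler_powR ?(ltW a0)// ?nnegrE; try by apply: sumr_ge0 => *; exact: powR_ge0.
    rewrite big_mkcond [leRHS]big_mkcond; apply: ler_sum => y _ /=.
    by case: ifP => [/sub ->//|_]; case: ifP => // _; exact: powR_ge0.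
  apply: le_trans (moment_le a0 cmu0 mmass mu_mom) _.
  rewrite mulrAC /cm ler_wpM2r ?powR_ge0// /moment_const le_max lexx orbT//.
have dtri (y z w : Lam) : dist y w <= dist y z + dist z w by exact: graph_dist_triangle.
have dadj y z : om y z != 0 -> dist y z <= 1.
  by rewrite (box_weight_neq0 weights) => yz; exact: graph_dist_adj.
have hK : h <= 4 `^ eps * K.
  apply: le_trans h1 _; rewrite mulr_ege1//.
  rewrite -[leLHS](powRr0 4); apply: ler_powR; first by rewrite ler1n.
  exact: ltW.
have := mean_value (box_weight_sym weights (Lam := Lam))
  (box_weight_ge0 weights (Lam := Lam)) (box_killing_ge0 graph weights (Lam := Lam))
  h0 (fun y => graph_dist_refl R graph (val y)) dtri dadj r01 hN K1 cm1 ab eb mnorm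
  fkm fk1 f0 hK fL.
move=> /le_trans; apply.
have L0 : 0 <= L.
  by apply: le_trans (fL 0%N isT); apply: sumr_ge0 => y _; rewrite sqr_ge0.
rewrite ler_wpM2r//.
pose y := n%:R / r0; pose w := n%:R `^ (- d).
have y1 : 1 <= y.
  rewrite ler_pdivlMr// mul1r; apply: le_trans x0n; rewrite lerDr.
  exact: graph_dist_ge0.
have y0 : 0 <= y by exact: le_trans y1.
have w0 : 0 <= w by exact: powR_ge0.
have F0 : 0 <= fk_const by rewrite /fk_const le_max ler01.
have M0 : 0 <= moment_const by rewrite /moment_const le_max ler01.
have N0 : n%:R != 0 :> R by rewrite gt_eqF.
have KrE : K / r0 ^+ 2 = fk_const * (w `^ eps * y ^+ 2).
  rewrite /K /w /y -powRrM (_ : 2 - d * eps = 2%:R + - d * eps); last by ring.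
  rewrite powRD ?N0 ?implybT// powR_mulrn ?ler0n//.
  by field; rewrite gt_eqF.
have epsN0 : eps != 0 by rewrite gt_eqF.
have wy0 : 0 <= w `^ eps * y ^+ 2 by rewrite mulr_ge0 ?powR_ge0 ?sqr_ge0.
have pw c : 0 <= c -> (c * (w `^ eps * y ^+ 2)) `^ eps^-1 =
    c `^ eps^-1 * (w * y `^ (2 / eps)).
  move=> c0; rewrite powRM// powRM ?powR_ge0 ?sqr_ge0//.
  rewrite -powRrM mulfV// powRr1//.
  by rewrite -(powR_mulrn 2 y0) -powRrM.
have a1N0 : 1 - a != 0 by rewrite gt_eqF// subr_gt0.
have wwa : n%:R `^ (d * a) * w = w `^ (1 - a).
  rewrite /w -powRrM -powRD ?N0 ?implybT//; congr (_ `^ _); ring.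
rewrite /mean_value_const /box_mean_const.
have -> : 4 * (4 `^ eps * K) / (eps * r0 ^+ 2) = 4 * 4 `^ eps / eps * (K / r0 ^+ 2).
  by field; rewrite epsN0 gt_eqF.
rewrite KrE pw// [X in _ + X `^ eps^-1](mulrA (4 * 4 `^ eps / eps)).
have cc0 : 0 <= 4 * 4 `^ eps / eps * fk_const.
  apply: mulr_ge0 F0; apply: divr_ge0 (ltW eps0).
  by apply: mulr_ge0; [exact: ler0n|exact: powR_ge0].
rewrite pw//.
have -> : fk_const `^ eps^-1 * (w * y `^ (2 / eps)) * cm =
    (fk_const `^ eps^-1 * moment_const) * (w `^ (1 - a) * y `^ (2 / eps)).
  by rewrite -wwa /cm; ring.
have ia0 : 0 <= (1 - a)^-1 by rewrite invr_ge0 subr_ge0 ltW.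
rewrite powRM ?mulr_ge0 ?powR_ge0//.
rewrite (powRM (1 - a)^-1 (powR_ge0 w _) (powR_ge0 y _)).
rewrite -(powRrM w) mulfV// powRr1// -(powRrM y).
have -> : 2 / eps * (1 - a)^-1 = 2 / (eps * (1 - a)) by rewrite invfM mulrA.
set g := 2 / (eps * (1 - a)).
have yg : y `^ (2 / eps) <= y `^ g.
  apply: ler_powR => //; rewrite /g invfM mulrA ler_peMr//.
    by rewrite divr_ge0// ltW.
  by rewrite invf_ge1 ?subr_gt0// gerBl ltW.
set AC := absorb_const _ _; set F := (_ * moment_const) `^ _.
set c := (4 * _ / eps * fk_const) `^ _.
rewrite -/y -/w.
rewrite [leRHS](_ : _ = 2 * (AC * (F * (w * y `^ g)) + c * (w * y `^ g))); last by ring.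
rewrite ler_pM2l ?ltr0n// lerD2l ler_wpM2l ?powR_ge0//.
exact: ler_wpM2l.
Qed.

End BoxMeanValue.

(** * Law of the walk *)

Section RealProbability.
Variables (R : realType) (dO : measure_display) (Omega : measurableType dO).
Variable (Pr : probability Omega R).
Implicit Types A B : set Omega.

Definition pr A : R := fine (Pr A).

Lemma prE A : measurable A -> Pr A = (pr A)%:E.
Proof.
move=> mA; rewrite /pr fineK// ge0_fin_numE ?measure_ge0//.
exact: le_lt_trans (probability_le1 Pr mA) (ltry _).
Qed.

Lemma pr_mono A B : measurable A -> measurable B -> A `<=` B -> pr A <= pr B.
Proof.
by move=> mA mB AB; rewrite -lee_fin -!prE// le_measure ?inE.
Qed.

Lemma pr_add A B : measurable A -> measurable B -> A `&` B = set0 ->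
  pr (A `|` B) = pr A + pr B.
Proof.
move=> mA mB AB; apply: EFin_inj; rewrite EFinD -!prE//; last exact: measurableU.
by rewrite measureU.
Qed.

Lemma pr_sub A B : measurable A -> measurable B -> B `<=` A ->
  pr (A `\` B) = pr A - pr B.
Proof.
move=> mA mB BA; have := @pr_add (A `\` B) B (measurableD mA mB) mB.
rewrite setDE -setIA setICl setI0 => /(_ erefl).
rewrite -setDE setUC setDUK// => ->; ring.
Qed.

Lemma pr_le_add A B : measurable A -> measurable B -> pr (A `|` B) <= pr A + pr B.
Proof.
move=> mA mB; rewrite -lee_fin EFinD -!prE//; first exact: measureU2.
exact: measurableU.
Qed.

Lemma measurable_seq_union (X : eqType) (s : seq X) (F : X -> set Omega) :
  (forall z, measurable (F z)) -> measurable [set w | exists2 z, z \in s & F z w].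
Proof.
move=> mF; elim: s => [|z s IH].
  rewrite (_ : [set w | _] = set0)//.
  by apply/seteqP; split => w //= -[z]; rewrite in_nil.
rewrite (_ : [set w | _] = F z `|` [set w | exists2 z, z \in s & F z w]).
  exact: measurableU.
apply/seteqP; split => w /=.
  move=> [z']; rewrite inE => /predU1P[->|zs] Fw; [by left|by right; exists z'].
by move=> [Fw|[z' zs Fw]]; [exists z; rewrite ?mem_head|exists z'; rewrite ?inE ?zs ?orbT].
Qed.

Lemma pr_seq_union_le (X : eqType) (s : seq X) (F : X -> set Omega) :
  (forall z, measurable (F z)) ->
  pr [set w | exists2 z, z \in s & F z w] <= \sum_(z <- s) pr (F z).
Proof.
move=> mF; elim: s => [|z s IH].
  rewrite big_nil (_ : [set w | _] = set0) ?/pr ?measure0//.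
  by apply/seteqP; split => w //= -[z]; rewrite in_nil.
rewrite big_cons; apply: le_trans (lerD (lexx _) IH).
have m2 := measurable_seq_union s mF.
apply: le_trans (pr_le_add (mF z) m2).
apply: pr_mono; [exact: measurable_seq_union|exact: measurableU|].
move=> w /= [z']; rewrite inE => /predU1P[->|zs] Fw; [by left|by right; exists z'].
Qed.

Lemma pr_seq_union (X : eqType) (s : seq X) (F : X -> set Omega) : uniq s ->
  (forall z, measurable (F z)) ->
  (forall z z' w, F z w -> F z' w -> z = z') ->
  pr [set w | exists2 z, z \in s & F z w] = \sum_(z <- s) pr (F z).
Proof.
move=> us mF dF; elim: s us => [_|z s IH /= /andP[zs us]].
  rewrite big_nil (_ : [set w | _] = set0) ?/pr ?measure0//.
  by apply/seteqP; split => w //= -[z]; rewrite in_nil.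
rewrite big_cons -IH// -pr_add//; last 2 first.
- exact: measurable_seq_union.
- apply/seteqP; split => w //= -[Fz [z' z's Fz']].
  by move: zs; rewrite (dF _ _ _ Fz Fz') z's.
congr pr; apply/seteqP; split => w /=.
  move=> [z']; rewrite inE => /predU1P[->|z's] Fw; [by left|by right; exists z'].
by move=> [Fw|[z' z's Fw]]; [exists z; rewrite ?mem_head|exists z'; rewrite ?inE ?z's ?orbT].
Qed.

(** Disjoint parts of [D] whose probabilities add up to that of [D] miss only a null set. The next
    position of the walk can thus be restricted to the neighbours. *)
Lemma pr_exhaust (X : eqType) (s : seq X) (F : X -> set Omega) (D E : set Omega) :
  uniq s -> measurable D -> measurable E -> (forall z, measurable (F z)) ->
  (forall z z' w, F z w -> F z' w -> z = z') -> (forall z, F z `<=` D) ->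
  pr D = \sum_(z <- s) pr (F z) ->
  pr (D `&` E) <= \sum_(z <- s) pr (F z `&` E).
Proof.
move=> us mD mE mF dF FD DF.
pose U := [set w | exists2 z, z \in s & F z w].
have mU : measurable U by exact: measurable_seq_union.
have UD : U `<=` D by move=> w [z _ /FD].
have null : pr (D `\` U) = 0 by rewrite pr_sub// DF -pr_seq_union// subrr.
have mFE z : measurable (F z `&` E) by exact: measurableI.
have := pr_seq_union_le s mFE; apply: le_trans.
have mUE := measurable_seq_union s mFE.
have mDU : measurable (D `\` U) by exact: measurableD.
rewrite -[leRHS]addr0 -null; apply: le_trans (pr_le_add mUE mDU).
apply: pr_mono; [exact: measurableI|exact: measurableU|].
move=> w [Dw Ew]; have [[z zs Fz]|nU] := pselect (U w); last by right.
by left; exists z.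
Qed.

Lemma measurable_forall_lt (F : nat -> set Omega) n :
  (forall i, measurable (F i)) -> measurable [set w | forall i, (i < n)%N -> F i w].
Proof.
move=> mF; elim: n => [|n IH].
  rewrite (_ : [set w | _] = setT)//.
  by apply/seteqP; split.
rewrite (_ : [set w | _] = [set w | forall i, (i < n)%N -> F i w] `&` F n).
  exact: measurableI.
apply/seteqP; split => w /=.
  by move=> h; split => [i ilt|]; apply: h => //; exact: ltnW.
move=> [h hn] i; rewrite ltnS leq_eqVlt => /predU1P[->//|]; exact: h.
Qed.

Lemma measurable_le (f : Omega -> R) (c : R) : measurable_fun setT f ->
  measurable [set w | f w <= c].
Proof.
move=> mf; have := mf measurableT `]-oo, c]%classic (measurable_itv _).
rewrite setTI; congr (measurable _); apply/seteqP; split => w /=; rewrite in_itv//=.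
Qed.

Lemma measurable_gt (f : Omega -> R) (c : R) : measurable_fun setT f ->
  measurable [set w | c < f w].
Proof.
move=> mf; have := mf measurableT `]c, +oo[%classic (measurable_itv _).
rewrite setTI; congr (measurable _); apply/seteqP; split => w /=; rewrite in_itv/= andbT//.
Qed.

End RealProbability.

Section WalkLaw.
Variables (R : realType) (V : choiceType) (adj : rel V) (omega : V -> V -> R).
Variables (dO : measure_display) (Omega : measurableType dO).
Variables (Pr : V -> probability Omega R) (Y : nat -> Omega -> V) (T : nat -> Omega -> R).
Hypothesis walk : variable_speed_walk adj omega Pr Y T.
Variable x : V.
Let pm := mu adj omega.

(** The first [m] holding times are bounded on both sides, the others only from below; for [m = 0]
    this is the event of [walk_law]. *)
Definition cylinder (n m : nat) (z : nat -> V) (s s' : nat -> R) : set Omega :=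
  [set w | forall i, (i < n.+1)%N ->
     [/\ Y i w = z i, s i < T i w & (i < m)%N -> T i w <= s' i]].

Lemma measurable_cylinder n m z s s' : measurable (cylinder n m z s s').
Proof.
rewrite /cylinder; apply: (measurable_forall_lt (F := fun i => [set w |
  [/\ Y i w = z i, s i < T i w & (i < m)%N -> T i w <= s' i]])) => i.
rewrite (_ : [set w | _] = [set w | Y i w = z i] `&` [set w | s i < T i w]
   `&` [set w | (i < m)%N -> T i w <= s' i]); last first.
  by apply/seteqP; split => w /= [] // []; split.
apply: measurableI; first apply: measurableI.
- exact: walk_pos_measurable walk _ _.
- apply: measurable_gt; exact: walk_time_measurable walk _.
- have [im|im] := ltnP i m.
    rewrite (_ : [set w | _] = [set w | T i w <= s' i]).
      apply: measurable_le; exact: walk_time_measurable walk _.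
    by apply/seteqP; split => w /=; [apply|move=> + _].
  by rewrite (_ : [set w | _] = setT)//; apply/seteqP; split => w.
Qed.

Definition jump_weight (z : nat -> V) (i : nat) : R := omega (z i) (z i.+1) / pm (z i).

Definition time_weight (m : nat) (z : nat -> V) (s s' : nat -> R) (i : nat) : R :=
  expR (- (pm (z i) * s i)) - (if (i < m)%N then expR (- (pm (z i) * s' i)) else 0).

(** Induction on [m]: imposing [T m <= s' m] removes the same event with its lower bound at [m]
    raised to [s' m]. *)
Lemma pr_cylinder n m z s s' : (m <= n.+1)%N -> (forall i, 0 <= s i) ->
  (forall i, (i < m)%N -> s i <= s' i) ->
  pr (Pr x) (cylinder n m z s s') =
  (z 0%N == x)%:R * \prod_(i < n) jump_weight z i
  * \prod_(i < n.+1) time_weight m z s s' i.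
Proof.
elim: m s => [|m IH] s mn s0 ss.
  have -> : cylinder n 0 z s s' = [set w | forall i, (i <= n)%N -> Y i w = z i /\ s i < T i w].
    by apply/seteqP; split => w /= h i /h []// *; split.
  rewrite /pr (walk_law walk x n z s0)/=; congr (_ * _); apply: eq_bigr => i _.
  by rewrite /time_weight ltn0 subr0.
pose s2 i := if i == m then s' m else s i.
have s20 i : 0 <= s2 i.
  by rewrite /s2; case: ifP => // _; apply: le_trans (s0 m) (ss m _).
have ss2 i : (i < m)%N -> s2 i <= s' i.
  by move=> im; rewrite /s2 ltn_eqF//; apply: ss; exact: ltnW.
have ssm i : (i < m)%N -> s i <= s' i by move=> im; apply: ss; exact: ltnW.
have -> : cylinder n m.+1 z s s' = cylinder n m z s s' `\` cylinder n m z s2 s'.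
  apply/seteqP; split => w /=.
    move=> h; split => [i /h[Yi Ti Ti']|h2].
      by split => // im; apply: Ti'; exact: ltnW.
    have [_ _ /(_ (ltnSn m)) Tm] := h m mn.
    by have [_ + _] := h2 m mn; rewrite /s2 eqxx ltNge Tm.
  move=> [h nh] i ilt; have [Yi Ti Ti'] := h i ilt; split => //.
  rewrite ltnS leq_eqVlt => /predU1P[im|/Ti'//].
  rewrite leNgt; apply/negP => Tgt; apply: nh => j jlt; have [Yj Tj Tj'] := h j jlt.
  split => //; rewrite /s2; case: eqP => // jm.
  by rewrite jm -im.
rewrite pr_sub; last 3 first.
- exact: measurable_cylinder.
- exact: measurable_cylinder.
- move=> w h i ilt; have [Yi Ti Ti'] := h i ilt; split => //.
  apply: le_lt_trans Ti; rewrite /s2; case: eqP => // ->; exact: ss.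
rewrite !IH//; try exact: ltnW.
rewrite -mulrBr; congr (_ * _).
pose im := Ordinal mn.
rewrite (bigD1 im)//= [X in _ - X](bigD1 im)//= [RHS](bigD1 im)//=.
have e1 : \prod_(i < n.+1 | i != im) time_weight m z s2 s' i =
   \prod_(i < n.+1 | i != im) time_weight m z s s' i.
  apply: eq_bigr => i iN; rewrite /time_weight /s2 ifF//.
  by apply/negP => /eqP e; case/eqP: iN; apply: val_inj.
have e2 : \prod_(i < n.+1 | i != im) time_weight m.+1 z s s' i =
   \prod_(i < n.+1 | i != im) time_weight m z s s' i.
  apply: eq_bigr => i iN; rewrite /time_weight ltnS leq_eqVlt.
  by rewrite (_ : (val i == m) = false)//; apply/negP => /eqP e; case/eqP: iN; apply: val_inj.
rewrite e1 e2 -mulrBl; congr (_ * _).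
by rewrite /time_weight /s2 ltnn ltnSn eqxx !subr0.
Qed.

End WalkLaw.

(** * Comparison of the walk with the resolvent *)

Section PathExpansion.
Variables (R : realType) (V : choiceType) (adj : rel V) (omega : V -> V -> R).
Hypothesis graph : infinite_graph adj.
Hypothesis weights : edge_weights adj omega.
Variables (h : R) (y : V).
Hypothesis h_gt0 : 0 < h.
Let pm := mu adj omega.

Definition nbrs (z : V) : seq V := fset_set (neighbours adj z).

Lemma mem_nbrs z z' : (z' \in nbrs z) = adj z z'.
Proof.
rewrite /nbrs in_fset_set; last exact: finite_neighbours graph z.
by apply/idP/idP; rewrite inE.
Qed.

Lemma mu_nbrs z : pm z = \sum_(z' <- nbrs z) omega z z'.
Proof. by rewrite /pm /mu fsbig_finite//; exact: finite_neighbours graph z. Qed.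

Definition stay (z : V) : R := (1 + h * pm z)^-1.

(* The contribution of the paths with [r] jumps from [z] to [y] to the [m]-th power
   of the resolvent [(1 - h L)^-1], restricted to at most one jump per factor. *)
Fixpoint path_weight (r m : nat) (z : V) : R :=
  if r is r'.+1 then
    \sum_(a < m) stay z ^+ a.+1
      * (h * \sum_(z' <- nbrs z) omega z z' * path_weight r' (m - a) z')
  else (z == y)%:R * stay z ^+ m.

Lemma stay_bounds z : 0 < stay z <= 1.
Proof.
have p0 := mu_gt0 graph weights z.
have hp : 0 < h * pm z by rewrite mulr_gt0.
by rewrite /stay invr_gt0 invf_le1 ?addr_gt0//= lerDl ltW.
Qed.

Lemma path_weight_ge0 r m z : 0 <= path_weight r m z.
Proof.
elim: r m z => [|r IH] m z /=.
  by rewrite mulr_ge0 ?exprn_ge0//; case/andP: (stay_bounds z) => /ltW.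
apply: sumr_ge0 => a _; rewrite mulr_ge0 ?exprn_ge0//.
  by case/andP: (stay_bounds z) => /ltW.
rewrite mulr_ge0 ?(ltW h_gt0)//; apply: sumr_ge0 => z' _.
by rewrite mulr_ge0// (omega_ge0 weights).
Qed.

Section ResolventBound.
Variable Lam : {fset V}.
Let om := box_weight omega (Lam := Lam).
Let kap := box_killing adj omega (Lam := Lam).
Let G := resolvent om kap h.

Definition inside (n : nat) (z : V) : Prop :=
  forall s, path adj z s -> (size s <= n)%N -> last z s \in Lam.

(** Induction on the number of jumps. Since paths with at most [M] edges do not leave the box, every
    neighbour met is a vertex of [Lam], and only nonnegative terms are dropped. *)
Lemma path_weight_le (yL : Lam) M m (z : Lam) : val yL = y -> inside M (val z) ->
  \sum_(r < M.+1) path_weight r m (val z) <= iter m G (delta R yL) z.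
Proof.
move=> yE.
pose v i := iter i G (delta R yL).
have v0 i w : 0 <= v i w.
  apply: (iter_resolvent_ge0 (box_weight_ge0 weights (Lam := Lam))
    (box_killing_ge0 graph weights (Lam := Lam)) h_gt0) => u.
  by rewrite /delta ler0n.
pose S i w := h * \sum_(b : Lam) om w b * v i b.
have vrec i w : v i.+1 w = stay (val w) * (v i w + S i.+1 w).
  have := resolventP (box_weight_ge0 weights (Lam := Lam))
    (box_killing_ge0 graph weights (Lam := Lam)) h_gt0 (v i) w.
  rewrite -/om -/kap -/G -[G (v i)]/(v i.+1) => <-.
  have /andP[st0 _] := stay_bounds (val w).
  have lapE : lap om kap (v i.+1) w = \sum_b om w b * v i.+1 b - pm (val w) * v i.+1 w.
    rewrite /lap /kap /box_killing -/om -/pm.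
    have -> : \sum_z om w z * (v i.+1 z - v i.+1 w) =
      \sum_z om w z * v i.+1 z - (\sum_z om w z) * v i.+1 w.
      by rewrite mulr_suml -sumrN -big_split/=; apply: eq_bigr => b _; ring.
    ring.
  rewrite lapE /S; have p0 := mu_gt0 graph weights (val w).
  rewrite /stay -/pm; field.
  by rewrite gt_eqF// addr_gt0// mulr_gt0.
have S0 i w : 0 <= S i w.
  rewrite mulr_ge0 ?(ltW h_gt0)//; apply: sumr_ge0 => b _.
  by rewrite mulr_ge0//; exact: (box_weight_ge0 weights).
(* [vrec] unrolled at the fixed vertex [w]. The factor in which [w] is left remains available at the
   next vertex, hence [a.+1] powers of [stay] but [i - a] remaining steps. *)
have vexp i w : v i w = stay (val w) ^+ i * v 0%N w
    + \sum_(a < i) stay (val w) ^+ a.+1 * S (i - a)%N w.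
  elim: i => [|i IH]; first by rewrite big_ord0 addr0 mul1r.
  rewrite vrec IH big_ord_recl/= subn0 expr1 mulrDr mulrDr -addrA.
  rewrite mulrA -exprS; congr (_ + _); rewrite addrC; congr (_ + _).
  rewrite mulr_sumr; apply: eq_bigr => a _.
  by rewrite /bump/= add1n subSS mulrA -exprS.
have st0 w : 0 <= stay w by case/andP: (stay_bounds w) => /ltW.
elim: M m z => [|M IH] m z ins.
  rewrite big_ord_recl big_ord0 addr0/= -/(v m) vexp /v/= /delta.
  have -> : (val z == y) = (z == yL) by rewrite -yE.
  rewrite mulrC lerDl; apply: sumr_ge0 => a _.
  by rewrite mulr_ge0 ?exprn_ge0.
rewrite big_ord_recl/= -/(v m) vexp.
apply: lerD.
  by rewrite /v/= /delta -yE mulrC.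
rewrite exchange_big/=; apply: ler_sum => a _.
rewrite -mulr_sumr ler_wpM2l ?exprn_ge0// /S -mulr_sumr ler_wpM2l ?(ltW h_gt0)//.
rewrite exchange_big/=.
pose F z' := omega (val z) z' * \sum_(r < M.+1) path_weight r (m - a) z'.
rewrite (eq_bigr F); last by move=> z' _; rewrite /F mulr_sumr.
have -> : \sum_(z' <- nbrs (val z)) F z' = \sum_(b : Lam | adj (val z) (val b)) F (val b).
  rewrite -(big_map (fun b : Lam => val b) (fun z' => adj (val z) z') F).
  rewrite -big_filter; apply: perm_big; apply: uniq_perm.
  - exact: fset_uniq.
  - by rewrite filter_uniq// map_inj_uniq ?index_enum_uniq//; exact: val_inj.
  - move=> z'; rewrite mem_nbrs mem_filter; case zz': (adj (val z) z') => //=.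
    have zL : z' \in Lam by have := ins [:: z']; apply => //=; rewrite zz'.
    apply/esym/mapP; exists [` zL]%fset => //; exact: mem_index_enum.
rewrite big_mkcond/=; apply: ler_sum => b _.
case: ifPn => zb; last by rewrite mulr_ge0//; exact: (box_weight_ge0 weights).
rewrite /F; apply: ler_wpM2l; first exact: (omega_ge0 weights).
apply: IH => s ps ss.
have := ins (val b :: s); rewrite /= zb/=; exact.
Qed.

End ResolventBound.

(** * Binned holding times and the probability of a given number of jumps *)

Section PathProbability.
Variables (dO : measure_display) (Omega : measurableType dO).
Variables (Pr : V -> probability Omega R) (Y : nat -> Omega -> V) (T : nat -> Omega -> R).
Hypothesis walk : variable_speed_walk adj omega Pr Y T.
Variables (x : V) (k N : nat) (t mbar : R).
Hypothesis ht : t = h * N%:R.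
Hypothesis mbar_le : forall s, path adj x s -> (size s <= k)%N -> pm (last x s) <= mbar.

Definition at_after (j : nat) : set Omega :=
  [set w | jump_time T j w <= t < jump_time T j.+1 w /\ Y j w = y].

Lemma measurable_jump_time j : measurable_fun setT (jump_time T j).
Proof.
rewrite /jump_time; apply: measurable_sum => i; exact: walk_time_measurable walk _.
Qed.

Lemma measurable_at_after j : measurable (at_after j).
Proof.
rewrite (_ : at_after j = [set w | jump_time T j w <= t] `&`
  [set w | t < jump_time T j.+1 w] `&` [set w | Y j w = y]).
  apply: measurableI; first apply: measurableI.
  - exact: measurable_le (measurable_jump_time j).
  - exact: measurable_gt (measurable_jump_time j.+1).
  - exact: walk_pos_measurable walk _ _.
apply/seteqP; split => w /=; first by move=> [/andP[]].
by move=> [[J1 J2] Yj]; split => //; apply/andP.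
Qed.

Let lo (a : nat -> nat) (j : nat) (c : R) (i : nat) : R :=
  if (i < j)%N then h * (a i)%:R else c.
Let hi (a : nat -> nat) (i : nat) : R := h * (a i).+1%:R.

Let prefix_weight (z : nat -> V) (a : nat -> nat) (j : nat) : R :=
  \prod_(i < j) (jump_weight adj omega z i
    * (expR (- (pm (z i) * (h * (a i)%:R))) - expR (- (pm (z i) * (h * (a i).+1%:R))))).

Let lohi a i : h * (a i)%:R <= hi a i.
Proof. by rewrite /hi ler_pM2l// ler_nat. Qed.

Let lo_ge0 a j c i : 0 <= c -> 0 <= lo a j c i.
Proof. by rewrite /lo; case: ifP => // _ _; rewrite mulr_ge0 ?(ltW h_gt0). Qed.

Lemma pr_prefix z a j c : z 0%N = x -> 0 <= c ->
  pr (Pr x) (cylinder Y T j j z (lo a j c) (hi a)) =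
  prefix_weight z a j * expR (- (pm (z j) * c)).
Proof.
move=> zx c0; rewrite (pr_cylinder walk); last 3 first.
- exact: leqnSn.
- by move=> i; exact: lo_ge0.
- by move=> i ij; rewrite /lo ij.
rewrite zx eqxx mul1r big_ord_recr/= mulrA -big_split/=; congr (_ * _).
  apply: eq_bigr => i _; congr (_ * _).
  by rewrite /time_weight /lo /hi ltn_ord.
by rewrite /time_weight /lo ltnn subr0.
Qed.

Lemma pr_prefix_bin z a j : z 0%N = x ->
  pr (Pr x) (cylinder Y T j j.+1 z (lo a j.+1 0) (hi a)) =
  prefix_weight z a j * (expR (- (pm (z j) * (h * (a j)%:R)))
     - expR (- (pm (z j) * (h * (a j).+1%:R)))).
Proof.
move=> zx; rewrite (pr_cylinder walk) //; last 2 first.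
- by move=> i; exact: lo_ge0.
- by move=> i ij; rewrite /lo ij.
rewrite zx eqxx mul1r big_ord_recr/= mulrA -big_split/=; congr (_ * _).
  apply: eq_bigr => i _; congr (_ * _).
  have ij : (i < j.+1)%N by rewrite ltnS ltnW.
  by rewrite /time_weight /lo /hi ij.
by rewrite /time_weight /lo /hi ltnSn.
Qed.

Lemma ex_bin (s : R) : 0 < s -> exists a : nat, h * a%:R < s <= h * a.+1%:R.
Proof.
move=> s0; have ex : exists n : nat, s <= h * n.+1%:R.
  exists (Num.truncn (s / h)); rewrite mulrC -ler_pdivrMr//.
  exact: ltW (truncnS_gt _).
have [a sa amin] := ex_minnP ex; exists a; rewrite sa andbT.
case: a sa amin => [|a] sa amin; first by rewrite mulr0.
rewrite ltNge; apply/negP => le; have := amin _ le; by rewrite ltnn.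
Qed.

Lemma reach_mu_le (z : nat -> V) j i : z 0%N = x ->
  (forall i, (i < j)%N -> adj (z i) (z i.+1)) -> (j <= k)%N -> (i <= j)%N ->
  pm (z i) <= mbar.
Proof.
move=> zx zadj jk ij.
have [s [ps ls] ss] : exists2 s, path adj x s /\ last x s = z i & size s = i.
  elim: i ij => [_|i IHi ij]; first by exists [::].
  have [s [ps ls] ss] := IHi (ltnW ij); exists (rcons s (z i.+1)).
    by rewrite rcons_path last_rcons ps ls zadj.
  by rewrite size_rcons ss.
by rewrite -ls; apply: mbar_le => //; rewrite ss (leq_trans ij).
Qed.

Let prefix_weight_ge0 z a j : 0 <= prefix_weight z a j.
Proof.
apply: prodr_ge0 => i _; have p0 := mu_gt0 graph weights (z i).
apply: mulr_ge0; first by rewrite /jump_weight divr_ge0 ?(omega_ge0 weights)// ltW.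
by rewrite subr_ge0 ler_expR lerN2 ler_pM2l// lohi.
Qed.

(** Induction on the number [r] of jumps to come. Each of them costs one factor [1 + h * mbar] when
    the probability of a bin is compared with powers of [stay]; the other [k] factors pay for
    rounding [k] holding times to bins. *)
Lemma pr_path_le r j (z : nat -> V) (a : nat -> nat) : (j + r = k)%N -> z 0%N = x ->
  (forall i, (i < j)%N -> adj (z i) (z i.+1)) ->
  (\sum_(i < j) a i <= N)%N ->
  pr (Pr x) (cylinder Y T j j z (lo a j 0) (hi a) `&` at_after k)
  <= prefix_weight z a j * (1 + h * mbar) ^+ (k + r)
     * path_weight r (N - \sum_(i < j) a i) (z j).
Proof.
have p0 z' : 0 < pm z' by exact: (mu_gt0 graph weights z').
have hp z' : 0 < h * pm z' by rewrite mulr_gt0.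
have mE := measurable_at_after k.
elim: r j z a => [|r IH] j z a jr zx zadj aN.
all: have jk : (j <= k)%N by rewrite -jr leq_addr.
all: have mb i : (i <= j)%N -> 1 + h * pm (z i) <= 1 + h * mbar
       by move=> ij; rewrite lerD2l ler_pM2l// (reach_mu_le zx zadj jk ij).
all: have W0 := prefix_weight_ge0 z a j.
all: have mb0 : 0 <= 1 + h * mbar
       by apply: le_trans (mb j (leqnn j)); rewrite addr_ge0// ltW.
- (* no jump left: the last holding time exceeds the remaining time *)
  rewrite addn0 in jr; subst j.
  (* The upper ends of the [k] bins may overstate the elapsed time by [h] each, hence [- k]. If the
     subtraction is truncated, [n] is 0 and [0 < T k] suffices. *)
  pose n := (N - \sum_(i < k) a i - k)%N.
  pose c := h * n%:R.
  have c0 : 0 <= c by rewrite mulr_ge0 ?(ltW h_gt0).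
  have sub : cylinder Y T k k z (lo a k 0) (hi a) `&` at_after k `<=`
      cylinder Y T k k z (lo a k c) (hi a).
    move=> w [cyl [/andP[_ J2] _]] i ilt; have [Yi Ti Ti'] := cyl i ilt.
    split => //; rewrite /lo; case: ltnP => ik.
      by move: Ti; rewrite /lo ik.
    have {}ik : i = k by apply/eqP; rewrite eqn_leq ik andbT -ltnS.
    subst i; move: Ti; rewrite /lo ltnn => Tk.
    rewrite /c /n; case: (leqP (N - \sum_(i < k) a i) k) => [le|gt].
      by rewrite (eqP le) mulr0.
    rewrite natrB ?(ltnW gt)// natrB// natr_sum.
    have : t < \sum_(i < k) h * (a i).+1%:R + T k w.
      apply: lt_le_trans J2 _; rewrite /jump_time big_ord_recr/= lerD2r.
      apply: ler_sum => i _; have [_ _] := cyl i (ltnW (ltn_ord i)).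
      by rewrite ltn_ord => /(_ isT).
    rewrite ht -mulr_sumr.
    have -> : \sum_(i < k) (a i).+1%:R = \sum_(i < k) (a i)%:R + k%:R :> R.
      under eq_bigr do rewrite -natr1.
      by rewrite big_split/= sumr_const card_ord.
    rewrite !mulrBr mulrDr; lra.
  have [zy|zy] := eqVneq (z k) y; last first.
    rewrite (_ : _ `&` _ = set0) ?/pr ?measure0//.
      apply: mulr_ge0 (path_weight_ge0 _ _ _).
      by apply: mulr_ge0 => //; rewrite exprn_ge0.
    apply/seteqP; split => w //= [cyl [_ Yk]].
    by have [Yk' _ _] := cyl k (ltnSn k); move: zy; rewrite -Yk' Yk eqxx.
  apply: (@le_trans _ _ (pr (Pr x) (cylinder Y T k k z (lo a k c) (hi a)))).
    apply: pr_mono => //; last exact: measurable_cylinder walk _ _ _ _ _.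
    by apply: measurableI => //; exact: measurable_cylinder walk _ _ _ _ _.
  rewrite pr_prefix// -mulrA ler_wpM2l//= zy eqxx mul1r addn0 -zy.
  have := exp1Dx_le n (ltW (hp (z k))); rewrite -/(stay (z k)).
  rewrite (_ : h * pm (z k) * n%:R = pm (z k) * c); last by rewrite /c; ring.
  move=> /le_trans; apply.
  have /andP[st0 st1] := stay_bounds (z k).
  have sE : 1 = (1 + h * pm (z k)) ^+ k * stay (z k) ^+ k.
    by rewrite -exprMn /stay divff ?expr1n// gt_eqF// addr_gt0.
  rewrite -[leLHS]mul1r {1}sE -mulrA -exprD.
  apply: ler_pM.
  + by rewrite exprn_ge0// addr_ge0// ltW.
  + by rewrite exprn_ge0// ltW.
  + by apply: lerXn2r; rewrite ?nnegrE ?mb// addr_ge0// ltW.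
  + apply: ler_wiXn2l; rewrite ?(ltW st0)//.
    by rewrite /n -leq_subLR.
- (* the holding time [T j] is binned, then the next position is summed over *)
  set m := (N - \sum_(i < j) a i)%N.
  pose upd (f : nat -> nat) al i := if i == j then al else f i.
  pose updz ze i := if i == j.+1 then ze else z i.
  have mcyl n' m' z' s s' := measurable_cylinder walk n' m' z' s s'.
  have sub : cylinder Y T j j z (lo a j 0) (hi a) `&` at_after k `<=`
    [set w | exists2 al, al \in iota 0 m &
       (cylinder Y T j j.+1 z (lo (upd a al) j.+1 0) (hi (upd a al)) `&` at_after k) w].
    move=> w [cyl E]; have [Yj Tj _] := cyl j (ltnSn j).
    move: Tj; rewrite /lo ltnn => Tj.
    have [al /andP[al1 al2]] := ex_bin Tj; exists al.
      (* As [j < k], the time [T j] has elapsed before [t = h * N], which bounds the number of its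
         bin. *)
      rewrite mem_iota add0n/= /m ltn_subRL -(ltr_nat R) -(ltr_pM2l h_gt0) -ht.
      case: E => /andP[J1 _] _; apply: lt_le_trans J1.
      rewrite natrD natr_sum mulrDr mulr_sumr.
      have jk' : (j < k)%N by rewrite -jr -[X in (X < _)%N]addn0 ltn_add2l.
      rewrite /jump_time -(subnKC jk') big_split_ord/= big_ord_recr/= -addrA.
      apply: ler_ltD.
        apply: ler_sum => i _; have [_ + _] := cyl i (ltnW (ltn_ord i)).
        by rewrite /lo ltn_ord => /ltW.
      rewrite -[ltLHS]addr0; apply: ltr_leD => //.
      by apply: sumr_ge0 => i _; exact: walk_time_ge0 walk _ _.
    split => // i ilt; have [Yi Ti Ti'] := cyl i ilt; split => //.
      rewrite /lo ilt /upd; case: eqP => [->//|/eqP ij].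
      have ij' : (i < j)%N by rewrite ltn_neqAle ij -ltnS.
      by move: Ti; rewrite /lo ij'.
    move=> _; rewrite /hi /upd; case: eqP => [->//|/eqP ij].
    by apply: Ti'; rewrite ltn_neqAle ij -ltnS.
  have mB al : measurable (cylinder Y T j j.+1 z (lo (upd a al) j.+1 0) (hi (upd a al))
      `&` at_after k) by exact: measurableI.
  have mU := measurable_seq_union (iota 0 m) mB.
  apply: le_trans (pr_mono (Pr x) (measurableI _ _ (mcyl _ _ _ _ _) mE) mU sub) _.
  apply: le_trans (pr_seq_union_le _ _ mB) _.
  have -> : iota 0 m = index_iota 0 m by rewrite /index_iota subn0.
  rewrite big_mkord/= -/m mulr_sumr; apply: ler_sum => al _.
  have updlt i : (i < j)%N -> upd a al i = a i.
    by move=> ij; rewrite /upd ltn_eqF.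
  have updzle ze i : (i <= j)%N -> updz ze i = z i.
    by move=> ij; rewrite /updz ltn_eqF// ltnS.
  have updj : upd a al j = al by rewrite /upd eqxx.
  have updzj ze : updz ze j.+1 = ze by rewrite /updz eqxx.
  pose bin := expR (- (pm (z j) * (h * al%:R))) - expR (- (pm (z j) * (h * al.+1%:R))).
  have bin0 : 0 <= bin by rewrite subr_ge0 ler_expR lerN2 !ler_pM2l// ler_nat.
  have pwE ze : prefix_weight (updz ze) (upd a al) j.+1 =
      prefix_weight z a j * bin * (omega (z j) ze / pm (z j)).
    rewrite /prefix_weight big_ord_recr/= /jump_weight updj updzj updzle//.
    rewrite -/pm -/bin mulrA mulrAC; congr (_ * _ * _).
    apply: eq_bigr => i _; rewrite updlt// !updzle//; exact: ltnW.
  have pwE' : prefix_weight z (upd a al) j = prefix_weight z a j.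
    by apply: eq_bigr => i _; rewrite updlt.
  pose F ze := cylinder Y T j.+1 j.+1 (updz ze) (lo (upd a al) j.+1 0) (hi (upd a al)).
  apply: (@le_trans _ _ (\sum_(ze <- nbrs (z j)) pr (Pr x) (F ze `&` at_after k))).
    have mF ze : measurable (F ze) by exact: mcyl.
    (* The jump probabilities from [z j] to its neighbours sum to 1, so any other next position has
       probability 0. *)
    apply: pr_exhaust => //.
    - exact: fset_uniq.
    - move=> ze ze' w /(_ j.+1 (ltnSn _)) [+ _ _] /(_ j.+1 (ltnSn _)) [+ _ _].
      by rewrite !updzj => -> ->.
    - move=> ze w Fw i ilt; have [Yi Ti Ti'] := Fw i (ltnW ilt).
      by split => //; rewrite Yi updzle// -ltnS.
    - rewrite pr_prefix_bin// pwE' updj -/bin.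
      rewrite (eq_bigr (fun ze => prefix_weight z a j * bin / pm (z j) * omega (z j) ze)).
        by rewrite -mulr_sumr -mu_nbrs mulfVK// gt_eqF.
      move=> ze _; rewrite pr_prefix ?lexx//.
        by rewrite mulr0 oppr0 expR0 mulr1 pwE; ring.
  have alm : (al < m)%N by exact: ltn_ord.
  have sumE : (\sum_(i < j.+1) upd a al i = \sum_(i < j) a i + al)%N.
    by rewrite big_ord_recr/= updj; congr (_ + _)%N; apply: eq_bigr => i _; rewrite updlt.
  have mE' : (N - \sum_(i < j.+1) upd a al i = m - al)%N by rewrite sumE subnDA.
  have stepE ze : ze \in nbrs (z j) -> pr (Pr x) (F ze `&` at_after k) <=
      prefix_weight z a j * bin * (omega (z j) ze / pm (z j))
      * (1 + h * mbar) ^+ (k + r) * path_weight r (m - al) ze.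
    rewrite mem_nbrs => zze; have := IH j.+1 (updz ze) (upd a al).
    rewrite mE' pwE updzj; apply.
    - by rewrite addSnnS.
    - by rewrite updzle.
    - move=> i; rewrite ltnS leq_eqVlt => /predU1P[->|ij].
        by rewrite updzj updzle.
      by rewrite !updzle//; [exact: zadj|exact: ltnW].
    - by rewrite sumE; move: alm; rewrite /m ltn_subRL => /ltnW.
  rewrite big_seq; apply: le_trans (ler_sum _ stepE) _; rewrite -big_seq.
  rewrite (eq_bigr (fun ze => prefix_weight z a j * (1 + h * mbar) ^+ (k + r) *
     (bin / pm (z j)) * (omega (z j) ze * path_weight r (m - al) ze))); last first.
    by move=> ze _; ring.
  rewrite -mulr_sumr; set S := \sum_(_ <- _) _.
  have S0 : 0 <= S.
    by apply: sumr_ge0 => ze _; rewrite mulr_ge0 ?path_weight_ge0 ?(omega_ge0 weights).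
  (* [1 - expR (- s) <= s] produces the factor [h * pm (z j)], and [exp1Dx_le] the power [al] of
     [stay]; the additional factor [stay] is bought with [1 + h * mbar]. *)
  have binle : bin / pm (z j) <= (1 + h * mbar) * (stay (z j) ^+ al.+1 * h).
    have e1 : bin <= expR (- (h * pm (z j) * al%:R)) * (h * pm (z j)).
      rewrite /bin (_ : - (pm (z j) * (h * al.+1%:R)) =
        - (h * pm (z j) * al%:R) + - (h * pm (z j))); last first.
        by rewrite -[al.+1%:R]natr1; ring.
      rewrite expRD (_ : pm (z j) * (h * al%:R) = h * pm (z j) * al%:R); last by ring.
      have := expR_ge1Dx (- (h * pm (z j))).
      have := expR_ge0 (- (h * pm (z j) * al%:R)) => q0 q1.
      have := ler_wpM2l q0 q1; lra.
    have e2 := exp1Dx_le al (ltW (hp (z j))); rewrite -/(stay (z j)) in e2.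
    have /andP[st0 st1] := stay_bounds (z j).
    rewrite ler_pdivrMr//; apply: le_trans e1 _.
    have -> : (1 + h * mbar) * (stay (z j) ^+ al.+1 * h) * pm (z j) =
       ((1 + h * mbar) * stay (z j)) * stay (z j) ^+ al * (h * pm (z j)).
      by rewrite exprS; ring.
    rewrite ler_wpM2r ?(ltW (hp (z j)))//; apply: le_trans e2 _.
    rewrite ler_peMl ?exprn_ge0 ?(ltW st0)//.
    by rewrite /stay ler_pdivlMr ?addr_gt0// mul1r mb.
  have q0 : 0 <= prefix_weight z a j * (1 + h * mbar) ^+ (k + r).
    by rewrite mulr_ge0// exprn_ge0.
  apply: le_trans (ler_wpM2r S0 (ler_wpM2l q0 binle)) _.
  rewrite le_eqVlt; apply/orP; left; apply/eqP.
  by rewrite addnS [X in _ = _ * X * _]exprS; ring.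
Qed.

Lemma pr_at_after_le :
  pr (Pr x) (at_after k) <= (1 + h * mbar) ^+ (k + k) * path_weight k N x.
Proof.
(* That the walk starts at [x] with a positive holding time is only almost sure. *)
pose D := cylinder Y T 0 0 (fun=> x) (lo (fun=> 0%N) 0 0) (hi (fun=> 0%N)).
have mD : measurable D by exact: measurable_cylinder walk _ _ _ _ _.
have mE := measurable_at_after k.
have D1 : pr (Pr x) D = 1.
  by rewrite pr_prefix// /prefix_weight big_ord0 mul1r mulr0 oppr0 expR0.
have := @pr_path_le k 0 (fun=> x) (fun=> 0%N) erefl erefl.
rewrite big_ord0 subn0 /prefix_weight big_ord0 mul1r => claim.
apply: le_trans (claim _ _) => //.
have T1 : pr (Pr x) setT = 1 by rewrite /pr probability_setT.
have nD : pr (Pr x) (setT `\` D) = 0 by rewrite pr_sub ?T1 ?D1 ?subrr.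
have mDc : measurable (setT `\` D) by exact: measurableD.
have mDE : measurable (D `&` at_after k) by exact: measurableI.
apply: (@le_trans _ _ (pr (Pr x) (D `&` at_after k) + pr (Pr x) (setT `\` D)));
  last by rewrite nD addr0.
apply: le_trans (pr_le_add (Pr x) mDE mDc).
apply: pr_mono => //; first exact: measurableU.
by move=> w Ew; have [Dw|Dw] := pselect (D w); [left|right].
Qed.

End PathProbability.
End PathExpansion.

(** * Heat kernel *)

Section HeatKernel.
Variables (R : realType) (V : choiceType) (adj : rel V) (omega : V -> V -> R).
Hypothesis graph : infinite_graph adj.
Hypothesis weights : edge_weights adj omega.
Variables (dO : measure_display) (Omega : measurableType dO).
Variables (Pr : V -> probability Omega R) (Y : nat -> Omega -> V) (T : nat -> Omega -> R).
Hypothesis walk : variable_speed_walk adj omega Pr Y T.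
Variables (x y : V) (t : R).
Hypothesis t_gt0 : 0 < t.

Let E := at_after y Y T t.

Lemma jump_time_mono w i j : (i <= j)%N -> jump_time T i w <= jump_time T j w.
Proof.
move=> /subnKC <-; rewrite /jump_time big_split_ord/= lerDl.
by apply: sumr_ge0 => n _; exact: walk_time_ge0 walk _ _.
Qed.

Lemma at_time_unique w i j : jump_time T i w <= t < jump_time T i.+1 w ->
  jump_time T j w <= t < jump_time T j.+1 w -> i = j.
Proof.
wlog ij : i j / (i <= j)%N.
  move=> h hi hj; have [ij|/ltnW ji] := leqP i j; first exact: h.
  by apply/esym; exact: h.
move=> /andP[_ i2] /andP[j1 _]; apply/eqP; rewrite eqn_leq ij/=.
rewrite leqNgt; apply/negP => lt; have := jump_time_mono w lt.
by move=> /(lt_le_trans i2) /lt_le_trans /(_ j1); rewrite ltxx.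
Qed.

Lemma walk_at_eq : [set w | walk_at Y T t w = Some y] = \bigcup_k E k.
Proof.
apply/seteqP; split => w /=; rewrite /walk_at.
  case: xgetP; last by [].
  move=> o oE [k [tk ok]] Sy; rewrite ok in Sy; case: Sy => Yk.
  by exists k.
move=> [k _ [tk Yk]].
have inS : [set o | exists n, jump_time T n w <= t < jump_time T n.+1 w /\
     o = Some (Y n w)] (Some y) by exists k; rewrite Yk.
apply: xget_subset1 => // o o' [n [tn ->]] [n' [tn' ->]].
by rewrite (at_time_unique tn tn').
Qed.

Lemma heat_kernel_le_series (c : R) :
  (forall M, \sum_(k < M) pr (Pr x) (E k) <= c) ->
  heat_kernel Pr Y T t x y <= c.
Proof.
move=> hM; have mE k : measurable (E k) by exact: (measurable_at_after y walk t k).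
have tE : trivIset setT E.
  apply/trivIsetP => i j _ _ ij; apply/seteqP; split => w //= -[[ti _] [tj _]].
  by move: ij; rewrite (at_time_unique ti tj) eqxx.
have mU : measurable (\bigcup_k E k) by exact: bigcupT_measurable.
have cv := @measure_semi_sigma_additive _ _ _ (Pr x) E mE tE mU.
rewrite /heat_kernel walk_at_eq -lee_fin -(prE (Pr x) mU).
rewrite -(cvg_lim _ cv)//; apply: lime_le; first by apply/cvg_ex; eexists; exact: cv.
apply: nearW => M; rewrite big_mkord.
rewrite (eq_bigr (fun k : 'I_M => (pr (Pr x) (E k))%:E)); last first.
  by move=> k _; rewrite -prE.
by rewrite sumEFin lee_fin; exact: hM.
Qed.

Lemma expR_half_le2 : expR (2^-1) <= 2 :> R.
Proof.
have := expR_ge1Dx (- 2^-1 : R); rewrite expRN => h.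
have e0 := expR_gt0 (2^-1 : R).
have : 2^-1 <= (expR 2^-1)^-1 :> R by apply: le_trans h; lra.
by rewrite lef_pV2 ?posrE.
Qed.

(** The order of the quantifiers matters: the box is fixed once the number of jumps is bounded by
    [M], then [n] is increased until the rounding factor is at most 2. Since [c] depends neither on
    [M] nor on the box, the bound passes to the whole series. *)
Lemma heat_kernel_le (c : R) :
  (forall M : nat, exists (Lam : {fset V}) (xL yL : Lam),
    [/\ val xL = x, val yL = y, inside adj Lam M x &
     forall n0 : nat, exists n, [/\ (n0 <= n)%N, (0 < n)%N &
       iter n (resolvent (box_weight omega (Lam := Lam))
         (box_killing adj omega (Lam := Lam)) (t / n%:R)) (delta R yL) xL <= c]]) ->
  heat_kernel Pr Y T t x y <= 2 * c.
Proof.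
move=> hyp; apply: heat_kernel_le_series => M.
have [Lam [xL [yL [xE yE ins hn]]]] := hyp M.
pose mbar := \sum_(z <- Lam) mu adj omega z.
have mpos z : 0 <= mu adj omega z by apply: ltW; exact: (mu_gt0 graph weights z).
have mbar0 : 0 <= mbar by exact: sumr_ge0.
have mle z : z \in Lam -> mu adj omega z <= mbar.
  move=> zL; rewrite /mbar (big_fsetD1 z)//= lerDl; exact: sumr_ge0.
(* [C <= n] gives [h * mbar * (2 M) <= 1/2], and [expR (1/2) <= 2]. *)
pose C := 4 * M%:R * t * mbar.
have C0 : 0 <= C by rewrite !mulr_ge0// ltW.
have [n [n0 np itn]] := hn (Num.truncn C).+1.
have nR : 0 < n%:R :> R by rewrite ltr0n.
set h := t / n%:R in itn.
have h0 : 0 < h by rewrite divr_gt0.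
have tE : t = h * n%:R by rewrite /h divfK// gt_eqF.
have hm0 : 0 <= h * mbar by rewrite mulr_ge0// ltW.
have pow2 k : (k <= M)%N -> (1 + h * mbar) ^+ (k + k) <= 2.
  move=> kM; apply: le_trans expR_half_le2.
  apply: (@le_trans _ _ (expR (h * mbar) ^+ (k + k))).
    by rewrite lerXn2r// ?nnegrE ?expR_ge0 ?addr_ge0// expR_ge1Dx.
  rewrite -expRM_natr ler_expR.
  apply: (@le_trans _ _ (h * mbar * (2 * M%:R))).
    by rewrite ler_wpM2l// -natrM ler_nat mul2n addnn leq_double.
  have Cn : C <= n%:R.
    apply: le_trans (ltW (truncnS_gt C)) _; rewrite ler_nat//.
  rewrite /h (_ : t / n%:R * mbar * (2 * M%:R) = C / 2 / n%:R); last first.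
    by rewrite /C; field; rewrite gt_eqF.
  by rewrite ler_pdivrMr//; lra.
have mb k : (k <= M)%N -> forall s, path adj x s -> (size s <= k)%N ->
    mu adj omega (last x s) <= mbar.
  by move=> kM s ps ss; apply: mle; apply: ins => //; exact: leq_trans kM.
apply: (@le_trans _ _ (\sum_(k < M) 2 * path_weight adj omega h y k n x)).
  apply: ler_sum => k _.
  have kM : (k <= M)%N by exact: ltnW.
  apply: le_trans (pr_at_after_le graph weights y h0 walk tE (mb k kM)) _.
  by rewrite ler_wpM2r ?pow2//; exact: path_weight_ge0.
rewrite -mulr_sumr ler_pM2l//; apply: le_trans itn.
have ins' : inside adj Lam M (val xL) by rewrite xE.
have := path_weight_le graph weights h0 n yE ins'; rewrite xE.
apply: le_trans; rewrite big_ord_recr/= lerDl; exact: path_weight_ge0.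
Qed.

Variable (Cdeg : R).
Hypothesis Cdeg_ge1 : 1 <= Cdeg.
Hypothesis deg : bounded_degree adj Cdeg.

(** The mean value inequality is assumed in every box containing a fixed ball, with the same [Q],
    because the box grows with the number of jumps. The time [t / 2] belongs to each half of the
    kernel. *)
Lemma heat_kernel_davies (Q rr lam : R) (n : nat) : 0 <= Q -> 0 <= rr -> 0 <= lam ->
  (forall (Lam : {fset V}) (xL yL : Lam) (h : R) (N : nat),
     val xL = x -> val yL = y ->
     (forall z, gball adj x (n.+1%:R : R) z -> z \in Lam) ->
     0 < h -> h <= 1 -> h * N%:R = t / 2 ->
     let mv := mean_value_at (box_weight omega (Lam := Lam))
       (box_killing adj omega (Lam := Lam)) h N
       (fun u w : Lam => graph_dist R adj (val u) (val w)) rr Q in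
     mv xL /\ mv yL) ->
  heat_kernel Pr Y T t x y <= 2 * (Q * expR (- (lam * chemical_dist adj omega x y)
     + 2 * (lam * rr) + Cdeg * lam ^+ 2 * expR lam * t)).
Proof.
move=> Q0 rr0 lam0 mvh; apply: heat_kernel_le => M.
have Dxy0 : 0 <= graph_dist R adj x y by exact: graph_dist_ge0.
(* Room for the ball of the hypothesis, for the paths of at most [M] edges from [x], and for [y]. *)
pose k := (n.+1 + M + (Num.truncn (graph_dist R adj x y)).+1)%N.
pose Lam := fset_set (gball adj x (k%:R : R)).
have inL z : gball adj x (k%:R : R) z -> z \in Lam.
  by move=> zB; rewrite /Lam in_fset_set ?inE//; exact: finite_gball.
have subk (i : nat) : (i <= k)%N -> forall z, gball adj x (i%:R : R) z -> z \in Lam.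
  by move=> ik z zi; apply: inL; rewrite /gball/=; apply: le_trans zi _; rewrite ler_nat.
have xin : x \in Lam by apply: inL; rewrite /gball/= graph_dist_refl.
have yin : y \in Lam.
  apply: (subk (Num.truncn (graph_dist R adj x y)).+1); first by rewrite /k leq_addl.
  by rewrite /gball/= ltW// truncnS_gt.
exists Lam, [` xin]%fset, [` yin]%fset; split => //.
  move=> s ps ss; apply: (subk M); first by rewrite /k addnAC leq_addl.
  rewrite /gball/=; apply: le_trans (graph_dist_le R graph (_ : paths adj x (last x s) s)) _.
    by split.
  by rewrite ler_nat.
set xL := [` xin]%fset; set yL := [` yin]%fset.
pose H := Cdeg * lam ^+ 2 * expR lam / 2.
have H0 : 0 <= H.
  by rewrite divr_ge0// mulr_ge0 ?expR_ge0// mulr_ge0 ?sqr_ge0// (le_trans ler01).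
move=> n0.
(* Large enough for [n0], for [h <= 1] and for the smallness of [h * H] in Davies' estimate. *)
pose N := (n0 + (Num.truncn (t + 4 * t * H)).+1)%N.
have Np : (0 < N)%N by rewrite /N addnS.
have NR : 0 < N%:R :> R by rewrite ltr0n.
exists (N + N)%N; split.
- by rewrite (leq_trans _ (leq_addr _ _))// /N leq_addr.
- by rewrite addn_gt0 Np.
set h := t / (N + N)%:R.
have h0 : 0 < h by rewrite divr_gt0// ltr0n addn_gt0 Np.
have hN : h * N%:R = t / 2.
  by rewrite /h natrD; field; rewrite gt_eqF// -mulr2n mulrn_wgt0.
have tH0 : 0 <= 4 * t * H by rewrite mulr_ge0// mulr_ge0// ltW.
have Nbig : t + 4 * t * H <= N%:R.
  apply: le_trans (ltW (truncnS_gt _)) _; rewrite ler_nat /N leq_addl//.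
have h1 : h <= 1.
  rewrite -(ler_pM2r NR) hN mul1r; move: t_gt0 => t0; lra.
have hH : 2 * (h * H) <= 2^-1.
  rewrite -(ler_pM2r NR) (_ : 2 * (h * H) * N%:R = 2 * (h * N%:R) * H); last by ring.
  by rewrite hN; move: t_gt0 => t0; lra.
have := mvh Lam xL yL h N erefl erefl (subk n.+1 _) h0 h1 hN.
rewrite /k -addnA leq_addr => /(_ isT) [mvx mvy].
pose psi (z : Lam) := - (lam * chemical_dist adj omega x (val z)).
have lipE (z w : Lam) : `|psi z - psi w| =
   lam * `|chemical_dist adj omega x (val z) - chemical_dist adj omega x (val w)|.
  rewrite /psi; set A := chemical_dist _ _ _ (val z); set A' := chemical_dist _ _ _ _.
  rewrite (_ : _ - _ = lam * (A' - A)); last by ring.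
  by rewrite normrM (ger0_norm lam0) distrC.
have lip (u z : Lam) : graph_dist R adj (val u) (val z) <= rr ->
   `|psi u - psi z| <= lam * rr.
  move=> uz; rewrite lipE ler_wpM2l//; apply: le_trans uz.
  exact: (chemical_dist_lip_graph graph weights).
have psiH := box_davies graph weights deg lam0 (psi := psi).
have {}psiH := psiH _.
have edge (y0 z : Lam) : adj (val y0) (val z) ->
    `|psi y0 - psi z| <= lam * edge_length omega (val y0) (val z).
  by move=> yz; rewrite lipE ler_wpM2l//; exact: (chemical_dist_lip graph weights).
have {}psiH := psiH edge.
have := off_diagonal (box_weight_sym weights (Lam := Lam))
  (box_weight_ge0 weights (Lam := Lam)) (box_killing_ge0 graph weights (Lam := Lam))
  h0 H0 hH Q0 mvx mvy (lip xL) (lip yL) psiH.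
move=> /le_trans; apply; rewrite ler_wpM2l// ler_expR /psi/=.
rewrite (chemical_dist_refl graph omega) mulr0 oppr0 subr0.
rewrite (_ : 4 * (h * H) * N%:R = 4 * (h * N%:R) * H); last by ring.
by rewrite hN /H le_eqVlt; apply/orP; left; apply/eqP; field.
Qed.

(** On a ball of radius 0 the mean value inequality holds with [Q = 1], a point value being one
    summand of the L^2 norm. *)
Lemma heat_kernel_small_time (lam : R) : 0 <= lam ->
  heat_kernel Pr Y T t x y <= 2 * expR (- (lam * chemical_dist adj omega x y)
     + Cdeg * lam ^+ 2 * expR lam * t).
Proof.
move=> lam0.
have := @heat_kernel_davies 1 0 lam 0 ler01 (lexx _) lam0.
rewrite mul1r mulr0 mulr0 addr0; apply.
move=> Lam xL yL h N _ _ _ _ _ _ /=.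
have mv z : mean_value_at (box_weight omega (Lam := Lam))
    (box_killing adj omega (Lam := Lam)) h N
    (fun u w : Lam => graph_dist R adj (val u) (val w)) 0 1 z.
  move=> f L f0 fL; rewrite mul1r; apply: le_trans (fL N (leqnn N)).
  rewrite (bigD1 z)/=; last by rewrite graph_dist_refl.
  by rewrite lerDl; apply: sumr_ge0 => u _; rewrite sqr_ge0.
by split.
Qed.

End HeatKernel.

(** * Exponents *)

Section Exponents.
Variable R : realType.

(** For [p = +oo] any positive [a] will do, since the maximum dominates every moment; Hoelder's
    inequality is thus spared the exponent 0. The strict inequality on the exponents leaves room for
    such a choice. *)
Definition inverse_exponent (p : \bar R) (a : R) : Prop :=
  if p is r%:E%E then a = r^-1 else True.

Lemma exponents_choice (d' : R) (p q : \bar R) : 2 <= d' ->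
  (1 < p)%E -> (1 < q)%E -> (p^-1 + q^-1 < (2 / d')%R%:E)%E ->
  exists a b : R, [/\ [/\ 0 < a, 0 < b, a < 1 & b < 1], a + b < 2 / d',
    inverse_exponent p a & inverse_exponent q b].
Proof.
move=> d2; have d0 : 0 < d' by lra.
have dd0 : 0 < 2 / d' by rewrite divr_gt0.
have dd1 : 2 / d' <= 1 by rewrite ler_pdivrMr// mul1r.
have inv01 (r : R) : 1 < r -> 0 < r^-1 < 1.
  by move=> r1; rewrite invr_gt0 invf_lt1 ?r1 ?andbT// (lt_trans ltr01).
case: p => [r||]; case: q => [s||]; rewrite ?lte_fin//=.
- move=> r1 s1; have /andP[r0 r1'] := inv01 _ r1; have /andP[s0 s1'] := inv01 _ s1.
  rewrite !inver !gt_eqF ?(lt_trans ltr01)// -EFinD lte_fin => h.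
  by exists r^-1, s^-1.
- move=> r1 _; have /andP[r0 r1'] := inv01 _ r1.
  rewrite inver invey gt_eqF ?(lt_trans ltr01)// adde0 lte_fin => h.
  by exists r^-1, ((2 / d' - r^-1) / 2); split => //; [split|]; lra.
- move=> _ s1; have /andP[s0 s1'] := inv01 _ s1.
  rewrite inver invey gt_eqF ?(lt_trans ltr01)// add0e lte_fin => h.
  by exists ((2 / d' - s^-1) / 2), s^-1; split => //; [split|]; lra.
- move=> _ _ _; exists (2 / d' / 4), (2 / d' / 4); split => //; first split; lra.
Qed.

Lemma moment_of_avg_norm (V : choiceType) (p : \bar R) (a c : R) (A : set V) (f : V -> R) :
  finite_set A -> A !=set0 -> (forall z, 0 <= f z) -> 0 < a -> (1 < p)%E ->
  inverse_exponent p a -> 0 <= c -> avg_norm p A f <= c ->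
  \sum_(z \in A) f z `^ a^-1 <= (card_set A)%:R * c `^ a^-1.
Proof.
move=> finA [x0 Ax0] f0 a0 p1 pa c0.
have x0in : x0 \in fset_set A by rewrite in_fset_set ?inE.
have card0 : 0 < (card_set A)%:R :> R.
  by rewrite ltr0n /card_set cardfs_gt0; apply/fset0Pn; exists x0.
case: p p1 pa => [r||]//=.
  rewrite lte_fin => r1 ->; have r0 : 0 < r by lra.
  rewrite invrK; set S := \sum_(z \in A) `|f z| `^ r.
  have SE : \sum_(z \in A) f z `^ r = S.
    by apply: eq_fsbigr => z _; rewrite ger0_norm.
  have S0 : 0 <= S.
    by rewrite /S fsbig_finite//; apply: sumr_ge0 => z _; exact: powR_ge0.
  have X0 : 0 <= (card_set A)%:R^-1 * S by rewrite mulr_ge0// invr_ge0 ltW.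
  move=> h; rewrite SE -ler_pdivrMl//.
  rewrite [leLHS](_ : _ = (((card_set A)%:R^-1 * S) `^ r^-1) `^ r); last first.
    by rewrite -powRrM mulVf ?gt_eqF// powRr1.
  by rewrite ge0_ler_powR ?nnegrE ?powR_ge0// ltW.
move=> _ _ h; rewrite card_set_sum// fsbig_finite// [in leRHS]fsbig_finite//.
rewrite mulr_suml big_seq [leRHS]big_seq; apply: ler_sum => z zA.
rewrite mul1r ge0_ler_powR ?nnegrE ?invr_ge0 ?(ltW a0)//.
apply: le_trans h; rewrite -[leLHS]ger0_norm//.
elim: (enum_fset (fset_set A)) zA => [|w s IH]; first by rewrite in_nil.
rewrite inE big_cons => /predU1P[->|/IH h]; first by rewrite le_max lexx.
by rewrite le_max h orbT.
Qed.

Lemma avg_norm_le (V : choiceType) (adj : rel V) (p : \bar R) (f N : V -> R)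
    (m : R) (x : V) (n : nat) :
  sup_limsup_norm adj p f = m%:E -> norm_controlled_from adj p f N -> N x <= n%:R ->
  avg_norm p (gball adj x (n%:R : R)) f <= 2 * m.
Proof.
move=> sup ctrl Nn; rewrite -lee_fin.
apply: (@le_trans _ _ (ereal_sup [set (avg_norm p (gball adj x (k%:R : R)) f)%:E
               | k in [set k : nat | N x <= k%:R]])).
  by apply: ereal_sup_ubound; exists n.
apply: le_trans (ctrl x) _; rewrite EFinM lee_wpmul2l//.
by rewrite -sup; apply: ereal_sup_ubound; exists x.
Qed.

(** [lam] is nearly optimal for the quadratic exponent, and [c] makes [lam] so small that the term
    with [expR lam] takes only 1/16 of the gain. The cost [2 * (lam * rr)] of the balls is split by
    the arithmetic-geometric mean: a quarter of the gain and a constant below 4. *)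
Lemma exponent_gaussian (C K t rr c lam : R) : 1 <= C -> 0 < t -> 0 <= K -> K <= t ->
  0 <= rr -> rr ^+ 2 <= t ->
  c = (32 * C)^-1 -> lam = c * (K / t) ->
  - (lam * K) + 2 * (lam * rr) + C * lam ^+ 2 * expR lam * t
  <= 4 - c / 2 * K ^+ 2 / t.
Proof.
move=> C1 t0 K0 Kt rr0 rrt cE lamE.
have C0 : 0 < C by lra.
have c0 : 0 < c by rewrite cE invr_gt0 mulr_gt0.
have Cc : C * c = 32^-1 by rewrite cE; field; rewrite gt_eqF.
have c1 : c <= 32^-1 by rewrite cE lef_pV2 ?posrE ?mulr_gt0//; lra.
have Kt0 : 0 <= K / t by rewrite divr_ge0// ltW.
have Kt1 : K / t <= 1 by rewrite ler_pdivrMr// mul1r.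
have lam0 : 0 <= lam by rewrite lamE mulr_ge0// ltW.
have lam1 : lam <= 2^-1 by rewrite lamE; nra.
have e2 : expR lam <= 2.
  by apply: le_trans (expR_half_le2 R); rewrite ler_expR.
have X0 : 0 <= K ^+ 2 / t by rewrite divr_ge0 ?sqr_ge0// ltW.
have tN0 : t != 0 by rewrite gt_eqF.
have h1 : lam * K = c * (K ^+ 2 / t) by rewrite lamE; field.
have h2 : C * lam ^+ 2 * expR lam * t <= c / 16 * (K ^+ 2 / t).
  rewrite (_ : C * lam ^+ 2 * expR lam * t = (C * c) * c * (K ^+ 2 / t) * expR lam); last first.
    by rewrite lamE; field.
  rewrite Cc; have : 0 <= 32^-1 * c * (K ^+ 2 / t) by rewrite mulr_ge0// mulr_ge0// ltW.
  by move=> p0; apply: le_trans (ler_wpM2l p0 e2) _; lra.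
have h3 : 2 * (lam * rr) <= c * (K ^+ 2 / t / 4 + 4).
  rewrite lamE -!mulrA mulrCA ler_pM2l//.
  have sq : 0 <= (K / 2 - 2 * rr) ^+ 2 / t by rewrite divr_ge0 ?sqr_ge0// ltW.
  have rt : rr ^+ 2 / t <= 1 by rewrite ler_pdivrMr// mul1r.
  have e : (K / 2 - 2 * rr) ^+ 2 / t =
     K ^+ 2 * (t^-1 / 4) + 4 * (rr ^+ 2 / t) - 2 * (K * (t^-1 * rr)) by field.
  lra.
rewrite h1 (_ : c / 2 * K ^+ 2 / t = c / 2 * (K ^+ 2 / t)); last by rewrite mulrA.
have := mulr_ge0 (ltW c0) X0; nra.
Qed.

(** Writing [l] for the maximum, [expR l] is at most [4 * (K / t)] and [lam <= l / 2], so
    [l * expR lam] is at most [8 * (K / t)]. Each of the two error terms then costs a quarter of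
    [lam * K]. *)
Lemma exponent_poisson (C K t rr c lam : R) : 1 <= C -> 0 < t -> t <= K -> 0 <= rr ->
  rr <= t / 8 ->
  c = (32 * C)^-1 -> lam = c * Num.max 1 (ln (K / t)) ->
  - (lam * K) + 2 * (lam * rr) + C * lam ^+ 2 * expR lam * t
  <= - (c / 2 * K * Num.max 1 (ln (K / t))).
Proof.
move=> C1 t0 tK rr0 rrt cE; set l := Num.max _ _ => lamE.
have C0 : 0 < C by lra.
have c0 : 0 < c by rewrite cE invr_gt0 mulr_gt0.
have Cc : C * c = 32^-1 by rewrite cE; field; rewrite gt_eqF.
have c1 : c <= 32^-1 by rewrite cE lef_pV2 ?posrE ?mulr_gt0//; lra.
have K0 : 0 < K by lra.
have Kt0 : 0 < K / t by rewrite divr_gt0.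
have Kt1 : 1 <= K / t by rewrite ler_pdivlMr// mul1r.
have l1 : 1 <= l by rewrite le_max lexx.
have lam0 : 0 <= lam by rewrite lamE mulr_ge0//; lra.
have el : expR l <= 4 * (K / t).
  rewrite /l; case: (leP 1 (ln (K / t))) => _.
    by rewrite lnK ?posrE//; lra.
  have e4 : expR (1 : R) <= 4.
    have h := expR_half_le2 R; have e0 := expR_ge0 (2^-1 : R).
    rewrite (_ : 1 = 2^-1 + 2^-1 :> R) ?expRD; last by field.
    nra.
  lra.
have le_exp : l * expR lam <= 2 * expR l.
  have h1 : l / 2 <= expR (l / 2) by have := expR_ge1Dx (l / 2); lra.
  have h2 : expR lam <= expR (l / 2).
    by rewrite ler_expR lamE; nra.
  have -> : expR l = expR (l / 2) * expR (l / 2) by rewrite -expRD; congr expR; field.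
  have p0 := expR_gt0 (l / 2); have p1 := expR_gt0 lam.
  have : l / 2 * expR lam <= expR (l / 2) * expR (l / 2).
    by apply: ler_pM; rewrite ?(ltW p1)//; lra.
  lra.
have h2 : C * lam ^+ 2 * expR lam * t <= lam * K / 4.
  have -> : C * lam ^+ 2 * expR lam * t = lam * ((C * c) * (l * expR lam) * t).
    by rewrite lamE; ring.
  rewrite -[leRHS]mulrA ler_wpM2l// Cc.
  have : l * expR lam * t <= 8 * K.
    have h : l * expR lam <= 2 * (4 * (K / t)) by lra.
    have := ler_wpM2r (ltW t0) h; rewrite (_ : 2 * (4 * (K / t)) * t = 8 * K) //.
    by field; rewrite gt_eqF.
  lra.
have h3 : 2 * (lam * rr) <= lam * K / 4.
  have : lam * rr <= lam * (K / 8) by rewrite ler_wpM2l//; lra.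
  lra.
have -> : c / 2 * K * l = lam * K / 2 by rewrite lamE; field.
lra.
Qed.

End Exponents.

(** * Prefactor in terms of [t] and the graph distance *)

Section HeatKernelPrefactor.
Variables (R : realType) (d d' : R) (p q : \bar R) (a b : R).
Hypotheses (hd : 2 <= d) (hd' : d <= d') (hp : (1 < p)%E) (hq : (1 < q)%E).
Hypotheses (ab_bounds : [/\ 0 < a, 0 < b, a < 1 & b < 1]) (ab_lt : a + b < 2 / d').
Hypotheses (pa : inverse_exponent p a) (qb : inverse_exponent q b).
Let eps : R := 2 - a - b - 2 * ((d' - 1) / d').
Let g : R := 2 / (eps * (1 - a)).
Variables (Creg CS1 Cdeg mubar nubar : R).
Hypotheses (Creg0 : 0 < Creg) (CS0 : 0 < CS1) (Cdeg1 : 1 <= Cdeg).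
(** The factor 2 is the one in the definition of [N]; the maximum with 1 lets the constant weight 1
    satisfy the same moment bound. *)
Let cmu : R := Num.max 1 (2 * mubar).
Let cnu : R := Num.max 1 (2 * nubar).
Let Cb : R := box_mean_const d' a b CS1 Creg cmu cnu.
Let Cpre : R := Cb * 4 `^ g + 64 `^ (d / 2).
Variables (V : choiceType) (adj : rel V) (N1 N2 : V -> R)
  (omega : V -> V -> R) (N : V -> R).
Variables (dOmega : measure_display) (Omega : measurableType dOmega)
  (P : V -> probability Omega R) (Y : nat -> Omega -> V) (T : nat -> Omega -> R).
Hypotheses (graph : infinite_graph adj) (vol : volume_regular adj d Creg N1)
  (sob : isoperimetric_sobolev adj d d' CS1 N2) (deg : bounded_degree adj Cdeg)
  (weights : edge_weights adj omega).
Hypotheses (mu_sup : sup_limsup_norm adj p (mu adj omega) = mubar%:E)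
  (nu_sup : sup_limsup_norm adj q (nu adj omega) = nubar%:E)
  (mu_ctl : norm_controlled_from adj p (mu adj omega) N)
  (nu_ctl : norm_controlled_from adj q (nu adj omega) N)
  (walk : variable_speed_walk adj omega P Y T).
Variables (t : R) (x y : V).
Hypotheses (t0 : 0 < t)
  (tN : Num.max (N x) (2 * Num.max (N1 x) (N2 x)) <= Num.sqrt t).
Let D := graph_dist R adj x y.
Let K := chemical_dist adj omega x y.

Lemma growth_exponent_ge0 : 0 <= g.
Proof.
case: ab_bounds => a0 b0 a1 b1.
have e0 : 0 < eps by exact: (eps_gt0 hd hd' ab_lt).
by apply: divr_ge0 => //; apply: mulr_ge0; [exact: ltW|rewrite subr_ge0 ltW].
Qed.

Lemma distance_factor_ge1 : 1 <= 1 + D / Num.sqrt t.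
Proof.
by rewrite lerDl divr_ge0 ?sqrtr_ge0//; exact: (graph_dist_ge0 R graph x y).
Qed.

Lemma nu_ge0 z : 0 <= nu adj omega z.
Proof.
by apply: fsumr_ge0 => w; rewrite invr_ge0 (omega_ge0 weights).
Qed.

(* [n] exceeds both [sqrt t] and the distance, but only by a bounded factor times
   [1 + D / sqrt t]. *)
Lemma radius_choice : 64 <= t -> exists n : nat,
  [/\ D + Num.sqrt t <= n%:R, n%:R <= D + 2 * Num.sqrt t & (0 < n)%N].
Proof.
move=> t64; have D0 : 0 <= D by exact: (graph_dist_ge0 R graph x y).
have s1 : 1 <= Num.sqrt t by rewrite -sqrtr1 ler_sqrt; lra.
exists (Num.truncn (D + Num.sqrt t)).+1; split => //.
  by rewrite ltW// truncnS_gt.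
have : (Num.truncn (D + Num.sqrt t))%:R <= D + Num.sqrt t.
  by rewrite truncn_le// addr_ge0 ?sqrtr_ge0.
by rewrite -natr1; lra.
Qed.

(** [rr] is existential because small and large times use different radii. Its three bounds hold in
    both cases: [rr ^+ 2 <= t] serves the Gaussian regime, [rr <= t / 8] the other one. *)
Lemma heat_kernel_prefactor (lam : R) : 0 <= lam -> exists rr,
  [/\ 0 <= rr, rr ^+ 2 <= t, rr <= t / 8 &
   heat_kernel P Y T t x y <= 2 * (Cpre * t `^ (- (d / 2)) * (1 + D / Num.sqrt t) `^ g *
     expR (- (lam * K) + 2 * (lam * rr) + Cdeg * lam ^+ 2 * expR lam * t))].
Proof.
move=> lam0; have D0 : 0 <= D by exact: (graph_dist_ge0 R graph x y).
have base := distance_factor_ge1; have g0 := growth_exponent_ge0; have C0 : 0 <= Cb by exact: box_mean_const_ge0.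
have s0 : 0 < Num.sqrt t by rewrite sqrtr_gt0.
have ss : Num.sqrt t * Num.sqrt t = t by rewrite -expr2 sqr_sqrtr// ltW.
have Cp : Cb * 4 `^ g <= Cpre /\ 64 `^ (d / 2) <= Cpre.
  by rewrite /Cpre lerDl lerDr powR_ge0 mulr_ge0 ?powR_ge0.
have [Cp1 Cp2] := Cp; have e0 := @expR_ge0 R.
(* 64 is the threshold from which [sqrt t <= t / 8]. Below it the missing power of [t] is paid by
   the second summand of [Cpre]. *)
case: (leP 64 t) => t64; last first.
  exists 0; split; rewrite ?expr0n ?mulr0 ?addr0 ?(ltW t0)//; first by rewrite divr_ge0 ?(ltW t0).
  apply: (le_trans (heat_kernel_small_time graph weights walk x y t0 Cdeg1 deg lam0)).
  rewrite ler_wpM2l// ler_peMl//.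
  have h : 1 <= (1 + D / Num.sqrt t) `^ g by rewrite -[leLHS](powRr0 (1 + D / Num.sqrt t)) ler_powR.
  rewrite -[leLHS]mulr1 ler_pM//.
  apply: (@le_trans _ _ (64 `^ (d / 2) * t `^ (- (d / 2)))); last by rewrite ler_wpM2r ?powR_ge0.
  rewrite powRN ler_pdivlMr ?powR_gt0// mul1r ge0_ler_powR ?nnegrE ?(ltW t64) ?(ltW t0)//.
  by rewrite divr_ge0// (le_trans _ hd).
(* Parabolic scaling: [rr ^+ 2] has to equal the time [h * M = t / 2] of the mean value
   inequality. *)
pose rr := Num.sqrt (t / 2).
have rrE : rr ^+ 2 = t / 2 by rewrite sqr_sqrtr// divr_ge0// ltW.
have rr1 : 1 <= rr by rewrite -[leLHS]sqrtr1 ler_sqrt; lra.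
have s8 : 8 <= Num.sqrt t.
  by rewrite -(@ler_pXn2r _ 2) ?nnegrE ?sqrtr_ge0// sqr_sqrtr ?(ltW t0)//; lra.
have rrs : rr <= Num.sqrt t by rewrite ler_sqrt//; lra.
have st8 : Num.sqrt t <= t / 8.
  by rewrite -[in leRHS]ss; have := ler_wpM2r (ltW s0) s8; lra.
exists rr; split; [lra|rewrite rrE; lra|lra|].
have [n [n1 n2 n0]] := radius_choice t64.
have n_gt0 : 0 < (n%:R : R) by rewrite ltr0n.
move: tN; rewrite ge_max => /andP[Nx]; rewrite -ler_pdivlMl// ge_max => /andP[N1x N2x].
have Nn : N x <= n%:R by lra.
have N1n : N1 x <= n%:R by lra.
have N2n : N2 x <= n%:R by lra.
have cmu1 : 1 <= cmu by rewrite /cmu le_max lexx.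
have cnu0 : 0 <= cnu by rewrite /cnu (le_trans ler01)// le_max lexx.
case: (ab_bounds) => a0 b0 a1 b1.
have finB := finite_gball graph x (n%:R : R).
have B0 : gball adj x (n%:R : R) !=set0.
  by exists x; rewrite /gball /= (graph_dist_refl R graph x).
have mu_mom := moment_of_avg_norm finB B0
  (fun z => ltW (mu_gt0 graph weights z)) a0 hp pa (le_trans ler01 cmu1)
  (le_trans (avg_norm_le mu_sup mu_ctl Nn) _).
have nu_mom := moment_of_avg_norm finB B0 nu_ge0 b0 hq qb cnu0
  (le_trans (avg_norm_le nu_sup nu_ctl Nn) _).
have [_ volB] := vol N1n.
pose Q := Cb * n%:R `^ (- d) * (n%:R / rr) `^ g.
have Q0 : 0 <= Q by apply: mulr_ge0; [apply: mulr_ge0 => //|]; exact: powR_ge0.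
apply: (le_trans (heat_kernel_davies (Q := Q) (rr := rr) (n := n) graph weights walk
  (x := x) (y := y) t0 Cdeg1 deg Q0 _ lam0 _)); first by lra.
  move=> Lam xL yL h M xE yE sub h0 h1 hM mv.
  have ball_sub z : gball adj x (n%:R : R) z -> z \in Lam.
    by move=> zB; apply: sub; rewrite /gball/= (le_trans zB)// ler_nat.
  have nbr_sub z w : gball adj x (n%:R : R) z -> adj z w -> w \in Lam.
    move=> zB zw; apply: sub; rewrite /gball/=.
    apply: (le_trans (graph_dist_triangle R graph x z w)).
    by rewrite -natr1 lerD// (graph_dist_adj R graph zw).
  have hr : h * M%:R = rr ^+ 2 by rewrite rrE.
  split; apply: (box_mean_value_at hd hd' ab_bounds ab_lt CS0 Creg0 cmu1 cnu0
    graph weights sob N2n n0 ball_sub nbr_sub volB (mu_mom _) (nu_mom _) h0 h1 rr1 hr).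
  - by rewrite /cmu le_max lexx orbT.
  - by rewrite /cnu le_max lexx orbT.
  - by rewrite xE (graph_dist_refl R graph x) add0r; lra.
  - by rewrite /cmu le_max lexx orbT.
  - by rewrite /cnu le_max lexx orbT.
  - by rewrite yE -/D; lra.
rewrite ler_wpM2l// ler_wpM2r//.
apply: (@le_trans _ _ (Cb * 4 `^ g * t `^ (- (d / 2)) * (1 + D / Num.sqrt t) `^ g)); last first.
  by rewrite ler_wpM2r ?powR_ge0// ler_wpM2r ?powR_ge0.
have -> : Cb * 4 `^ g * t `^ (- (d / 2)) * (1 + D / Num.sqrt t) `^ g =
  Cb * t `^ (- (d / 2)) * (4 * (1 + D / Num.sqrt t)) `^ g.
  rewrite (powRM _ (ler0n _ 4) (le_trans ler01 base)).
  by move: (Cb) (4 `^ g) (t `^ _) (_ `^ g) => *; ring.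
rewrite /Q; apply: ler_pM; rewrite ?powR_ge0//; [exact: mulr_ge0 C0 (powR_ge0 _ _)|apply: ler_wpM2l => //|].
  have -> : t `^ (- (d / 2)) = Num.sqrt t `^ (- d).
    by rewrite -{1}ss -expr2 -powR_mulrn ?(ltW s0)// -powRrM; congr powR; field.
  rewrite !powRN lef_pV2 ?posrE ?powR_gt0// ge0_ler_powR ?nnegrE ?(ltW s0) ?(ltW n_gt0)//; last by lra.
  by move: hd; lra.
rewrite ge0_ler_powR ?nnegrE//; [by rewrite divr_ge0 ?(ltW n_gt0)//; lra|by lra|].
(* Together with [n <= 2 * (D + sqrt t)] this gives [n / rr <= 4 * (1 + D / sqrt t)], the origin of
   the power of 4 in [Cpre]. *)
have rh : Num.sqrt t / 2 <= rr.
  rewrite -(@ler_pXn2r _ 2) ?nnegrE ?divr_ge0 ?sqrtr_ge0// rrE expr2 mulf_div ss; lra.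
rewrite ler_pdivrMr; last by lra.
have -> : 4 * (1 + D / Num.sqrt t) * rr = (D + Num.sqrt t) * (4 * rr / Num.sqrt t).
  by field; rewrite gt_eqF.
apply: (@le_trans _ _ ((D + Num.sqrt t) * 2)); first by lra.
rewrite ler_wpM2l//; first by lra.
by rewrite ler_pdivlMr//; lra.
Qed.
End HeatKernelPrefactor.

Theorem theorem1p10 (R : realType) (d d' : R) (p q : \bar R)
    (hd : 2 <= d) (hd' : d <= d') (hp : (1 < p)%E) (hq : (1 < q)%E)
    (hpq : (p^-1 + q^-1 < (2 / d')%R%:E)%E) :
  exists gamma : R,
  forall Creg CS1 Cdeg mubar nubar : R,
    0 < Creg -> 0 < CS1 -> 1 <= Cdeg ->
  exists c5 c6 c7 c8 : R,
    [/\ 0 < c5, 0 < c6, 0 < c7 & 0 < c8] /\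
  forall (V : choiceType) (adj : rel V) (N1 N2 : V -> R)
         (omega : V -> V -> R) (N : V -> R)
         (dOmega : measure_display) (Omega : measurableType dOmega)
         (P : V -> probability Omega R)
         (Y : nat -> Omega -> V) (T : nat -> Omega -> R),
    infinite_graph adj ->
    volume_regular adj d Creg N1 ->
    isoperimetric_sobolev adj d d' CS1 N2 ->
    bounded_degree adj Cdeg ->
    edge_weights adj omega ->
    sup_limsup_norm adj p (mu adj omega) = mubar%:E ->
    sup_limsup_norm adj q (nu adj omega) = nubar%:E ->
    norm_controlled_from adj p (mu adj omega) N ->
    norm_controlled_from adj q (nu adj omega) N ->
    variable_speed_walk adj omega P Y T ->
  forall (t : R) (x : V), 0 < t ->
    Num.max (N x) (2 * Num.max (N1 x) (N2 x)) <= Num.sqrt t ->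
  forall y : V,
    (chemical_dist adj omega x y <= c5 * t ->
       heat_kernel P Y T t x y
       <= c6 * t `^ (- (d / 2))
          * (1 + graph_dist R adj x y / Num.sqrt t) `^ gamma
          * expR (- (c7 * chemical_dist adj omega x y ^+ 2 / t)))
    /\
    (c5 * t <= chemical_dist adj omega x y ->
       heat_kernel P Y T t x y
       <= c6 * t `^ (- (d / 2))
          * (1 + graph_dist R adj x y / Num.sqrt t) `^ gamma
          * expR (- (c8 * chemical_dist adj omega x y
                     * Num.max 1 (ln (chemical_dist adj omega x y / t))))).
Proof.
have hd2 : 2 <= d' by exact: le_trans hd hd'.
have [a [b [ab_bounds ab_lt pa qb]]] := exponents_choice hd2 hp hq hpq.
pose eps : R := 2 - a - b - 2 * ((d' - 1) / d').
pose g : R := 2 / (eps * (1 - a)); exists g => Creg CS1 Cdeg mubar nubar Creg0 CS0 Cdeg1.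
pose Cb := box_mean_const d' a b CS1 Creg (Num.max 1 (2 * mubar)) (Num.max 1 (2 * nubar)).
pose Cpre := Cb * 4 `^ g + 64 `^ (d / 2).
pose c : R := (32 * Cdeg)^-1.
have Cd0 : 0 < Cdeg by lra.
have c0 : 0 < c by rewrite invr_gt0; lra.
have Cpre0 : 0 < Cpre.
  apply: ltr_wpDl; last by rewrite powR_gt0.
  apply: mulr_ge0; last exact: powR_ge0.
  exact: box_mean_const_ge0.
have e4 : 1 <= expR (4 : R) by rewrite -expR0 ler_expR.
(* With [c5 = 1] the regimes meet where the chemical distance equals [t]. The factor 2 comes from
   [heat_kernel_le], and [expR 4] from the additive constant in [exponent_gaussian]. *)
exists 1, (2 * expR 4 * Cpre), (c / 2), (c / 2); split.
  by split; [exact: ltr01|apply: mulr_gt0 => //; rewrite mulr_gt0 ?expR_gt0//| |]; lra.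
move=> V adj N1 N2 omega N dOmega Omega P Y T graph vol sob deg weights.
move=> mu_sup nu_sup mu_ctl nu_ctl walk t x t0 tN y.
set K := chemical_dist adj omega x y; set B := (1 + _ / _) `^ g.
have K0 : 0 <= K by exact: (chemical_dist_ge0 graph omega x y).
have pre := heat_kernel_prefactor hd hd' hp hq ab_bounds ab_lt pa qb Creg0 CS0 Cdeg1 graph vol sob
  deg weights mu_sup nu_sup mu_ctl nu_ctl walk y t0 tN.
have fin (X Z : R) : X <= 4 + Z -> 2 * (Cpre * t `^ (- (d / 2)) * B * expR X) <=
    2 * expR 4 * Cpre * t `^ (- (d / 2)) * B * expR Z.
  move=> XZ; have -> : 2 * expR 4 * Cpre * t `^ (- (d / 2)) * B * expR Z =
    2 * (Cpre * t `^ (- (d / 2)) * B * (expR 4 * expR Z)) by ring.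
  rewrite -expRD ler_wpM2l// ler_wpM2l ?ler_expR//.
  by rewrite !mulr_ge0 ?powR_ge0 ?(ltW Cpre0).
rewrite mul1r; split => Kt.
  have lam0 : 0 <= c * (K / t) by rewrite mulr_ge0 ?(ltW c0)// divr_ge0// ltW.
  have [rr [rr0 rr2 _ hk]] := pre _ lam0; apply: (le_trans hk); apply: fin.
  exact: (exponent_gaussian Cdeg1 t0 K0 Kt rr0 rr2).
have lam0 : 0 <= c * Num.max 1 (ln (K / t)).
  by rewrite mulr_ge0 ?(ltW c0)// le_max ler01.
have [rr [rr0 _ rr8 hk]] := pre _ lam0; apply: (le_trans hk); apply: fin.
by apply: (le_trans (exponent_poisson Cdeg1 t0 Kt rr0 rr8 erefl erefl)); rewrite lerDr.
Qed.
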